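(* Let $k$ be an algebraically closed field of characteristic $0$. Let $w$ be a foliation of degree $2$ of $\mathbf{P}^2_k$ whose singular locus does not contain a double curve, and write $$w=\sum_{\alpha}a_\alpha w^1_\alpha+\sum_\beta b_\beta w^2_\beta+\sum_\gamma c_\gamma w^3_\gamma$$ in the basis given in the context. Then the associated curve $\Phi(w)$ on the dual plane $\check{\mathbf{P}}^2_k$, parameterizing the lines tangent to $w$ with multiplicity at least $2$, is the quartic with equation \begin{align*} &\Big(c_{(2,0)}c_{(0,2)}-\tfrac{c_{(1,1)}^2}{4}\Big)\check{x}^4 +\Big(\tfrac{c_{(1,1)}b_{(0,1,1)}}{2}-c_{(0,2)}b_{(0,2,0)}-c_{(2,0)}b_{(0,0,2)}\Big)\check{x}^3\check{y}\\ &+\Big(b_{(0,2,0)}b_{(0,0,2)}+c_{(0,2)}b_{(1,1,0)}-\tfrac{b_{(0,1,1)}^2}{4}-\tfrac{c_{(1,1)}b_{(1,0,1)}}{2}\Big)\check{x}^2\check{y}^2\\ &+\Big(\tfrac{b_{(1,0,1)}b_{(0,1,1)}}{2}-c_{(0,2)}b_{(2,0,0)}-b_{(0,0,2)}b_{(1,1,0)}\Big)\check{x}\check{y}^3 +\Big(b_{(2,0,0)}b_{(0,0,2)}-\tfrac{b_{(1,0,1)}^2}{4}\Big)\check{y}^4\\ &+\Big(c_{(0,2)}a_{(0,2,0)}+c_{(2,0)}a_{(0,0,2)}-\tfrac{c_{(1,1)}a_{(0,1,1)}}{2}\Big)\check{x}^3\check{z}\\ &+\Big(\tfrac{c_{(1,1)}a_{(1,0,1)}}{2}+\tfrac{b_{(0,1,1)}a_{(0,1,1)}}{2}+c_{(2,0)}b_{(1,0,1)}-\tfrac{c_{(1,1)}b_{(1,1,0)}}{2}-b_{(0,0,2)}a_{(0,2,0)}\\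 &\qquad-b_{(0,2,0)}a_{(0,0,2)}-c_{(0,2)}a_{(1,1,0)}\Big)\check{x}^2\check{y}\check{z}\\ &+\Big(\tfrac{b_{(1,1,0)}b_{(0,1,1)}}{2}+c_{(0,2)}a_{(2,0,0)}+b_{(1,1,0)}a_{(0,0,2)}+b_{(0,0,2)}a_{(1,1,0)}+c_{(1,1)}b_{(2,0,0)}\\ &\qquad-\tfrac{b_{(0,1,1)}a_{(1,0,1)}}{2}-\tfrac{b_{(1,0,1)}a_{(0,1,1)}}{2}-b_{(0,2,0)}b_{(1,0,1)}\Big)\check{x}\check{y}^2\check{z}\\ &+\Big(\tfrac{b_{(1,1,0)}b_{(1,0,1)}}{2}+\tfrac{b_{(1,0,1)}a_{(1,0,1)}}{2}-b_{(2,0,0)}b_{(0,1,1)}-b_{(0,0,2)}a_{(2,0,0)}-b_{(2,0,0)}a_{(0,0,2)}\Big)\check{y}^3\check{z}\\ &+\Big(a_{(0,2,0)}a_{(0,0,2)}+\tfrac{c_{(1,1)}a_{(1,1,0)}}{2}-\tfrac{a_{(0,1,1)}^2}{4}-c_{(2,0)}a_{(1,0,1)}\Big)\check{x}^2\check{z}^2\\ &+\Big(\tfrac{a_{(1,0,1)}a_{(0,1,1)}}{2}+b_{(1,0,1)}a_{(0,2,0)}+b_{(0,2,0)}a_{(1,0,1)}-\tfrac{b_{(0,1,1)}a_{(1,1,0)}}{2}-\tfrac{b_{(1,1,0)}a_{(0,1,1)}}{2}\\ &\qquad-c_{(2,0)}b_{(2,0,0)}-c_{(1,1)}a_{(2,0,0)}-a_{(0,0,2)}a_{(1,1,0)}\Big)\check{x}\check{y}\check{z}^2\\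 &+\Big(b_{(2,0,0)}b_{(0,2,0)}+b_{(0,1,1)}a_{(2,0,0)}+a_{(2,0,0)}a_{(0,0,2)}+b_{(2,0,0)}a_{(0,1,1)}-\tfrac{b_{(1,1,0)}^2}{4}-\tfrac{a_{(1,0,1)}^2}{4}\\ &\qquad-\tfrac{b_{(1,0,1)}a_{(1,1,0)}}{2}-\tfrac{b_{(1,1,0)}a_{(1,0,1)}}{2}\Big)\check{y}^2\check{z}^2\\ &+\Big(\tfrac{a_{(1,1,0)}a_{(0,1,1)}}{2}+c_{(2,0)}a_{(2,0,0)}-a_{(0,2,0)}a_{(1,0,1)}\Big)\check{x}\check{z}^3\\ &+\Big(\tfrac{b_{(1,1,0)}a_{(1,1,0)}}{2}+\tfrac{a_{(1,1,0)}a_{(1,0,1)}}{2}-b_{(0,2,0)}a_{(2,0,0)}-b_{(2,0,0)}a_{(0,2,0)}-a_{(2,0,0)}a_{(0,1,1)}\Big)\check{y}\check{z}^3\\ &+\Big(a_{(2,0,0)}a_{(0,2,0)}-\tfrac{a_{(1,1,0)}^2}{4}\Big)\check{z}^4=0 . \end{align*} In particular, these coefficients give the rational map $\Phi:\mathbf{F}_2\dashrightarrow\mathbf{C}_4$ in coordinates.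
   Context: Foliations. A foliation of degree $2$ of $\mathbf{P}^2_k$ is, up to a nonzero constant, a nonzero section of $T_{\mathbf{P}^2_k}(1)$, given by a homogeneous vector field $F\partial_x+G\partial_y+H\partial_z$ with $F,G,H\in k[x,y,z]$ homogeneous of degree $2$ (unique up to adding a multiple of the Euler field $x\partial_x+y\partial_y+z\partial_z$). Equivalently it is given by the nonzero homogeneous form $w=A\,dx+B\,dy+C\,dz$ with $A=yH-zG$, $B=zF-xH$, $C=xG-yF$; the forms arising are exactly those with $A,B,C$ homogeneous of degree $3$ and $xA+yB+zC=0$. These forms constitute a vector space with basis $$w^1_\alpha=x^{\alpha_1}y^{\alpha_2}z^{\alpha_3}(-y\,dx+x\,dy),\quad w^2_\beta=x^{\beta_1}y^{\beta_2}z^{\beta_3}(-z\,dx+x\,dz),\quad w^3_\gamma=y^{\gamma_2}z^{\gamma_3}(-z\,dy+y\,dz),$$ where $\alpha=(\alpha_1,\alpha_2,\alpha_3)$ and $\beta=(\beta_1,\beta_2,\beta_3)$ run through the triples, and $\gamma=(\gamma_2,\gamma_3)$ through the pairs, of nonnegative integers with sum $2$. The coefficients $a_\alpha,b_\beta,c_\gamma\in k$ are homogeneous coordinates of the space $\mathbf{F}_2\cong\mathbf{P}^{14}_k$ of foliations of degree $2$. The singular locus of $w$ is the subscheme $A=B=C=0$ of $\mathbf{P}^2_k$; it contains a double curve if it contains, as a subscheme, $2Z$ for some plane curve $Z$, i.e. if $A,B,C$ are all divisible by the square of a nonconstant homogeneous polynomial. The map $\Phi$. Let $\check x,\check y,\check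 z$ be the coordinates of the dual plane $\check{\mathbf{P}}^2_k$ dual to $x,y,z$, so that $(\check x:\check y:\check z)$ corresponds to the line $\check x x+\check y y+\check z z=0$. Let $V\subset\mathbf{P}^2_k\times\check{\mathbf{P}}^2_k$ be the subscheme given by $\check x x+\check y y+\check z z=0$ and $\check x F+\check y G+\check z H=0$; it parameterizes the pairs $(P,L)$ where $L$ is a line and $P\in L$ is a point where the foliation is singular or tangent to $L$. Let $\pi:V\to\check{\mathbf{P}}^2_k$ be the projection, and $D\subseteq V$ the degeneracy locus of the natural map $\pi^*\Omega^1_{\check{\mathbf{P}}^2_k}\to\Omega^1_V$ (defined by the zeroth Fitting ideal of $\Omega^1_{V/\check{\mathbf{P}}^2_k}$). The curve of lines tangent to the foliation with multiplicity at least $2$ is the curve $\Phi(w)\subset\check{\mathbf{P}}^2_k$, counted with multiplicities, such that $\pi_*[D]=[\Phi(w)]$. This defines a rational map $\Phi:\mathbf{F}_2\dashrightarrow\mathbf{C}_4$, where $\mathbf{C}_4$ is the projective space of plane quartic curves (here in $\check{\mathbf{P}}^2_k$).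
   Formalization: The equality of cycles π_*[D]=[quartic] is asserted only when D has dimension at most 1 (it fails e.g. for a smooth conic times x dy − y dx); for every w without double curve, Φ(w) is read as the value at w of the rational map Φ, which is proved to be defined there. *)

(* Defs.v *)
From HB Require Import structures.
From mathcomp Require Import all_boot all_order all_algebra.
From mathcomp Require Import mpoly.
From mathcomp Require Import ring.

Set Implicit Arguments.
Unset Strict Implicit.
Unset Printing Implicit Defensive.

Import GRing.Theory.

Local Open Scope ring_scope.

(* Coordinates on the space of foliations: a point is given by 15 scalars,
   first the a_alpha (alpha running through exps3), then the b_beta, then the
   c_gamma.  The scalars live in an arbitrary ring so that the generic point
   w = ('X_0, ..., 'X_14) is also covered. *)
Definition exps3 : seq (nat * nat * nat) :=
  [:: (2, 0, 0); (1, 1, 0); (1, 0, 1); (0, 2, 0); (0, 1, 1); (0, 0, 2)]%N.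
Definition exps2 : seq (nat * nat) := [:: (2, 0); (1, 1); (0, 2)]%N.

Section Coordinates.
Variable R : Type.
Implicit Type w : 'I_15 -> R.

Definition acoef w (i j l : nat) : R := w (inord (index (i, j, l) exps3)).
Definition bcoef w (i j l : nat) : R := w (inord (6 + index (i, j, l) exps3)).
Definition ccoef w (j l : nat) : R := w (inord (12 + index (j, l) exps2)).

End Coordinates.

Definition vec3 (T : nzRingType) (p q r : T) : 'rV[T]_3 :=
  \row_(i < 3) [:: p; q; r]`_i.

Definition x0 : 'I_3 := inord 0.
Definition x1 : 'I_3 := inord 1.
Definition x2 : 'I_3 := inord 2.

Section Quartic.
Variables (R : comUnitRingType) (w : 'I_15 -> R).

Local Notation a := (acoef w).
Local Notation b := (bcoef w).
Local Notation c := (ccoef w).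

Definition quartic : {mpoly R[3]} :=
  let X := 'X_x0 in let Y := 'X_x1 in let Z := 'X_x2 in
  (c 2 0 * c 0 2 - c 1 1 ^+ 2 / 4%:R) *: X ^+ 4
  + (c 1 1 * b 0 1 1 / 2%:R - c 0 2 * b 0 2 0 - c 2 0 * b 0 0 2)
      *: (X ^+ 3 * Y)
  + (b 0 2 0 * b 0 0 2 + c 0 2 * b 1 1 0 - b 0 1 1 ^+ 2 / 4%:R
     - c 1 1 * b 1 0 1 / 2%:R) *: (X ^+ 2 * Y ^+ 2)
  + (b 1 0 1 * b 0 1 1 / 2%:R - c 0 2 * b 2 0 0 - b 0 0 2 * b 1 1 0)
      *: (X * Y ^+ 3)
  + (b 2 0 0 * b 0 0 2 - b 1 0 1 ^+ 2 / 4%:R) *: Y ^+ 4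
  + (c 0 2 * a 0 2 0 + c 2 0 * a 0 0 2 - c 1 1 * a 0 1 1 / 2%:R)
      *: (X ^+ 3 * Z)
  + (c 1 1 * a 1 0 1 / 2%:R + b 0 1 1 * a 0 1 1 / 2%:R + c 2 0 * b 1 0 1
     - c 1 1 * b 1 1 0 / 2%:R - b 0 0 2 * a 0 2 0
     - b 0 2 0 * a 0 0 2 - c 0 2 * a 1 1 0) *: (X ^+ 2 * Y * Z)
  + (b 1 1 0 * b 0 1 1 / 2%:R + c 0 2 * a 2 0 0 + b 1 1 0 * a 0 0 2
     + b 0 0 2 * a 1 1 0 + c 1 1 * b 2 0 0
     - b 0 1 1 * a 1 0 1 / 2%:R - b 1 0 1 * a 0 1 1 / 2%:R
     - b 0 2 0 * b 1 0 1) *: (X * Y ^+ 2 * Z)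
  + (b 1 1 0 * b 1 0 1 / 2%:R + b 1 0 1 * a 1 0 1 / 2%:R
     - b 2 0 0 * b 0 1 1 - b 0 0 2 * a 2 0 0 - b 2 0 0 * a 0 0 2)
      *: (Y ^+ 3 * Z)
  + (a 0 2 0 * a 0 0 2 + c 1 1 * a 1 1 0 / 2%:R - a 0 1 1 ^+ 2 / 4%:R
     - c 2 0 * a 1 0 1) *: (X ^+ 2 * Z ^+ 2)
  + (a 1 0 1 * a 0 1 1 / 2%:R + b 1 0 1 * a 0 2 0 + b 0 2 0 * a 1 0 1
     - b 0 1 1 * a 1 1 0 / 2%:R - b 1 1 0 * a 0 1 1 / 2%:R
     - c 2 0 * b 2 0 0 - c 1 1 * a 2 0 0 - a 0 0 2 * a 1 1 0)
      *: (X * Y * Z ^+ 2)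
  + (b 2 0 0 * b 0 2 0 + b 0 1 1 * a 2 0 0 + a 2 0 0 * a 0 0 2
     + b 2 0 0 * a 0 1 1 - b 1 1 0 ^+ 2 / 4%:R - a 1 0 1 ^+ 2 / 4%:R
     - b 1 0 1 * a 1 1 0 / 2%:R - b 1 1 0 * a 1 0 1 / 2%:R)
      *: (Y ^+ 2 * Z ^+ 2)
  + (a 1 1 0 * a 0 1 1 / 2%:R + c 2 0 * a 2 0 0 - a 0 2 0 * a 1 0 1)
      *: (X * Z ^+ 3)
  + (b 1 1 0 * a 1 1 0 / 2%:R + a 1 1 0 * a 1 0 1 / 2%:R
     - b 0 2 0 * a 2 0 0 - b 2 0 0 * a 0 2 0 - a 2 0 0 * a 0 1 1)
      *: (Y * Z ^+ 3)
  + (a 2 0 0 * a 0 2 0 - a 1 1 0 ^+ 2 / 4%:R) *: Z ^+ 4.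

End Quartic.

(* Ideals, and subsets of fields, are Prop-valued predicates. *)
Section Ideals.
Variable R : comNzRingType.
Implicit Types I P : R -> Prop.

Definition ideal_gen (gens : seq R) : R -> Prop :=
  fun s => exists c : nat -> R, s = \sum_(i < size gens) c i * gens`_i.

Definition prime_ideal P : Prop :=
  [/\ P 0, forall s t, P s -> P t -> P (s + t),
      forall s t, P t -> P (s * t),
      ~ P 1 & forall s t, P (s * t) -> P s \/ P t].

Definition subideal I P : Prop := forall s, I s -> P s.

Definition dvd (p s : R) : Prop := exists r, s = p * r.

Definition multiplicity (p s : R) (n : nat) : Prop :=
  exists2 r, s = p ^+ n * r & ~ dvd p r.

(* [A] is a subring of [R], [I] an ideal of [A]; submodules of A / I are
   viewed as A-submodules of [R] between [I] and [A]. *)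
Definition intermediate_submodule (A I M : R -> Prop) : Prop :=
  [/\ subideal I M, subideal M A,
      forall u v, M u -> M v -> M (u + v)
    & forall u v, A u -> M v -> M (u * v)].

Definition strict_subideal I P : Prop := subideal I P /\ ~ subideal P I.

Definition length_ge (A I : R -> Prop) (n : nat) : Prop :=
  exists M : nat -> R -> Prop,
    (forall i, (i <= n)%N -> intermediate_submodule A I (M i)) /\
    (forall i, (i < n)%N -> strict_subideal (M i) (M i.+1)).

(* the A-module A / I has length n *)
Definition has_length (A I : R -> Prop) (n : nat) : Prop :=
  length_ge A I n /\ ~ length_ge A I n.+1.

(* [B] is a local subring of the local ring [A], with maximal ideals [mB] and
   [mA]; the degree is that of the residue field extension. *)
Definition residue_span (A mA B : R -> Prop) d (e : 'I_d -> R) : Prop :=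
  (forall i, A (e i)) /\
  forall u, A u -> exists2 c : 'I_d -> R, forall i, B (c i)
                   & mA (u - \sum_(i < d) c i * e i).

Definition residue_free (mA B mB : R -> Prop) d (e : 'I_d -> R) : Prop :=
  forall c : 'I_d -> R, (forall i, B (c i)) ->
    mA (\sum_(i < d) c i * e i) -> forall i, mB (c i).

(* d is the degree of A / mA over B / mB if it is finite, and 0 otherwise:
   the convention for proper pushforward of cycles *)
Definition residue_degree (A mA B mB : R -> Prop) (d : nat) : Prop :=
  (exists2 e : 'I_d -> R, residue_span A mA B e & residue_free mA B mB e)
  \/ (d = 0%N /\ ~ exists d' (e : 'I_d' -> R), residue_span A mA B e).

End Ideals.

(* The bihomogeneous coordinate ring of P^2 x dual P^2: polynomials in
   x, y, z with coefficients in the coordinate ring of the dual plane. *)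
Notation dualring k := {mpoly k[3]} (only parsing).
Notation biring k := {mpoly {mpoly k[3]}[3]} (only parsing).

Section Bihomogeneous.
Variable k : fieldType.
Implicit Types (s : biring k) (I P : biring k -> Prop) (p : dualring k).

Definition bihomog (d e : nat) s : Prop :=
  s \is d.-homog /\ forall m, s@_m \is e.-homog.

Definition bicomponent (d e : nat) s : biring k :=
  map_mpoly (pihomog mdeg e) (pihomog mdeg d s).

(* homogeneous ideals of the integral closed subschemes of P^2 x dual P^2 *)
Definition bihomog_prime P : Prop :=
  [/\ prime_ideal P, forall s d e, P s -> P (bicomponent d e s),
      exists i, ~ P 'X_i & exists i, ~ P ('X_i)%:MP].

(* irreducible components of the subscheme defined by I *)
Definition component I P : Prop :=
  [/\ bihomog_prime P, subideal I P
    & forall P', bihomog_prime P' -> subideal I P' -> subideal P' P ->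
        subideal P P'].

Definition dim_le1 I : Prop :=
  ~ exists P0 P1 P2,
      [/\ [/\ bihomog_prime P0, bihomog_prime P1 & bihomog_prime P2],
          subideal I P0, strict_subideal P0 P1 & strict_subideal P1 P2].

(* The local ring of P^2 x dual P^2 at the generic point of the subscheme
   with ideal P, inside the fraction field, and the extension of I to it. *)
Definition local_ideal P I (u : {fraction biring k}) : Prop :=
  exists d e s t,
    [/\ bihomog d e s, bihomog d e t, I s, ~ P t & u = tofrac s / tofrac t].
Definition local_ring P := local_ideal P (fun _ => True).

(* Prime divisors of the dual plane are given by homogeneous prime elements
   p of its coordinate ring. *)
Definition prime_divisor p : Prop :=
  [/\ exists e, p \is e.-homog, p != 0 & prime_ideal (dvd p)].

(* The local ring of the dual plane at the generic point of p = 0, embedded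
   by pullback in the same fraction field, and its maximal ideal. *)
Definition dual_local_ideal p (J : dualring k -> Prop)
    (u : {fraction biring k}) : Prop :=
  exists e (s t : dualring k),
    [/\ s \is e.-homog, t \is e.-homog, J s, ~ dvd p t
      & u = tofrac (s%:MP_[3] : biring k) / tofrac (t%:MP_[3] : biring k)].
Definition dual_local_ring p := dual_local_ideal p (fun _ => True).
Definition dual_local_max p := dual_local_ideal p (dvd p).

Definition maps_onto P p : Prop := forall s : dualring k, P s%:MP <-> dvd p s.

(* The coefficient of the curve p = 0 in the pushforward to the dual plane of
   the fundamental cycle of the subscheme defined by I: the sum, over the
   components Z mapping onto the curve, of the length of the local ring at Z
   times the degree of Z over the curve. *)
Definition pushforward_coef I p (n : nat) : Prop :=
  exists (r : nat) (P : 'I_r -> biring k -> Prop) (l d : 'I_r -> nat),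
    [/\ forall i, component I (P i) /\ maps_onto (P i) p,
        forall i j, (forall s, P i s <-> P j s) -> i = j,
        forall P', component I P' -> maps_onto P' p ->
          exists i, forall s, P' s <-> P i s,
        forall i, has_length (local_ring (P i)) (local_ideal (P i) I) (l i) /\
          residue_degree (local_ring (P i)) (local_ideal (P i) (P i))
            (dual_local_ring p) (dual_local_max p) (d i)
      & n = (\sum_(i < r) l i * d i)%N].

Definition pushforward_is I (Q : dualring k) : Prop :=
  forall p, prime_divisor p ->
    exists2 n, pushforward_coef I p n & multiplicity p Q n.

End Bihomogeneous.

Section Foliations.
Variable k : fieldType.
Implicit Types (w : 'I_15 -> k) (F G H : {mpoly k[3]}).

Local Notation x := ('X_x0 : {mpoly k[3]}).
Local Notation y := ('X_x1 : {mpoly k[3]}).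
Local Notation z := ('X_x2 : {mpoly k[3]}).

Definition foliation w : Prop := exists i, w i != 0.

(* 1-forms are row vectors of coefficients of dx, dy, dz *)
Definition w1 (t : nat * nat * nat) : 'rV[{mpoly k[3]}]_3 :=
  (x ^+ t.1.1 * y ^+ t.1.2 * z ^+ t.2) *: vec3 (- y) x 0.
Definition w2 (t : nat * nat * nat) : 'rV[{mpoly k[3]}]_3 :=
  (x ^+ t.1.1 * y ^+ t.1.2 * z ^+ t.2) *: vec3 (- z) 0 x.
Definition w3 (t : nat * nat) : 'rV[{mpoly k[3]}]_3 :=
  (y ^+ t.1 * z ^+ t.2) *: vec3 0 (- z) y.

Definition form w : 'rV[{mpoly k[3]}]_3 :=
  \sum_(t <- exps3) (acoef w t.1.1 t.1.2 t.2)%:MP *: w1 t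
  + \sum_(t <- exps3) (bcoef w t.1.1 t.1.2 t.2)%:MP *: w2 t
  + \sum_(t <- exps2) (ccoef w t.1 t.2)%:MP *: w3 t.

Definition vector_field_of w F G H : Prop :=
  [/\ F \is 2.-homog, G \is 2.-homog, H \is 2.-homog
    & form w = vec3 (y * H - z * G) (z * F - x * H) (x * G - y * F)].

Definition double_curve w : Prop :=
  exists d (h : {mpoly k[3]}),
    [/\ (0 < d)%N, h \is d.-homog, h != 0 & forall i, dvd (h ^+ 2) (form w 0 i)].

Definition lift (p : {mpoly k[3]}) : biring k := map_mpoly (@mpolyC 3 k) p.

Definition incidence_eq : biring k := \sum_(i < 3) ('X_i)%:MP * 'X_i.

Definition tangency_eq F G H : biring k :=
  \sum_(i < 3) ('X_i)%:MP * lift (vec3 F G H 0 i).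

Definition rel_jacobian F G H : 'M[biring k]_(2, 3) :=
  \matrix_(i, j) mderiv j [:: incidence_eq; tangency_eq F G H]`_i.

(* The ideal of D.  On the chart x_l != 0 the sheaf of relative differentials
   of V over the dual plane is presented by the Jacobian matrix of the two
   equations of V with respect to the other two coordinates, so that its
   zeroth Fitting ideal is generated by the minor obtained by deleting column
   l.  By Euler's relation, modulo the equations of V, x_l times any of the
   three minors is plus or minus one of the x_i times that l-th minor; hence
   on that chart the other two minors are redundant. *)
Definition ideal_D F G H : biring k -> Prop :=
  ideal_gen ([:: incidence_eq; tangency_eq F G H]
    ++ [seq \det (col' l (rel_jacobian F G H)) | l <- enum 'I_3]).

(* [Q] is an equation of Phi(w), as determined by cycles *)
Definition tangency_curve w (Q : dualring k) : Prop :=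
  forall F G H, vector_field_of w F G H -> pushforward_is (ideal_D F G H) Q.

Definition specialize w (Psi : {mpoly {mpoly k[15]}[3]}) : {mpoly k[3]} :=
  map_mpoly (meval w) Psi.

(* The coefficients of Psi are homogeneous polynomials of the same degree in
   the coordinates, and give Phi on a nonempty open set of P^14. *)
Definition represents_Phi (Psi : {mpoly {mpoly k[15]}[3]}) : Prop :=
  [/\ Psi \is 4.-homog, exists e, forall m, Psi@_m \is e.-homog
    & exists d (h : {mpoly k[15]}),
        [/\ h \is d.-homog, h != 0
          & forall w, foliation w -> h.@[w] != 0 ->
              specialize w Psi != 0 /\ tangency_curve w (specialize w Psi)]].

(* The rational map Phi is defined at w, and its value is the curve Q = 0.
   This makes sense also when D has components of dimension 2, as for the
   products of a conic with a pencil of lines, where the pushforward of the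
   fundamental cycle of D misses a part of the quartic. *)
Definition Phi_at w (Q : dualring k) : Prop :=
  exists Psi (u : k),
    [/\ represents_Phi Psi, specialize w Psi != 0, u != 0
      & Q = u *: specialize w Psi].

(* Every foliation is given by a vector field, unique up to multiples of the
   Euler field; adding l times the latter adds l * incidence_eq to
   tangency_eq, so that the quantification over F, G, H above is harmless. *)
Lemma vector_field_exists w : exists F G H, vector_field_of w F G H.
Proof.
exists (- \sum_(t <- exps2) (ccoef w t.1 t.2) *: (y ^+ t.1 * z ^+ t.2)).
exists (\sum_(t <- exps3) (bcoef w t.1.1 t.1.2 t.2)
          *: (x ^+ t.1.1 * y ^+ t.1.2 * z ^+ t.2)).
exists (- \sum_(t <- exps3) (acoef w t.1.1 t.1.2 t.2)
          *: (x ^+ t.1.1 * y ^+ t.1.2 * z ^+ t.2)).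
have hX i e : ('X_i ^+ e : {mpoly k[3]}) \is e.-homog.
  by rewrite -[X in X.-homog]mul1n; apply: dhomogMn; rewrite dhomogX /= mdeg1.
have hd d e (p : {mpoly k[3]}) : d = e -> p \is d.-homog -> p \is e.-homog.
  by move->.
have h3 (u : nat -> nat -> nat -> k) :
    \sum_(t <- exps3) u t.1.1 t.1.2 t.2
      *: (x ^+ t.1.1 * y ^+ t.1.2 * z ^+ t.2) \is 2.-homog.
  rewrite big_seq; apply: rpred_sum => t t_in; apply: rpredZ.
  apply: (hd (t.1.1 + t.1.2 + t.2)%N).
    by move: t_in; rewrite !inE => /or4P[|||/or3P[||]] /eqP->.
  by do 2!apply: dhomogM => //.
split => //.
- rewrite rpredN big_seq; apply: rpred_sum => t t_in; apply: rpredZ.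
  apply: (hd (t.1 + t.2)%N).
    by move: t_in; rewrite !inE => /or3P[] /eqP->.
  exact: dhomogM.
- by rewrite rpredN.
have scal (I : Type) (r : seq I) (c : I -> k) (m : I -> {mpoly k[3]})
    (v : 'rV[{mpoly k[3]}]_3) :
    \sum_(t <- r) (c t)%:MP *: (m t *: v) = (\sum_(t <- r) c t *: m t) *: v.
  by rewrite scaler_suml; apply: eq_bigr => t _; rewrite scalerA mul_mpolyC.
rewrite /form !scal.
move: (\sum_(t <- _) _) (\sum_(t <- _) _) (\sum_(t <- _) _) => A B C.
apply/rowP => i; rewrite !mxE.
move: x y z => X Y Z; case: i => -[|[|[|//]]] ? /=; ring.
Qed.

End Foliations.

(* Main.v *)
(** Write T = X F + Y G + Z H (X, Y, Z the dual variables) and h for its Hessian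
matrix in x, y, z.  Restricted to a line, T is a binary quadratic form q, and D
is the locus where both partial derivatives of q vanish.  With S the matrix of
the cross product with (X, Y, Z), the symmetric matrix N = S h S represents q on
the line, and S h N = -disc S where disc = (X, Y, Z) adj(h) (X, Y, Z)^T is four
times the quartic.  Let p be a prime divisor of the dual plane.  If p does not
divide N, a column of N not divisible by p is the double point of q over the
curve p = 0; evaluation at it identifies the local ring of D there with the
local ring of the dual plane modulo disc, so that the length is the multiplicity
of p in the quartic and the residue degree is 1.  If p divides N, every line of
the curve p = 0 is invariant and D contains the surface of their points.

If the quartic vanishes, the form is computed explicitly: either some
substitution x -> x + m y + n z turns it into x^2 times a form of degree 0, or
the polynomials a, b, c multiplying the three basic forms are binary in y, z; in
the latter case they are isotropic and mutually orthogonal for the discriminant,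
hence multiples of one square.

The quartic represents Phi because the lines through (1:0:0) are not invariant
for a generic foliation, while any curve p = 0 contains one of them. *)

Require Import Defs.
From mathcomp Require Import all_boot all_order all_algebra.
From mathcomp Require Import mpoly.
From mathcomp Require Import ring zify.
From Stdlib Require Import Classical.
Import Defs.

Set Implicit Arguments.
Unset Strict Implicit.
Unset Printing Implicit Defensive.

Import GRing.Theory.
Local Open Scope ring_scope.


(** Ideals of subschemes must be bihomogeneous, whereas the primes at hand are kernels of
    evaluations, which are not; each is therefore replaced by its bihomogeneous core, which is again
    prime. Elements of the local rings are quotients of elements of equal bidegree, so every witness
    below comes with factors that only balance degrees. The ideal of D is not saturated: it contains
    Q only after multiplication by a variable of each plane. A relevant prime omits some variable of
    each kind, which lets these factors be cancelled. The pushforward is first computed one divisor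
    p at a time, assuming only that p does not divide N. Both uses of the computation supply this:
    dimension at most 1 for every p, or a cubic condition on w. If D has a surface, the cycle no
    longer determines the quartic, and the value of Phi comes from the generic formula; what remains
    to prove at such w is that the quartic is nonzero, and this is where the absence of a double
    curve enters. The cubic does double duty: it excludes invariant lines through (1:0:0), and minus
    a quarter of its square is a value of the quartic, so it also forces the quartic to be
    nonzero. *)

(** * Homogeneous cores of prime ideals *)

Lemma ex_minimal (P : nat -> Prop) :
  (exists n, P n) -> exists2 n, P n & forall m, (m < n)%N -> ~ P m.
Proof.
case=> n; elim/ltn_ind: n => n IH Pn.
case: (classic (exists2 m, (m < n)%N & P m)) => [[m ltmn Pm]|nex].
  exact: IH Pm.
by exists n => // m ltmn Pm; apply: nex; exists m.
Qed.

Section Ideal.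
Variable R : comNzRingType.
Implicit Types N : R -> Prop.

Definition is_ideal N : Prop :=
  [/\ N 0, forall s t, N s -> N t -> N (s + t) & forall s t, N t -> N (s * t)].

Lemma prime_is_ideal N : prime_ideal N -> is_ideal N.
Proof. by case=> N0 ND NM _ _. Qed.

Lemma is_ideal_sum N (I : finType) (Q : pred I) (F : I -> R) :
  is_ideal N -> (forall i, Q i -> N (F i)) -> N (\sum_(i | Q i) F i).
Proof. by case=> N0 ND _ NF; apply: big_ind. Qed.

Lemma is_idealN N s : is_ideal N -> N s -> N (- s).
Proof. by case=> _ _ NM Ns; rewrite -mulN1r; apply: NM. Qed.

Lemma is_idealB N s t : is_ideal N -> N s -> N t -> N (s - t).
Proof. by move=> iN Ns Nt; case: (iN) => _ ND _; apply: ND => //; apply: is_idealN. Qed.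

Lemma is_idealMr N s t : is_ideal N -> N s -> N (s * t).
Proof. by case=> _ _ NM Ns; rewrite mulrC; apply: NM. Qed.

Lemma prime_ideal_exp N s n : prime_ideal N -> N (s ^+ n) -> N s.
Proof.
case=> _ _ _ N1 NP; elim: n => [|n IH]; first by rewrite expr0.
by rewrite exprS => Ns; case: (NP _ _ Ns).
Qed.

Lemma not_prime_idealM N s t : prime_ideal N -> ~ N s -> ~ N t -> ~ N (s * t).
Proof. by case=> _ _ _ _ NP Ns Nt Nst; case: (NP _ _ Nst). Qed.

Lemma not_prime_ideal_exp N s n : prime_ideal N -> ~ N s -> ~ N (s ^+ n).
Proof. by move=> pN Ns /(prime_ideal_exp pN). Qed.

Lemma dvd_is_ideal (p : R) : is_ideal (dvd p).
Proof.
split; first by exists 0; rewrite mulr0.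
  by move=> s t [a ->] [b ->]; exists (a + b); rewrite mulrDr.
by move=> s t [a ->]; exists (s * a); rewrite mulrCA.
Qed.

Lemma prime_ideal_preim (S : comNzRingType) (f : {rmorphism R -> S}) J :
  prime_ideal J -> prime_ideal (fun s => J (f s)).
Proof.
case=> J0 JD JM J1 JP; split=> [||s t Jt||s t].
- by rewrite rmorph0.
- by move=> s t Js Jt; rewrite rmorphD; apply: JD.
- by rewrite rmorphM; apply: JM.
- by rewrite rmorph1.
- by rewrite rmorphM => /JP.
Qed.

End Ideal.

(** * Prime ideals in an abstract graded ring *)

Section Grading.
Variables (R : comNzRingType) (c : nat -> R -> R) (H : nat -> R -> Prop).
Hypotheses (c0 : forall d, c d 0 = 0)
  (cD : forall d s t, c d (s + t) = c d s + c d t)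
  (cH : forall d s, H d (c d s))
  (Hc : forall d e s, H d s -> c e s = if e == d then s else 0)
  (H1 : H 0 1)
  (HM : forall d e s t, H d s -> H e t -> H (d + e) (s * t))
  (c_fin : forall s, exists b, forall b', (b <= b')%N -> s = \sum_(d < b') c d s).

Lemma gradedM n s t : c n (s * t) = \sum_(i < n.+1) c i s * c (n - i) t.
Proof.
have [b1 hs] := c_fin s; have [b2 ht] := c_fin t.
(* One bound beyond the supports of s and t and beyond n lets all three sums run over the same index
   set. *)
pose b := (maxn (maxn b1 b2) n.+1).
have {}hs := hs b (leq_trans (leq_maxl _ _) (leq_maxl _ _)).
have {}ht := ht b (leq_trans (leq_maxr _ _) (leq_maxl _ _)).
have csum (I : finType) (F : I -> R) : c n (\sum_i F i) = \sum_i c n (F i).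
  exact: (big_morph (c n) (cD n) (c0 n)).
have le_nb : (n.+1 <= b)%N by apply: leq_maxr.
rewrite {1}hs {1}ht mulr_suml csum (big_ord_widen _ (fun i => c i s * c (n - i) t) le_nb).
rewrite [RHS]big_mkcond; apply: eq_bigr => i _.
rewrite mulr_sumr csum ltnS; case: leqP => hi; last first.
  rewrite big1 // => j _; rewrite (Hc n (HM (cH i s) (cH j t))).
  by rewrite ifN // neq_ltn (leq_trans hi (leq_addr _ _)).
have ltb : (n - i < b)%N by rewrite (leq_ltn_trans (leq_subr _ _)).
rewrite (bigD1 (Ordinal ltb)) //= big1 ?addr0 => [|j /eqP nj].
  by rewrite (Hc n (HM (cH i s) (cH _ t))) subnKC // eqxx.
rewrite (Hc n (HM (cH i s) (cH j t))); case: eqP => // nij.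
by case: nj; apply: val_inj; rewrite /= nij addKn.
Qed.

Definition core (N : R -> Prop) : R -> Prop := fun s => forall d, N (c d s).

Lemma core_is_ideal N : is_ideal N -> is_ideal (core N).
Proof.
move=> iN; case: (iN) => N0 ND NM.
split=> [d|s t Ns Nt d|s t Nt d]; first by rewrite c0.
  by rewrite cD; apply: ND.
by rewrite gradedM; apply: is_ideal_sum => // i _; apply: NM.
Qed.

(** If s and t both lie outside the core, take their lowest components outside N, of degrees d and
    e. In the component of s t of degree d + e every other term has a factor of smaller degree,
    hence in N, so the product of the two lowest components would lie in N as well. *)
Lemma core_prime N : prime_ideal N -> prime_ideal (core N).
Proof.
move=> pN; have iN := prime_is_ideal pN; have [C0 CD CM] := core_is_ideal iN.
split=> // [N1|s t Nst].
  by case: pN => _ _ _ n1 _; apply: n1; move: (N1 0%N); rewrite (Hc _ H1).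
apply: NNPP => /not_or_and [/not_all_ex_not ns /not_all_ex_not nt].
have [d nd sd] := ex_minimal ns; have [e ne te] := ex_minimal nt.
apply: (not_prime_idealM pN nd ne).
have lt_d : (d < (d + e).+1)%N by rewrite ltnS leq_addr.
have := Nst (d + e)%N; rewrite gradedM (bigD1 (Ordinal lt_d)) //= addKn => Nsum.
rewrite -[X in N X](addrK (\sum_(i < (d + e).+1 | i != Ordinal lt_d) c i s * c (d + e - i) t)).
apply: is_idealB => //; apply: is_ideal_sum => // i /eqP ni.
case: (ltngtP i d) => [lt_id|lt_di|eq_id]; last by case: ni; apply: val_inj.
  by apply: is_idealMr => //; apply: NNPP => /(sd _ lt_id).
case: iN => _ _; apply; apply: NNPP; apply: te.
by have := ltn_ord i; lia.
Qed.

End Grading.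


(** * The bigrading of the coordinate ring of P^2 x dual P^2 *)

Section Bigrading.
Variable k : fieldType.
Implicit Types (s t : biring k) (N : biring k -> Prop).

Definition comp1 d s : biring k := pihomog mdeg d s.
Definition comp2 e s : biring k := map_mpoly (pihomog mdeg e) s.
Definition homog1 d s : Prop := s \is d.-homog.
Definition homog2 e s : Prop := forall m, s@_m \is e.-homog.

Lemma comp1_0 d : comp1 d 0 = 0. Proof. exact: raddf0. Qed.
Lemma comp1D d s t : comp1 d (s + t) = comp1 d s + comp1 d t.
Proof. exact: raddfD. Qed.
Lemma comp1_homog d s : homog1 d (comp1 d s). Proof. exact: pihomogP. Qed.
Lemma homog1_comp d e s : homog1 d s -> comp1 e s = if e == d then s else 0.
Proof.
move=> hs; case: eqP => [->|/eqP ne]; first exact: pihomog_dE.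
by apply: pihomog_ne0 hs; rewrite eq_sym.
Qed.
Lemma homog1_1 : homog1 0 1. Proof. exact: dhomog1. Qed.
Lemma homog1M d e s t : homog1 d s -> homog1 e t -> homog1 (d + e) (s * t).
Proof. exact: dhomogM. Qed.
Lemma comp1_fin s :
  exists b, forall b', (b <= b')%N -> s = \sum_(d < b') comp1 d s.
Proof. by exists (msize s) => b' /pihomog_partitionE. Qed.

Lemma comp2_0 e : comp2 e 0 = 0. Proof. exact: raddf0. Qed.
Lemma comp2D e s t : comp2 e (s + t) = comp2 e s + comp2 e t.
Proof. exact: raddfD. Qed.
Lemma comp2_homog e s : homog2 e (comp2 e s).
Proof. by move=> m; rewrite mcoeff_map_mpoly; apply: pihomogP. Qed.
Lemma homog2_comp d e s : homog2 d s -> comp2 e s = if e == d then s else 0.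
Proof.
move=> hs; case: eqP => [->|/eqP ne]; apply/mpolyP => m.
  by rewrite mcoeff_map_mpoly; apply: (pihomog_dE (hs m)).
rewrite mcoeff_map_mpoly mcoeff0; apply: (pihomog_ne0 _ (hs m)).
by rewrite eq_sym.
Qed.
Lemma homog2C e (q : dualring k) : q \is e.-homog -> homog2 e q%:MP.
Proof.
by move=> hq m; rewrite mcoeffC; case: eqP; rewrite ?mulr1 ?mulr0 ?dhomog0.
Qed.
Lemma homog2_1 : homog2 0 1. Proof. by apply: homog2C; apply: dhomog1. Qed.
Lemma homog2M d e s t : homog2 d s -> homog2 e t -> homog2 (d + e) (s * t).
Proof.
by move=> hs ht m; rewrite mcoeffM; apply: rpred_sum => i _; apply: dhomogM.
Qed.
Lemma comp2_fin s :
  exists b, forall b', (b <= b')%N -> s = \sum_(e < b') comp2 e s.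
Proof.
exists (\max_(m <- msupp s) msize s@_m) => b' le_b; apply/mpolyP => m.
rewrite raddf_sum /=; under eq_bigr => i _ do rewrite mcoeff_map_mpoly.
apply: pihomog_partitionE; have [ms|/memN_msupp_eq0->] := boolP (m \in msupp s).
  by rewrite (leq_trans _ le_b) // (bigD1_seq m) ?msupp_uniq //= leq_maxl.
by rewrite msize0.
Qed.

(* The largest bihomogeneous ideal contained in the ideal N. *)
Definition bicore N : biring k -> Prop := fun s => forall d e, N (bicomponent d e s).

(** [bicomponent d e] is [comp2 e] after [comp1 d], so by conversion [bicore N] is the core for the
    first grading of the core of N for the second. *)
Lemma bicore_is_ideal N : is_ideal N -> is_ideal (bicore N).
Proof.
move=> iN.
have i2 := core_is_ideal comp2_0 comp2D comp2_homog homog2_comp homog2M comp2_fin iN.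
exact: (core_is_ideal comp1_0 comp1D comp1_homog homog1_comp homog1M comp1_fin i2).
Qed.

Lemma bicore_prime N : prime_ideal N -> prime_ideal (bicore N).
Proof.
move=> iN.
have i2 := core_prime comp2_0 comp2D comp2_homog homog2_comp homog2_1 homog2M
  comp2_fin iN.
exact: (core_prime comp1_0 comp1D comp1_homog homog1_comp homog1_1 homog1M
  comp1_fin i2).
Qed.

Lemma bicomponent_bihomog d e s : bihomog d e (bicomponent d e s).
Proof.
split; last by apply: comp2_homog.
apply/dhomogP => m; rewrite mcoeff_msupp mcoeff_map_mpoly => nz.
apply: (dhomog_mf (comp1_homog d s)); rewrite mcoeff_msupp.
by apply: contra nz => /eqP ->; rewrite raddf0.
Qed.

Lemma bihomog_component d e d' e' s : bihomog d e s ->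
  bicomponent d' e' s = if (d' == d) && (e' == e) then s else 0.
Proof.
case=> h1 h2; rewrite /bicomponent -/(comp1 _ _) (homog1_comp _ h1).
by case: eqP => [_|_]; rewrite -/(comp2 _ _) ?comp2_0 // (homog2_comp _ h2).
Qed.

Lemma bicore_bihomog N d e s : N 0 -> bihomog d e s -> bicore N s <-> N s.
Proof.
move=> N0 hs; split=> [/(_ d e)|Ns d' e'].
  by rewrite (bihomog_component _ _ hs) !eqxx.
by rewrite (bihomog_component _ _ hs); case: andP.
Qed.

Lemma bihomog_ind N s : is_ideal N ->
  (forall d e, N (bicomponent d e s)) -> N s.
Proof.
move=> iN Ns; have [b1 /(_ b1 (leqnn _)) ->] := comp1_fin s.
apply: is_ideal_sum => // d _; have [b2 /(_ b2 (leqnn _)) ->] := comp2_fin (comp1 d s).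
by apply: is_ideal_sum => // e _; apply: Ns.
Qed.

Lemma bicoreS N N' : (forall s, N s -> N' s) -> forall s, bicore N s -> bicore N' s.
Proof. by move=> sNN' s Ns d e; apply/sNN'. Qed.

Lemma bihomogM d e d' e' s t :
  bihomog d e s -> bihomog d' e' t -> bihomog (d + d') (e + e') (s * t).
Proof. by case=> a b [c f]; split; [apply: dhomogM | apply: homog2M]. Qed.

Lemma bihomogD d e s t : bihomog d e s -> bihomog d e t -> bihomog d e (s + t).
Proof.
by case=> a b [c f]; split=> [|m]; rewrite ?mcoeffD rpredD.
Qed.

Lemma bihomogN d e s : bihomog d e s -> bihomog d e (- s).
Proof. by case=> a b; split=> [|m]; rewrite ?mcoeffN rpredN. Qed.

Lemma bihomogB d e s t : bihomog d e s -> bihomog d e t -> bihomog d e (s - t).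
Proof. by move=> hs ht; apply/bihomogD/bihomogN. Qed.

Lemma bihomogC e (q : dualring k) : q \is e.-homog -> bihomog 0 e q%:MP.
Proof.
split; last exact: homog2C.
by rewrite -[q%:MP]mul1r mulrC mul_mpolyC; apply/dhomogZ/dhomog1.
Qed.

Lemma bihomogX i : bihomog 1 0 ('X_i : biring k).
Proof.
split=> [|m]; first by rewrite dhomogX /= mdeg1.
by rewrite mcoeffX; case: eqP => _; [apply: dhomog1 | apply: dhomog0].
Qed.

Lemma bihomog_exp d e s n : bihomog d e s -> bihomog (d * n) (e * n) (s ^+ n).
Proof.
move=> hs; elim: n => [|n IH].
  by rewrite !muln0 expr0; split; [apply: dhomog1 | apply: homog2_1].
by rewrite exprS !mulnS; apply: bihomogM.
Qed.

Lemma bihomog_sum d e (I : finType) (F : I -> biring k) :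
  (forall i, bihomog d e (F i)) -> bihomog d e (\sum_i F i).
Proof.
move=> hF; apply: (big_ind (bihomog d e)) => //; last exact: bihomogD.
by split=> [|m]; rewrite ?mcoeff0 dhomog0.
Qed.

Lemma meval_homog d e e' (xi : 'I_3 -> dualring k) s :
  bihomog d e s -> (forall i, xi i \is e'.-homog) -> s.@[xi] \is (e + d * e').-homog.
Proof.
case=> /dhomogP hd he hxi; rewrite mevalE big_seq; apply: rpred_sum => m ms.
apply: dhomogM => //; have <- : mdeg m = d by apply: hd.
rewrite mdegE.
rewrite big_distrl /=; elim/big_rec2: _ => [|i a b _ IH]; first exact: dhomog1.
by apply: dhomogM => //; rewrite mulnC; apply: dhomogMn.
Qed.

End Bigrading.

(** * Homogeneity of cofactors *)

Section Homog.
Variables (n : nat) (R : idomainType).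
Implicit Types p q : {mpoly R[n]}.

(** As p is homogeneous of degree d, the part of p q of degree e is p times the part of q of degree
    e - d. Cancelling p identifies q with that part; comparing leading monomials gives d <= e, so
    the subtraction is not truncated. *)
Lemma dhomog_divr d e p q : p != 0 -> p \is d.-homog -> p * q \is e.-homog ->
  q \is (e - d).-homog.
Proof.
move=> p0 hp hpq; have [->|q0] := eqVneq q 0; first exact: dhomog0.
suff hq : exists f, q \is f.-homog.
  case: hq => f hq; rewrite (_ : (e - d)%N = f) //.
  have pq0 : p * q != 0 by rewrite mulf_neq0.
  by rewrite (dhomog_uniq pq0 hpq (dhomogM hp hq)) addKn.
exists (e - d)%N; rewrite homog_piE; apply/eqP/(mulfI p0).
have part : q = \sum_(i < maxn (msize q) (e - d).+1) pihomog mdeg i q.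
  by apply: pihomog_partitionE; apply: leq_maxl.
have lt_ed : (e - d < maxn (msize q) (e - d).+1)%N by apply: leq_maxr.
have le_de : (d <= e)%N.
  have := mleadM p0 q0 => /(congr1 (@mdeg n)).
  rewrite (dhomog_mf hpq (mlead_supp _)) ?mulf_neq0 //.
  by rewrite mdegD (dhomog_mf hp (mlead_supp _)) // => ->; apply: leq_addr.
have psum (I : finType) (F : I -> {mpoly R[n]}) :
  pihomog mdeg e (\sum_i F i) = \sum_i pihomog mdeg e (F i) by apply: raddf_sum.
rewrite -[RHS](pihomog_dE hpq).
have -> : p * q = \sum_(i < maxn (msize q) (e - d).+1) p * pihomog mdeg i q.
  by rewrite -mulr_sumr -part.
rewrite psum.
rewrite (bigD1 (Ordinal lt_ed)) //= big1 ?addr0 => [|i ni].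
  apply/esym/pihomog_dE; rewrite -[X in X.-homog](subnKC le_de).
  by apply: dhomogM (pihomogP _ _ _).
apply: (@pihomog_ne0 _ _ _ (d + i)); last by rewrite dhomogM ?pihomogP.
by apply: contra ni => /eqP die; apply/eqP/val_inj => /=; move: die; lia.
Qed.

End Homog.


(** * Local rings inside the fraction field *)

Section PrimePower.
Variable R : idomainType.
Implicit Types p s t : R.

Lemma prime_power_dvdl p s t j : p != 0 -> prime_ideal (dvd p) -> ~ dvd p t ->
  dvd (p ^+ j) (s * t) -> dvd (p ^+ j) s.
Proof.
move=> p0 [_ _ _ _ PP] pt; elim: j s => [|j IH] s.
  by exists s; rewrite expr0 mul1r.
case=> u su; case: (PP s t) => [|[s' hs']|//].
  by exists (p ^+ j * u); rewrite su exprS mulrA.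
case: (IH s') => [|v hv]; last by exists v; rewrite hs' hv exprS mulrA.
exists u; apply: (mulfI p0); rewrite mulrA -hs' su exprS; ring.
Qed.

Lemma dvd_power_le p i j s : (i <= j)%N -> dvd (p ^+ j) s -> dvd (p ^+ i) s.
Proof.
by move=> ij [u ->]; exists (p ^+ (j - i) * u); rewrite mulrA -exprD subnKC.
Qed.

End PrimePower.

Section Congruence.
Variables (R : comNzRingType) (I : R -> Prop).
Hypothesis hI : is_ideal I.

Lemma congrM a b c d : I (a - b) -> I (c - d) -> I (a * c - b * d).
Proof.
case: (hI) => _ ID IM Iab Icd.
have -> : a * c - b * d = c * (a - b) + b * (c - d) by ring.
by apply: ID; apply: IM.
Qed.

Lemma congr_exp a b n : I (a - b) -> I (a ^+ n - b ^+ n).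
Proof.
case: (hI) => I0 _ _ Iab.
by elim: n => [|n IH]; rewrite ?expr0 ?subrr // !exprS; apply: congrM.
Qed.

Lemma congr_prod (T : finType) (F G : T -> R) :
  (forall i, I (F i - G i)) -> I (\prod_i F i - \prod_i G i).
Proof.
case: (hI) => I0 _ _ IFG.
elim/big_rec2: _ => [|i a b _ IH]; first by rewrite subrr.
exact: congrM.
Qed.

End Congruence.

Section Fractions.
Variable R : idomainType.
Implicit Types s t : R.

Lemma tofrac_divE s t s' t' : t != 0 -> t' != 0 ->
  (tofrac s / tofrac t = tofrac s' / tofrac t') <-> s * t' = s' * t.
Proof.
move=> t0 t0'; split.
  by move/eqP; rewrite eqr_div ?tofrac_eq0 // -!tofracM tofrac_eq => /eqP.
by move=> e; apply/eqP; rewrite eqr_div ?tofrac_eq0 // -!tofracM tofrac_eq e.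
Qed.

Lemma tofrac_divD s t s' t' : t != 0 -> t' != 0 ->
  tofrac s / tofrac t + tofrac s' / tofrac t'
    = tofrac (s * t' + s' * t) / tofrac (t * t').
Proof. by move=> t0 t0'; rewrite addf_div ?tofrac_eq0 // tofracD !tofracM. Qed.

Lemma tofrac_divB s t s' t' : t != 0 -> t' != 0 ->
  tofrac s / tofrac t - tofrac s' / tofrac t'
    = tofrac (s * t' - s' * t) / tofrac (t * t').
Proof. by move=> t0 t0'; rewrite -mulNr -tofracN tofrac_divD // mulNr. Qed.

Lemma tofrac_divM s t s' t' :
  (tofrac s / tofrac t) * (tofrac s' / tofrac t')
    = tofrac (s * s') / tofrac (t * t').
Proof. by rewrite !tofracM mulf_div. Qed.

End Fractions.

Section BiringFractions.
Variable k : fieldType.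
Implicit Types s t : biring k.

(* [exact_no_check] leaves the conversion to the kernel: the unifier is very
   slow at relating the ring structures that [{mpoly {mpoly k[3]}[3]}] inherits
   from [comNzRingType] and from [idomainType]. *)
Lemma biring_fracE s t s' t' : t != 0 -> t' != 0 ->
  (tofrac s / tofrac t = tofrac s' / tofrac t') <-> s * t' = s' * t.
Proof. exact_no_check (@tofrac_divE (biring k) s t s' t'). Qed.

Lemma biring_fracD s t s' t' : t != 0 -> t' != 0 ->
  tofrac s / tofrac t + tofrac s' / tofrac t'
    = tofrac (s * t' + s' * t) / tofrac (t * t').
Proof. exact_no_check (@tofrac_divD (biring k) s t s' t'). Qed.

Lemma biring_fracB s t s' t' : t != 0 -> t' != 0 ->
  tofrac s / tofrac t - tofrac s' / tofrac t'
    = tofrac (s * t' - s' * t) / tofrac (t * t').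
Proof. exact_no_check (@tofrac_divB (biring k) s t s' t'). Qed.

Lemma biring_fracM s t s' t' :
  (tofrac s / tofrac t) * (tofrac s' / tofrac t')
    = tofrac (s * s') / tofrac (t * t').
Proof. exact_no_check (@tofrac_divM (biring k) s t s' t'). Qed.

End BiringFractions.

Section LocalIdeal.
Variables (k : fieldType) (P : biring k -> Prop).
Hypothesis pP : prime_ideal P.
Implicit Types (J : biring k -> Prop).

Lemma not_prime_neq0 t : ~ P t -> t != 0.
Proof. by move=> Pt; apply/eqP => t0; apply: Pt; rewrite t0; case: pP. Qed.

Lemma frac_eq (s t s' t' : biring k) : ~ P t -> ~ P t' ->
  tofrac s / tofrac t = tofrac s' / tofrac t' -> s * t' = s' * t.
Proof.
move=> Pt Pt'; exact: (proj1 (biring_fracE s s' (not_prime_neq0 Pt) (not_prime_neq0 Pt'))).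
Qed.

Lemma eq_frac (s t s' t' : biring k) : ~ P t -> ~ P t' ->
  s * t' = s' * t -> tofrac s / tofrac t = tofrac s' / tofrac t'.
Proof.
move=> Pt Pt'; exact: (proj2 (biring_fracE s s' (not_prime_neq0 Pt) (not_prime_neq0 Pt'))).
Qed.

Lemma local_idealD J u v : is_ideal J ->
  local_ideal P J u -> local_ideal P J v -> local_ideal P J (u + v).
Proof.
move=> iJ [d [e [s [t [hs ht Js Pt ->]]]]] [d' [e' [s' [t' [hs' ht' Js' Pt' ->]]]]].
have t0 := not_prime_neq0 Pt; have t0' := not_prime_neq0 Pt'.
exists (d + d')%N, (e + e')%N, (s * t' + s' * t), (t * t'); split.
- apply: bihomogD; first exact: bihomogM.
  rewrite addnC [(e + _)%N]addnC; exact: bihomogM.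
- exact: bihomogM.
- case: (iJ) => _ JD JM; apply: JD; rewrite mulrC; exact: JM.
- exact: not_prime_idealM.
- exact: biring_fracD.
Qed.

Lemma local_idealM J u v : is_ideal J ->
  local_ring P u -> local_ideal P J v -> local_ideal P J (u * v).
Proof.
move=> iJ [d [e [s [t [hs ht _ Pt ->]]]]] [d' [e' [s' [t' [hs' ht' Js' Pt' ->]]]]].
exists (d + d')%N, (e + e')%N, (s * s'), (t * t'); split.
- exact: bihomogM.
- exact: bihomogM.
- by case: (iJ) => _ _; apply.
- exact: not_prime_idealM.
- exact: biring_fracM.
Qed.

Lemma local_idealS J J' : subideal J J' -> subideal (local_ideal P J) (local_ideal P J').
Proof.
by move=> sJ u [d [e [s [t [hs ht Js Pt ->]]]]]; exists d, e, s, t; split=> //; apply: sJ.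
Qed.

End LocalIdeal.

(** * Prime divisors of the dual plane *)

Section PrimeDivisor.
Variables (k : fieldType) (p : dualring k).
Hypothesis pp : prime_divisor p.

Lemma prime_divisor_msize : (1 < msize p)%N.
Proof.
case: pp => _ p0 [_ _ _ n1 _]; rewrite ltnNge; apply/negP => le1; apply: n1.
have [c hc] : exists c, p = c%:MP.
  by exists p@_0; apply: msize1_polyC.
have c0 : c != 0 by move: p0; rewrite hc mpolyC_eq0.
by exists (c^-1)%:MP; rewrite hc -mpolyCM divff.
Qed.

Lemma prime_divisor_pos_deg : exists2 e, p \is e.-homog & (0 < e)%N.
Proof.
have [[e hp] _ _] := pp; exists e => //.
rewrite lt0n; apply/eqP => e0; have := prime_divisor_msize.
rewrite ltnNge msizeE => /negP; apply; apply/bigmax_leqP_seq => m mp _.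
by have -> : mdeg m = e by [apply: (dhomog_mf hp)]; rewrite e0.
Qed.

(** If p divides ['X_i], the cofactor is a nonzero constant, so p vanishes at the j-th unit vector,
    where ['X_j] takes the value 1. *)
Lemma prime_divisor_var (i j : 'I_3) : i != j -> dvd p 'X_i -> ~ dvd p 'X_j.
Proof.
move=> nij [a ha] [b hb]; have size_p := prime_divisor_msize.
have p0 : p != 0 by case: pp.
have a0 : a != 0.
  apply/eqP => a0; have := congr1 (fun q : dualring k => msize q) ha.
  by rewrite a0 mulr0 msize0 msizeX.
have := congr1 (fun q : dualring k => msize q) ha.
rewrite msizeM // msizeX => size_a.
have [c hc] : exists c, a = c%:MP.
  by exists a@_0; apply: msize1_polyC; move: size_a size_p; rewrite mdeg1 /=; case: (msize p) => [|[|u]] //=; case: (msize a) => [|[|v]] //=; rewrite addnS; lia.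
have c0 : c != 0 by move: a0; rewrite hc mpolyC_eq0.
pose v := fun l : 'I_3 => (l == j)%:R : k.
have := congr1 (meval v) ha; have := congr1 (meval v) hb.
rewrite !mevalM !mevalXU hc mevalC /v eqxx (negPf nij) => hj /esym/eqP.
rewrite mulf_eq0 (negPf c0) orbF => /eqP pv; move/eqP: hj.
by rewrite pv mul0r oner_eq0.
Qed.

Lemma prime_divisor_relevant : exists i, ~ dvd p 'X_i.
Proof.
case: (classic (dvd p 'X_ord0)) => [|np]; last by exists ord0.
by move/(@prime_divisor_var ord0 ord_max isT); exists ord_max.
Qed.

End PrimeDivisor.


(** * A divisor over which D has a single point *)

Section Relevant.
Variable k : fieldType.
Variables (I : biring k -> Prop) (Q p r : dualring k) (n : nat).
Hypotheses (hQ : Q = p ^+ n * r)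
  (hQX : forall i j : 'I_3, I (Q%:MP * ('X_j)%:MP * 'X_i)).

(** A prime omitting one variable of each plane cancels them from [hQX], hence contains Q = p^n r,
    and then p because it omits r. *)
Lemma relevant_mem P' (j : 'I_3) : bihomog_prime P' -> subideal I P' ->
  ~ P' ('X_j)%:MP -> ~ P' r%:MP -> P' p%:MP.
Proof.
case=> pP' _ [i xi] _ sI nj nr; have := sI _ (hQX i j).
have [_ _ _ _ PP] := pP'; case/PP => // /PP[] // PQ.
move: PQ; rewrite hQ mpolyCM => /PP[]// .
by rewrite (rmorphXn (@mpolyC 3 (dualring k))); apply: prime_ideal_exp.
Qed.

End Relevant.

Section NoPoint.
Variable k : fieldType.
Variables (I : biring k -> Prop) (Q p : dualring k).
Hypotheses (pp : prime_divisor p) (hr : ~ dvd p Q)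
  (hQX : forall i j : 'I_3, I (Q%:MP * ('X_j)%:MP * 'X_i)).

(** A component mapping onto p = 0 would contain Q by [hQX], and p would divide Q. The family of
    components is empty, whence the functions out of ['I_0]. *)
Lemma pushforward_coef_unit : pushforward_coef I p 0.
Proof.
have f0 (T : Type) (i : 'I_0) : T by case: i.
exists 0%N, (fun i => f0 _ i), (fun i => f0 _ i), (fun i => f0 _ i); split.
- by case.
- by case.
- move=> P' [hP' sI _] onto; have [j nj] := prime_divisor_relevant pp.
  have nXj : ~ P' ('X_j)%:MP by move/onto.
  case: hP' => pP' _ [i xi] _; have := sI _ (hQX i j).
  by have [_ _ _ _ PP] := pP'; case/PP => // /PP[] // /onto.
- by case.
- by rewrite big_ord0.
Qed.

End NoPoint.

Section OnePoint.
Variable k : fieldType.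
Variables (I : biring k -> Prop) (Q p r : dualring k) (n ax bQ : nat).
Variables (xi : 'I_3 -> dualring k) (i0 : 'I_3).
Hypotheses (hI : is_ideal I) (hIhom : forall s, I s -> bicore I s)
  (pp : prime_divisor p) (hQ : Q = p ^+ n * r) (hr : ~ dvd p r)
  (Qhom : Q \is bQ.-homog) (xihom : forall i, xi i \is ax.-homog)
  (xi0 : ~ dvd p (xi i0)) (hev : forall s, I s -> dvd Q s.@[xi])
  (hX : forall i j, I ('X_i * (xi j)%:MP - 'X_j * (xi i)%:MP))
  (hQX : forall i j : 'I_3, I (Q%:MP * ('X_j)%:MP * 'X_i)).

Let N (s : biring k) : Prop := dvd p s.@[xi].
(* The component of D above the divisor p: modulo p, its points are the
   (xi(X), X). *)
Definition point_ideal : biring k -> Prop := bicore N.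
Let P := point_ideal.

Let prime_p : prime_ideal (dvd p). Proof. by case: pp. Qed.
Let p0 : p != 0. Proof. by case: pp. Qed.
Let prime_N : prime_ideal N.
Proof. exact: (prime_ideal_preim (meval xi) prime_p). Qed.
Let ideal_N : is_ideal N. Proof. exact: prime_is_ideal. Qed.
Let N0 : N 0. Proof. by case: ideal_N. Qed.

Lemma point_ideal_prime : prime_ideal P.
Proof. exact: bicore_prime. Qed.
Let prime_P := point_ideal_prime.
Let ideal_P : is_ideal P. Proof. exact: prime_is_ideal. Qed.

Lemma point_idealE d e s : bihomog d e s -> P s <-> dvd p s.@[xi].
Proof. exact: bicore_bihomog. Qed.

Lemma point_idealC d (q : dualring k) : q \is d.-homog -> P q%:MP <-> dvd p q.
Proof. by move=> hq; rewrite (point_idealE (bihomogC hq)) mevalC. Qed.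

Lemma point_ideal_maps_onto : maps_onto P p.
Proof.
move=> s; split=> [Ps|[u ->]].
  have := bihomog_ind ideal_N Ps; by rewrite /N mevalC.
rewrite mpolyCM mulrC; case: (ideal_P) => _ _; apply.
by case: pp => [[d hp] _ _]; apply/(point_idealC hp); exists 1; rewrite mulr1.
Qed.

Lemma point_ideal_notX : ~ P 'X_i0.
Proof. by rewrite (point_idealE (bihomogX k i0)) mevalXU. Qed.

Lemma point_ideal_notr : ~ P r%:MP.
Proof. by rewrite point_ideal_maps_onto. Qed.

Lemma point_ideal_bihomog : bihomog_prime P.
Proof.
split=> [|s d e Ps d' e'||].
- exact: prime_P.
- rewrite (bihomog_component _ _ (bicomponent_bihomog d e s)).
  by case: ifP => _; [apply: Ps | apply: N0].
- by exists i0; apply: point_ideal_notX.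
- have [j nj] := prime_divisor_relevant pp.
  by exists j; rewrite point_ideal_maps_onto.
Qed.

(** Modulo I the point x is proportional to xi, by [hX]: a factor xi_i0 turns each variable x_i into
    x_i0 times xi_i. *)
Lemma reduce_monomial m :
  I ((xi i0)%:MP ^+ mdeg m * 'X_[m] - 'X_i0 ^+ mdeg m * ('X_[m].@[xi])%:MP).
Proof.
pose F i : biring k := ((xi i0)%:MP * 'X_i) ^+ m i.
pose G i : biring k := ('X_i0 * (xi i)%:MP) ^+ m i.
have prodF (u : biring k) (v : 'I_3 -> biring k) :
    \prod_i (u * v i) ^+ m i = u ^+ mdeg m * \prod_i v i ^+ m i.
  under eq_bigr => i _ do rewrite exprMn.
  by rewrite big_split /= mdegE prodrXr.
have := @congr_prod _ I hI _ F G; rewrite !prodF -mpolyXE_id mevalX.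
rewrite (rmorph_prod (@mpolyC 3 (dualring k))).
under [X in _ - _ * X]eq_bigr => i _ do rewrite -(rmorphXn (@mpolyC 3 (dualring k))).
apply=> i; apply: congr_exp => //; rewrite mulrC.
by have := is_idealN hI (hX i0 i); rewrite opprB.
Qed.

Lemma reduce d e s : bihomog d e s ->
  I ((xi i0)%:MP ^+ d * s - 'X_i0 ^+ d * (s.@[xi])%:MP).
Proof.
case=> hs _; rewrite [in X in X - _](mpolyE s) mevalE mulr_sumr raddf_sum mulr_sumr -sumrB.
case: (hI) => I0 ID IM; rewrite big_seq; apply: big_ind => // m /(dhomog_mf hs) md.
have -> : (xi i0)%:MP ^+ d * (s@_m *: 'X_[m]) -
  'X_i0 ^+ d * (s@_m * \prod_i xi i ^+ m i)%:MP = (s@_m)%:MP *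
   ((xi i0)%:MP ^+ mdeg m * 'X_[m] - 'X_i0 ^+ mdeg m * ('X_[m].@[xi])%:MP).
  by rewrite mevalX mpolyCM -mul_mpolyC [mdeg m]md; ring.
exact/IM/reduce_monomial.
Qed.

Lemma mem_local_ideal d e s : bihomog d e s -> dvd (p ^+ n) s.@[xi] ->
  exists d' e' c, [/\ bihomog d' e' c, ~ P c & I (c * s)].
Proof.
move=> hs [h sh]; have [j nj] := prime_divisor_relevant pp.
have [dp hp] : exists dp, p \is dp.-homog by case: pp.
have pn0 : p ^+ n != 0 by rewrite expf_neq0.
have rhom : r \is (bQ - dp * n).-homog.
  by apply: (dhomog_divr pn0); [apply: dhomogMn | rewrite -hQ].
have Xhom : ('X_j : dualring k) \is 1.-homog by rewrite dhomogX /= mdeg1.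
exists (0 + 0 + 0 * d + 1)%N, (bQ - dp * n + 1 + ax * d + 0)%N.
(* The power of xi_i0 allows the reduction of s to its value h p^n times a power of x_i0; the factor
   r completes p^n to Q, and the two variables bring Q into I. None of the factors lies in P. *)
exists (r%:MP * ('X_j)%:MP * (xi i0)%:MP ^+ d * 'X_i0); split.
- apply: bihomogM (bihomogX _ _); apply: bihomogM; last exact/bihomog_exp/bihomogC.
  by apply: bihomogM; apply: bihomogC.
- apply: not_prime_idealM point_ideal_notX => //.
  apply: not_prime_idealM => //; last first.
    by apply: not_prime_ideal_exp; rewrite ?point_ideal_maps_onto.
  by apply: not_prime_idealM => //; rewrite point_ideal_maps_onto.
case: (hI) => _ ID IM.
set x := 'X_i0 : biring k.
have -> : r%:MP * ('X_j)%:MP * (xi i0)%:MP ^+ d * x * s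
  = r%:MP * ('X_j)%:MP * x * ((xi i0)%:MP ^+ d * s - x ^+ d * (s.@[xi])%:MP)
    + (x ^+ d * h%:MP) * (Q%:MP * ('X_j)%:MP * x).
  by rewrite sh hQ !mpolyCM; ring.
by apply: ID; apply: IM; [apply: (reduce hs) | apply: hQX].
Qed.

(* Evaluation at xi identifies the local ring modulo I with the discrete
   valuation ring at p modulo p^n, so these are all the submodules. *)
Definition point_filtration j : {fraction biring k} -> Prop :=
  local_ideal P (fun s => dvd (p ^+ j) s.@[xi]).
Local Notation W := point_filtration.

Lemma eval_dvd_is_ideal j : is_ideal (fun s : biring k => dvd (p ^+ j) s.@[xi]).
Proof.
have [D0 DD DM] := dvd_is_ideal (p ^+ j).
split=> [|s t|s t]; rewrite ?meval0 ?mevalD ?mevalM //; [exact: DD | exact: DM].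
Qed.

Lemma local_ringE u : local_ring P u <-> W 0 u.
Proof.
split; apply: local_idealS => // s _.
by exists s.@[xi]; rewrite expr0 mul1r.
Qed.

(** One inclusion is [hev]; for the other, numerator and denominator are multiplied by the element
    outside P given by [mem_local_ideal]. *)
Lemma local_idealE u : local_ideal P I u <-> W n u.
Proof.
split.
  apply: local_idealS => s /hev[c ->]; exists (r * c).
  by rewrite hQ mulrA.
case=> d [e [s [t [hs ht ds Pt ->]]]].
have [d' [e' [c [hc Pc Ics]]]] := mem_local_ideal hs ds.
exists (d' + d)%N, (e' + e)%N, (c * s), (c * t); split; try exact: bihomogM.
- exact: Ics.
- exact: not_prime_idealM.
apply: (eq_frac prime_P Pt (not_prime_idealM prime_P Pc Pt)); ring.
Qed.

(** Membership does not depend on the chosen fraction, because denominators outside P have values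
    prime to p. *)
Lemma point_filtrationP j d e s t : bihomog d e s -> bihomog d e t -> ~ P t ->
  W j (tofrac s / tofrac t) <-> dvd (p ^+ j) s.@[xi].
Proof.
move=> hs ht Pt; split=> [|ds]; last by exists d, e, s, t; split.
case=> d' [e' [s' [t' [hs' ht' ds' Pt' /(frac_eq prime_P Pt Pt') est]]]].
apply: (prime_power_dvdl p0 prime_p (t := t'.@[xi])).
  by move/(point_idealE ht').
rewrite -mevalM est mevalM; exact: (is_idealMr _ (dvd_is_ideal (p ^+ j)) ds').
Qed.

Lemma point_filtrationS i j u : (i <= j)%N -> W j u -> W i u.
Proof. by move=> ij; apply: local_idealS => s; apply: dvd_power_le. Qed.


Lemma point_filtration_submodule j :
  (j <= n)%N -> intermediate_submodule (local_ring P) (local_ideal P I) (W j).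
Proof.
move=> jn; have iW := eval_dvd_is_ideal j; split.
- by move=> u /local_idealE; apply: point_filtrationS.
- by move=> u; apply: local_idealS.
- by move=> u v; apply: local_idealD.
- by move=> u v; apply: local_idealM.
Qed.

Lemma point_filtration_strict j : strict_subideal (W j.+1) (W j).
Proof.
split=> [u|sub]; first exact: point_filtrationS.
have [i ni] := prime_divisor_relevant pp.
have [dp hp] : exists dp, p \is dp.-homog by case: pp.
have Xhom : ('X_i : dualring k) ^+ (dp * j) \is (dp * j).-homog.
  by rewrite -{2}[(dp * j)%N]mul1n; apply: dhomogMn; rewrite dhomogX /= mdeg1.
have hs : bihomog 0 (dp * j) ((p ^+ j)%:MP : biring k).
  by apply/bihomogC/dhomogMn.
have ht := bihomogC Xhom.
have Pt : ~ P ('X_i ^+ (dp * j))%:MP.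
  by rewrite (point_idealC Xhom); apply: not_prime_ideal_exp.
(* The separating element is p^j, divided by a power of a variable prime to p so as to have degree
   0. *)
have /sub /(point_filtrationP _ hs ht Pt) :
    W j (tofrac ((p ^+ j)%:MP : biring k) / tofrac (('X_i ^+ (dp * j))%:MP : biring k)).
  by apply/(point_filtrationP _ hs ht Pt); rewrite mevalC; exists 1; rewrite mulr1.
rewrite mevalC exprSr => -[c /esym]; rewrite -mulrA -[RHS]mulr1.
move/(mulfI (expf_neq0 j p0)) => pc; case: prime_p => _ _ _ n1 _; apply: n1.
by exists c.
Qed.

Lemma point_length_ge : length_ge (local_ring P) (local_ideal P I) n.
Proof.
exists (fun i => W (n - i)); split=> i hi.
  by apply: point_filtration_submodule; apply: leq_subr.
have -> : (n - i = (n - i.+1).+1)%N by lia.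
exact: point_filtration_strict.
Qed.

Lemma point_filtration_exact j u : W 0 u -> ~ W j u ->
  exists2 i, (i < j)%N & W i u /\ ~ W i.+1 u.
Proof.
move=> W0u; elim: j => [//|j IH] nW.
case: (classic (W j u)) => [Wj|/IH[i ij hi]]; first by exists j.
by exists i => //; apply: ltnW.
Qed.

(** The degree identity makes quotients built from two such cofactors homogeneous of degree 0. *)
Lemma homog_eval_cofactor d e s j h : bihomog d e s -> s.@[xi] = p ^+ j * h ->
  exists f dp, [/\ h \is f.-homog, p \is dp.-homog & h != 0 -> (dp * j + f = e + d * ax)%N].
Proof.
move=> hs sh; have [dp hp] : exists dp, p \is dp.-homog by case: pp.
have evh := meval_homog hs xihom.
have hpj := dhomogMn j hp; have pj0 := expf_neq0 j p0.
have hh : h \is ((e + d * ax) - dp * j).-homog.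
  by apply: (dhomog_divr pj0 hpj); rewrite -sh.
exists ((e + d * ax) - dp * j)%N, dp; split=> // h0.
apply: (dhomog_uniq _ (dhomogM hpj hh)); first by rewrite mulf_neq0.
by rewrite -sh.
Qed.

(** An element u of exact order j generates step j modulo the local ideal of I. For v in step j, the
    ratio of the values of v and u, with p^j cancelled, is a fraction on the dual plane with
    denominator prime to p; subtracting that multiple of u from v leaves an element whose value is
    0. *)
Lemma point_filtration_gen M j u :
  intermediate_submodule (local_ring P) (local_ideal P I) M ->
  M u -> W j u -> ~ W j.+1 u -> subideal (W j) M.
Proof.
case=> IM MA MD MM Mu [d [e [s [t [hs ht [h sh] Pt uE]]]]].
move: Mu; rewrite {}uE => Mu nW v [d' [e' [s' [t' [hs' ht' [h' sh'] Pt' ->]]]]].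
have nh : ~ dvd p h.
  case=> c hc; apply: nW; apply/(point_filtrationP _ hs ht Pt).
  by exists c; rewrite sh hc exprSr mulrA.
have [f [dp [hf hp hdeg]]] := homog_eval_cofactor hs sh.
have [f' [dp' [hf' hp' hdeg']]] := homog_eval_cofactor hs' sh'.
have evt := meval_homog ht xihom; have evt' := meval_homog ht' xihom.
have h0 : h != 0 by apply/eqP => h0; apply: nh; exists 0; rewrite mulr0.
have hnum : h' * t.@[xi] \is (f + (e' + d' * ax)).-homog.
  have [->|h'0] := eqVneq h' 0; first by rewrite mul0r dhomog0.
  suff -> : (f + (e' + d' * ax) = f' + (e + d * ax))%N by apply: dhomogM.
  have E := dhomog_uniq p0 hp hp'.
  by rewrite -(hdeg' h'0) -(hdeg h0) E addnCA addnA [(f' + _)%N]addnC.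
have hden : h * t'.@[xi] \is (f + (e' + d' * ax)).-homog by apply: dhomogM.
have nt : ~ dvd p t.@[xi] := fun D => Pt (proj2 (point_idealE ht) D).
have nt' : ~ dvd p t'.@[xi] := fun D => Pt' (proj2 (point_idealE ht') D).
have Pden : ~ P (h * t'.@[xi])%:MP.
  by rewrite (point_idealC hden); apply: not_prime_idealM.
pose num : biring k := (h' * t.@[xi])%:MP; pose den : biring k := (h * t'.@[xi])%:MP.
have Ab : local_ring P (tofrac num / tofrac den).
  exists 0%N, (f + (e' + d' * ax))%N, num, den.
  by split; [apply: bihomogC | apply: bihomogC | | exact: Pden | exact: erefl].
have den0 := not_prime_neq0 prime_P Pden.
have t0 := not_prime_neq0 prime_P Pt; have t0' := not_prime_neq0 prime_P Pt'.
have Pdt := not_prime_idealM prime_P Pden Pt.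
(* The numerator of z evaluates to 0 at xi, hence is divisible by p^n after evaluation. *)
pose z := tofrac s' / tofrac t' - (tofrac num / tofrac den) * (tofrac s / tofrac t).
have zI : local_ideal P I z.
  apply/local_idealE; rewrite /z biring_fracM biring_fracB //; last exact: (not_prime_neq0 prime_P).
  have hdt := bihomogM (bihomogC hden) ht.
  have hns := bihomogM (bihomogC hnum) hs.
  have Ptdt := not_prime_idealM prime_P Pt' Pdt.
  apply/(point_filtrationP _ (d := (d' + (0 + d))%N) (e := (e' + (f + (e' + d' * ax) + e))%N) _ _ Ptdt).
  - apply: bihomogB; first exact: bihomogM.
    by rewrite addnC [(e' + (_ + _))%N]addnC; apply: bihomogM.
  - exact: bihomogM.
  exists 0; rewrite mulr0 mevalB !mevalM !mevalC sh sh'; ring.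
have -> : tofrac s' / tofrac t' = z + (tofrac num / tofrac den) * (tofrac s / tofrac t).
  by rewrite /z subrK.
by apply: MD; [apply: IM | apply: MM].
Qed.

(** In a strict chain, the i-th module contains some step j of the filtration with j + i <= n: an
    element gained at the next stage lies outside step j, so it has smaller order and generates a
    strictly larger step. At i = n + 1 no such j is left. *)
Lemma point_length : has_length (local_ring P) (local_ideal P I) n.
Proof.
split; first exact: point_length_ge.
case=> M [Msub Mstrict].
have step i : (i <= n.+1)%N -> exists2 j, (j + i <= n)%N & subideal (W j) (M i).
  elim: i => [_|i IH hi].
    exists n; rewrite ?addn0 // => u /local_idealE Iu.
    by case: (Msub 0%N isT) => IM _ _ _; apply: IM.
  have [j ji Wj] := IH (ltnW hi); have [_ nsub] := Mstrict i hi.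
  have [u hu] := not_all_ex_not _ _ nsub; have [Mu nMu] := imply_to_and _ _ hu.
  have sub := Msub _ hi.
  have W0u : W 0 u by apply/local_ringE; case: sub => _ MA _ _; apply: MA.
  have [j' lt_j [Wu nWu]] := point_filtration_exact W0u (fun h => nMu (Wj _ h)).
  exists j'; last exact: point_filtration_gen sub Mu Wu nWu.
  by rewrite addnS (leq_trans _ ji) // ltn_add2r.
have [j hj _] := step n.+1 (leqnn _).
by move: hj; rewrite addnS ltnNge leq_addl.
Qed.

Lemma point_residue_degree :
  residue_degree (local_ring P) (local_ideal P P) (dual_local_ring p) (dual_local_max p) 1.
Proof.
have P1 : ~ P 1 by case: prime_P.
have h1 : bihomog 0 0 (1 : biring k) by split; [apply: homog1_1 | apply: homog2_1].
(* The residue class of s / t is that of s(xi) / t(xi), which comes from the dual plane, so 1 spans;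
   it is written 1 / 1 to fit the shape of local elements. *)
left; exists (fun _ => tofrac (1 : biring k) / tofrac (1 : biring k)).
  split=> [_|u]; first by exists 0%N, 0%N, 1, 1; split.
  case=> d [e [s [t [hs ht _ Pt ->]]]].
  have evs := meval_homog hs xihom; have evt := meval_homog ht xihom.
  have nt : ~ dvd p t.@[xi] := fun D => Pt (proj2 (point_idealE ht) D).
  exists (fun _ => tofrac (s.@[xi]%:MP : biring k) / tofrac (t.@[xi]%:MP : biring k)).
    move=> _; exists (e + d * ax)%N, s.@[xi], t.@[xi].
    by split; [exact: evs | exact: evt | | exact: nt | exact: erefl].
  have Pet : ~ P (t.@[xi])%:MP by rewrite (point_idealC evt).
  have t0 := not_prime_neq0 prime_P Pt; have et0 := not_prime_neq0 prime_P Pet.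
  have n10 := not_prime_neq0 prime_P P1.
  rewrite big_ord1 biring_fracM biring_fracB //; last by rewrite mulr1.
  exists (d + (0 + 0))%N, (e + (e + d * ax + 0))%N.
  exists (s * (t.@[xi]%:MP * 1) - s.@[xi]%:MP * 1 * t), (t * (t.@[xi]%:MP * 1)).
  have hst : bihomog (d + (0 + 0)) (e + (e + d * ax + 0))
      (s * (t.@[xi]%:MP * 1) - s.@[xi]%:MP * 1 * t).
    apply: bihomogB; first by apply: bihomogM (bihomogM (bihomogC evt) h1).
    rewrite [(d + _)%N]addnC [(e + _)%N]addnC.
    by apply: bihomogM (bihomogM (bihomogC evs) h1) _.
  split; last by [].
  - exact: hst.
  - by apply: bihomogM (bihomogM (bihomogC evt) h1).
  - rewrite (point_idealE hst) mevalB !mevalM !mevalC ?meval1.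
    by exists 0; ring.
  - by rewrite mulr1; apply: not_prime_idealM.
move=> c Bc; rewrite big_ord1 => mAc i; rewrite (ord1 i).
have [e [s [t [hs ht _ nt cE]]]] := Bc ord0.
have Pt : ~ P t%:MP by rewrite (point_idealC ht).
move: mAc; rewrite cE biring_fracM => -[d' [e' [a [b [ha hb Pa Pb]]]]].
move/(frac_eq prime_P (not_prime_idealM prime_P Pt P1) Pb) => est.
exists e, s, t; split; [exact: hs | exact: ht | | exact: nt | exact: erefl].
apply/(point_idealC hs).
have Psb : P (s%:MP * 1 * b) by rewrite est; apply: (is_idealMr _ ideal_P Pa).
move: Psb; rewrite mulr1; have [_ _ _ _ PP] := prime_P => Psb.
by case: (PP _ _ Psb) => [h|h]; [exact: h | case: (Pb h)].
Qed.

(** Modulo P', a power of xi_i0 times s equals a power of x_i0 times s(xi), a multiple of p; the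
    power of xi_i0 can then be cancelled. *)
Lemma point_ideal_sub P' : prime_ideal P' -> subideal I P' -> P' p%:MP ->
  ~ P' (xi i0)%:MP -> subideal P P'.
Proof.
move=> pP' sI Pp nxi s Ps; have iP' := prime_is_ideal pP'.
apply: bihomog_ind => // d e; have hs := bicomponent_bihomog d e s.
have := Ps d e; move: (bicomponent d e s) hs => {Ps}s hs [c sc].
have Pm : P' ((xi i0)%:MP ^+ d * s).
  rewrite -[X in P' X](subrK ('X_i0 ^+ d * (s.@[xi])%:MP)).
  case: (iP') => _ P'D P'M; apply: P'D; first by apply: sI; apply: (reduce hs).
  by apply: P'M; rewrite sc mpolyCM; apply: (is_idealMr _ iP' Pp).
have [_ _ _ _ PP] := pP'; case: (PP _ _ Pm) => [h|h]; last exact: h.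
by case: nxi; apply: (prime_ideal_exp pP' h).
Qed.

Lemma point_ideal_unique P' : bihomog_prime P' -> subideal I P' ->
  maps_onto P' p -> subideal P P'.
Proof.
move=> [pP' _ _ _] sI onto; apply: point_ideal_sub => //.
  by rewrite onto; exists 1; rewrite mulr1.
by rewrite onto.
Qed.

Hypothesis n_gt0 : (0 < n)%N.

Lemma sub_point_ideal : subideal I P.
Proof.
move=> s Is d e; have [c hc] := hev (hIhom Is d e).
by exists (p ^+ n.-1 * r * c); rewrite hc hQ -{1}(prednK n_gt0) exprS !mulrA.
Qed.

(** A relevant prime between I and P omits r and some dual variable, because P does; so it contains
    p by [relevant_mem], and then all of P. *)
Lemma point_ideal_component : component I P.
Proof.
split; [exact: point_ideal_bihomog | exact: sub_point_ideal |].
move=> P' hP' sI sub; have [pP' _ _ _] := hP'.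
have [j nj] := prime_divisor_relevant pp.
have Pp : P' p%:MP.
  apply: (relevant_mem hQ hQX hP' sI (j := j)).
    by move/sub; rewrite point_ideal_maps_onto.
  by move/sub; apply: point_ideal_notr.
apply: point_ideal_sub => //.
by move/sub; rewrite point_ideal_maps_onto.
Qed.

Lemma pushforward_coef_point : pushforward_coef I p n.
Proof.
exists 1%N, (fun _ => P), (fun _ => n), (fun _ => 1%N); split.
- move=> _; split; [exact: point_ideal_component | exact: point_ideal_maps_onto].
- by move=> i j _; rewrite (ord1 i) (ord1 j).
- move=> P' [hP' sI min] onto; exists ord0 => s.
  have sub := point_ideal_unique hP' sI onto.
  split; last exact: sub.
  exact: (min _ point_ideal_bihomog sub_point_ideal sub s).
- by move=> _; split; [exact: point_length | exact: point_residue_degree].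
- by rewrite big_ord1 muln1.
Qed.

End OnePoint.


(** * Divisors all of whose lines are invariant *)

Lemma x0E : x0 = 0%N :> nat. Proof. exact: inordK. Qed.
Lemma x1E : x1 = 1%N :> nat. Proof. exact: inordK. Qed.
Lemma x2E : x2 = 2%N :> nat. Proof. exact: inordK. Qed.

Lemma ord3_ind (P : 'I_3 -> Prop) : P x0 -> P x1 -> P x2 -> forall i, P i.
Proof.
move=> P0 P1 P2 [[|[|[|//]]] hi].
- by rewrite (_ : Ordinal hi = x0) //; apply: val_inj; rewrite /= x0E.
- by rewrite (_ : Ordinal hi = x1) //; apply: val_inj; rewrite /= x1E.
- by rewrite (_ : Ordinal hi = x2) //; apply: val_inj; rewrite /= x2E.
Qed.

Lemma x01 : (x0 == x1) = false. Proof. by rewrite -val_eqE /= x0E x1E. Qed.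
Lemma x02 : (x0 == x2) = false. Proof. by rewrite -val_eqE /= x0E x2E. Qed.
Lemma x12 : (x1 == x2) = false. Proof. by rewrite -val_eqE /= x1E x2E. Qed.
Lemma x10 : (x1 == x0) = false. Proof. by rewrite eq_sym x01. Qed.
Lemma x20 : (x2 == x0) = false. Proof. by rewrite eq_sym x02. Qed.
Lemma x21 : (x2 == x1) = false. Proof. by rewrite eq_sym x12. Qed.
Definition neqx := (x01, x02, x12, x10, x20, x21).

Lemma sum_ord3 (R : nmodType) (F : 'I_3 -> R) : \sum_i F i = F x0 + F x1 + F x2.
Proof.
rewrite !big_ord_recl big_ord0 addr0 addrA; do ?congr (_ + _); congr F;
  by apply: val_inj; rewrite /= ?x0E ?x1E ?x2E.
Qed.

Lemma prod_ord3 (R : pzSemiRingType) (F : 'I_3 -> R) : \prod_i F i = F x0 * F x1 * F x2.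
Proof.
rewrite !big_ord_recl big_ord0 mulr1 mulrA; do ?congr (_ * _); congr F;
  by apply: val_inj; rewrite /= ?x0E ?x1E ?x2E.
Qed.

(* The matrix of the cross product with X; its column j is the point of
   intersection of the line X with the coordinate line x_j = 0. *)
Definition skew (R : pzRingType) (X : 'I_3 -> R) (i j : 'I_3) : R :=
  match nat_of_ord i, nat_of_ord j with
  | 0, 1 => - X x2 | 0, 2 => X x1 | 1, 0 => X x2
  | 1, 2 => - X x0 | 2, 0 => - X x1 | 2, 1 => X x0
  | _, _ => 0
  end.

Lemma skew_diag (R : pzRingType) (X : 'I_3 -> R) i : skew X i i = 0.
Proof. by move: i; apply: ord3_ind; rewrite /skew ?x0E ?x1E ?x2E. Qed.

Lemma skew_neq0 (R : pzRingType) (X : 'I_3 -> R) i j l :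
  X l != 0 -> l != i -> l != j -> i != j -> skew X i j != 0.
Proof.
move: i j l; do 3![apply: ord3_ind];
  by rewrite ?eqxx ?neqx // /skew !(x0E, x1E, x2E) ?oppr_eq0.
Qed.

(** * Zeros of plane curves *)

Section PlaneCurveZero.
Variables (k : closedFieldType) (p : {mpoly k[3]}) (e : nat).
Hypotheses (hp : p \is e.-homog) (e_gt0 : (0 < e)%N).

Definition vec_fun (T : Type) (a b c : T) (i : 'I_3) : T :=
  match nat_of_ord i with 0 => a | 1 => b | _ => c end.

(** Unless (0:0:1) is on the curve, p(0, 1, t) is a polynomial in t of degree e with leading
    coefficient p(0, 0, 1), and it has a root. *)
Lemma curve_meets_line :
  exists eta : 'I_3 -> k, [/\ p.@[eta] = 0, eta x0 = 0 & exists i, eta i != 0].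
Proof.
have [p1|p1] := eqVneq p.@[vec_fun 0 0 1] 0.
  exists (vec_fun 0 0 1); split=> //; first by rewrite /vec_fun x0E.
  by exists x2; rewrite /vec_fun x2E oner_eq0.
pose g : {poly k} := mmap (@polyC k) (vec_fun 0 1 'X) p.
have ge : g`_e = p.@[vec_fun 0 0 1].
  rewrite /g /mmap mevalE coef_sum big_seq [RHS]big_seq; apply: eq_bigr => m ms.
  have hm : (m x0 + m x1 + m x2 = e)%N.
    have <- : mdeg m = e by apply: (dhomog_mf hp).
    by rewrite mdegE; exact: (esym (sum_ord3 (fun i => m i))).
  rewrite coefCM /mmap1 !prod_ord3 /vec_fun !(x0E, x1E, x2E) -hm.
  rewrite !expr1n !mulr1 !expr0n; congr (_ * _).
  case: (m x0) => [|m0] /=; last by rewrite !mul0r coef0.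
  rewrite !mul1r coefXn add0n; case: (m x1) => [|m1]; first by rewrite add0n eqxx.
  by rewrite eqn_leq [X in X && _]leqNgt addSn ltnS leq_addl.
have /closed_rootP[t /rootP gt] : size g != 1%N.
  apply/eqP => size_g; move: p1; rewrite -ge nth_default ?eqxx //.
  by rewrite size_g.
exists (vec_fun 0 1 t); split; rewrite ?/vec_fun ?x0E //; last first.
  by exists x1; rewrite /vec_fun x1E oner_eq0.
rewrite -[RHS]gt /g /mmap mevalE horner_sum; apply: eq_bigr => m _.
rewrite hornerM hornerC /mmap1 !prod_ord3 /vec_fun !(x0E, x1E, x2E).
by rewrite !hornerM !horner_exp hornerX horner0 -polyC1 hornerC.
Qed.

End PlaneCurveZero.

(** By degrees p is a nonzero constant multiple of L1, so every multiple of p vanishes where L1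
    does. *)
Lemma prime_divisor_linear (k : fieldType) (p L1 L2 : dualring k) v :
  prime_divisor p -> L1 != 0 -> L1 \is 1.-homog -> dvd p L1 -> dvd p L2 ->
  L1.@[v] = 0 -> L2.@[v] = 0.
Proof.
move=> pp L10 hL1 [a ha] [b ->]; have size_p := prime_divisor_msize pp.
have p0 : p != 0 by case: pp.
have a0 : a != 0 by apply: contraNneq L10 => a0; rewrite ha a0 mulr0.
have [c hc] : exists c, a = c%:MP.
  exists a@_0; apply: msize1_polyC.
  have : (msize L1 <= 2)%N.
    rewrite msizeE; apply/bigmax_leqP_seq => m mL _.
    by have -> : mdeg m = 1%N by apply: (dhomog_mf hL1).
  rewrite ha msizeM //; move: size_p; case: (msize p) => [|[|u]] //=.
  by case: (msize a) => [|w] //=; rewrite addnS; lia.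
have c0 : c != 0 by move: a0; rewrite hc mpolyC_eq0.
rewrite ha hc !mevalM mevalC => /eqP; rewrite mulf_eq0 (negPf c0) orbF => /eqP ->.
by rewrite mul0r.
Qed.

Lemma zero_ideal_prime (R : idomainType) : prime_ideal (fun x : R => x = 0).
Proof.
split=> //.
- by move=> s t -> ->; rewrite addr0.
- by move=> s t ->; rewrite mulr0.
- by move/eqP; rewrite oner_eq0.
- by move=> s t /eqP; rewrite mulf_eq0 => /orP[] /eqP; [left | right].
Qed.

(** Gauss's lemma, by comparing the lowest coefficients not divisible by p. *)
Lemma content_prime (R : comNzRingType) (p : R) : prime_ideal (dvd p) ->
  prime_ideal (fun q : {poly R} => forall j, dvd p q`_j).
Proof.
move=> pp; have ip := prime_is_ideal pp; have [D0 DD DM] := ip; split.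
- by move=> j; rewrite coef0.
- by move=> s t hs ht j; rewrite coefD; apply: DD.
- by move=> s t ht j; rewrite coefM; apply: is_ideal_sum => // i _; apply: DM.
- by move/(_ 0%N); rewrite coef1 eqxx; case: pp.
move=> s t st; apply: NNPP => /not_or_and[/not_all_ex_not ns /not_all_ex_not nt].
have [d nd sd] := ex_minimal ns; have [e ne te] := ex_minimal nt.
apply: (not_prime_idealM pp nd ne).
have lt_d : (d < (d + e).+1)%N by rewrite ltnS leq_addr.
have := st (d + e)%N; rewrite coefM (bigD1 (Ordinal lt_d)) //= addKn => stde.
rewrite -[X in dvd p X](addrK (\sum_(i < (d + e).+1 | i != Ordinal lt_d) s`_i * t`_(d + e - i))).
apply: is_idealB => //; apply: is_ideal_sum => // i /eqP ni.
case: (ltngtP i d) => [lt_id|lt_di|eq_id]; last by case: ni; apply: val_inj.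
  by apply: is_idealMr => //; apply: NNPP => /(sd _ lt_id).
by apply: DM; apply: NNPP; apply: te; have := ltn_ord i; lia.
Qed.

(** * A chain of three primes over a curve of invariant lines *)

Section RankZero.
Variable k : closedFieldType.
Variables (I : biring k -> Prop) (p : dualring k).
Local Notation X := (fun i : 'I_3 => 'X_i : dualring k).

(* The columns of [skew X] span the line X, so this is the restriction to its
   generic point. *)
Definition line_eval (a b : 'I_3) : biring k -> {poly (dualring k)} :=
  mmap (@polyC _) (fun i => (skew X i a)%:P + (skew X i b)%:P * 'X).

Hypotheses (pp : prime_divisor p) (hIhom : forall s, I s -> bicore I s)
  (hIp : forall a b s, I s -> forall j, dvd p (line_eval a b s)`_j).

Let prime_p : prime_ideal (dvd p). Proof. by case: pp. Qed.

Section Chain.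
Variables (eta : 'I_3 -> k) (l a b : 'I_3).
Hypotheses (eta_p : p.@[eta] = 0) (eta_l : eta l != 0)
  (la : l != a) (lb : l != b) (ab : a != b).

(** The cores of these kernels are the ideals of a surface, a curve and a point: the points of the
    lines of p = 0, the points of the single line eta, and the point of that line given by column a
    of the skew matrix, at parameter 0. *)
Let N0 s := forall j, dvd p (line_eval a b s)`_j.
Let N1 s := map_poly (meval eta) (line_eval a b s) = 0.
Let N2 s := (map_poly (meval eta) (line_eval a b s)).[0] = 0.

Let prime_N0 : prime_ideal N0.
Proof. exact: (prime_ideal_preim (line_eval a b) (content_prime prime_p)). Qed.
Let prime_N1 : prime_ideal N1.
Proof.
exact: (prime_ideal_preim (map_poly (meval eta) \o line_eval a b) (zero_ideal_prime _)).
Qed.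
Let prime_N2 : prime_ideal N2.
Proof.
exact: (prime_ideal_preim
  (horner_eval (0 : k) \o (map_poly (meval eta) \o line_eval a b)) (zero_ideal_prime _)).
Qed.

Let N01 s : N0 s -> N1 s.
Proof.
move=> h; apply/polyP => j; rewrite coef_map coef0 /=.
by have [c ->] := h j; rewrite mevalM eta_p mul0r.
Qed.
Let N12 s : N1 s -> N2 s. Proof. by rewrite /N1 /N2 => ->; rewrite horner0. Qed.

Let line_evalC q : line_eval a b q%:MP = q%:P. Proof. exact: mmapC. Qed.
Let line_evalX i :
  line_eval a b 'X_i = (skew X i a)%:P + (skew X i b)%:P * 'X.
Proof. by rewrite /line_eval mmapX mmap1U. Qed.

Let skew_eval i j : (skew X i j).@[eta] = skew eta i j.
Proof.
move: i j; do 2![apply: ord3_ind]; rewrite /skew !(x0E, x1E, x2E) ?mevalN ?mevalXU //;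
  exact: meval0.
Qed.

Let notN2X : ~ N2 'X_b.
Proof.
rewrite /N2 line_evalX skew_diag mul0r addr0 map_polyC hornerC /= skew_eval.
by apply/eqP; apply: (skew_neq0 eta_l) => //; rewrite eq_sym.
Qed.

Let notN2C : ~ N2 ('X_l)%:MP.
Proof. by rewrite /N2 line_evalC map_polyC hornerC /= mevalXU; apply/eqP. Qed.

(** The point lies on the curve and the surface, so variables not vanishing at it serve for all
    three primes. *)
Let bicore_relevant N : prime_ideal N -> (forall s, N s -> N2 s) -> bihomog_prime (bicore N).
Proof.
move=> pN NN2; have N0' : N 0 by case: pN.
split=> [|s d e Ps d' e'||]; first exact: bicore_prime.
- rewrite (bihomog_component _ _ (bicomponent_bihomog d e s)).
  by case: ifP => _; [apply: Ps | apply: N0'].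
- by exists b; move/(bicore_bihomog N0' (bihomogX k b)).1/NN2/notN2X.
- exists l; have hX : ('X_l : dualring k) \is 1.-homog by rewrite dhomogX /= mdeg1.
  by move/(bicore_bihomog N0' (bihomogC hX)).1/NN2/notN2C.
Qed.

Lemma rank_zero_chain : ~ dim_le1 I.
Proof.
move=> dimI; apply: dimI; exists (bicore N0), (bicore N1), (bicore N2).
have n0 (N : biring k -> Prop) : prime_ideal N -> N 0 by case.
split.
- split; first exact: (bicore_relevant prime_N0 (fun s h => N12 (N01 h))).
    exact: (bicore_relevant prime_N1 N12).
  exact: (bicore_relevant prime_N2 (fun s h => h)).
- by move=> s Is d e; apply: hIp; apply: hIhom.
- split=> [|sub]; first by apply: bicoreS.
  (* These linear forms vanish at eta. If p divided both [L a] and [L b], they would have the same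
     zeros, but at the b-th unit vector [L a] is 0 and [L b] is eta_l. *)
  pose L c : dualring k := eta l *: 'X_c - eta c *: 'X_l.
  have hL c : L c \is 1.-homog.
    by rewrite /L rpredB // dhomogZ // dhomogX /= mdeg1.
  have pL c : dvd p (L c).
    have h : bicore N1 (L c)%:MP.
      apply: (proj2 (bicore_bihomog (n0 _ prime_N1) (bihomogC (hL c)))).
      by rewrite /N1 line_evalC map_polyC /= mevalB !mevalZ !mevalXU mulrC subrr.
    have := proj1 (bicore_bihomog (n0 _ prime_N0) (bihomogC (hL c))) (sub _ h) 0%N.
    by rewrite line_evalC coefC eqxx.
  pose v d : 'I_3 -> k := fun i => (i == d)%:R.
  have La0 : L a != 0.
    apply: contraNneq eta_l => /(congr1 (meval (v a))).
    rewrite mevalB !mevalZ !mevalXU /v eqxx (negPf la) mulr1 mulr0 subr0 => ->.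
    by rewrite meval0.
  have := prime_divisor_linear (v := v b) pp La0 (hL a) (pL a) (pL b).
  rewrite !mevalB !mevalZ !mevalXU /v eqxx (negPf ab) (negPf lb) !mulr0 mulr1 !subr0.
  by move=> /(_ erefl) /eqP; rewrite (negPf eta_l).
- split=> [|sub]; first by apply: bicoreS.
  (* The coordinate x_a vanishes at the chosen point but not along the whole line eta. *)
  have h : bicore N2 'X_a.
    apply: (proj2 (bicore_bihomog (n0 _ prime_N2) (bihomogX k a))).
    by rewrite /N2 line_evalX skew_diag add0r rmorphM /= map_polyX hornerMX mulr0.
  have := proj1 (bicore_bihomog (n0 _ prime_N1) (bihomogX k a)) (sub _ h).
  rewrite /N1 line_evalX skew_diag add0r rmorphM /= map_polyC map_polyX /= skew_eval.
  move/eqP; rewrite mulf_eq0 polyX_eq0 orbF polyC_eq0.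
  by rewrite (negPf (skew_neq0 eta_l la lb ab)).
Qed.

End Chain.

Lemma rank_zero : ~ dim_le1 I.
Proof.
have [e hp e_gt0] := prime_divisor_pos_deg pp.
have [eta [eta_p _ [l eta_l]]] := curve_meets_line hp e_gt0.
move: l eta_l; apply: ord3_ind => eta_l.
- by apply: (rank_zero_chain (a := x1) (b := x2) eta_p eta_l); rewrite neqx.
- by apply: (rank_zero_chain (a := x0) (b := x2) eta_p eta_l); rewrite neqx.
- by apply: (rank_zero_chain (a := x0) (b := x1) eta_p eta_l); rewrite neqx.
Qed.

End RankZero.


(** * Restriction of a quadratic form to a line *)

Section BorderedHessian.
Variables (R : comNzRingType) (X : 'I_3 -> R) (h : 'I_3 -> 'I_3 -> R).
Hypothesis hsym : forall i j, h i j = h j i.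

(* X^T adj(h) X: up to a constant factor, the discriminant of the restriction
   to the line X of the quadratic form with matrix h. *)
Definition line_disc : R :=
  X x0 ^+ 2 * (h x1 x1 * h x2 x2 - h x1 x2 ^+ 2)
  + X x1 ^+ 2 * (h x0 x0 * h x2 x2 - h x0 x2 ^+ 2)
  + X x2 ^+ 2 * (h x0 x0 * h x1 x1 - h x0 x1 ^+ 2)
  + X x0 * X x1 * (h x0 x2 * h x1 x2 - h x0 x1 * h x2 x2) *+ 2
  + X x0 * X x2 * (h x0 x1 * h x1 x2 - h x0 x2 * h x1 x1) *+ 2
  + X x1 * X x2 * (h x0 x1 * h x0 x2 - h x1 x2 * h x0 x0) *+ 2.

(* [line_mx] is skew X * h * skew X, the matrix of the restriction to the line X
   up to sign and coordinates; when the restriction has rank one, its nonzero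
   columns all represent the double point. *)
Definition pole (c a : 'I_3) : R := \sum_b h a b * skew X b c.
Definition line_mx (i c : 'I_3) : R := \sum_a skew X i a * pole c a.

Local Ltac expand := do ?[apply: ord3_ind];
  rewrite ?/line_mx ?/pole ?/line_disc ?sum_ord3 /skew ?(x0E, x1E, x2E);
  rewrite ?(hsym x1 x0) ?(hsym x2 x0) ?(hsym x2 x1).

Lemma incidence_line_mx c : \sum_i X i * line_mx i c = 0.
Proof. by move: c; expand; ring. Qed.

Lemma line_mxK i c :
  \sum_a skew X i a * \sum_b h a b * line_mx b c = - line_disc * skew X i c.
Proof. by move: i c; expand; ring. Qed.

Lemma line_mx_quad c :
  \sum_a line_mx a c * \sum_b h a b * line_mx b c = - line_disc * line_mx c c.
Proof. by move: c; expand; ring. Qed.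

Section Point.
Variables (S : comNzRingType) (f : {rmorphism R -> S}) (x : 'I_3 -> S).

(** The triple product identity x × (X × v) = (x·v) X - (x·X) v, on the entries of skew matrices. *)
Lemma cross_cross (v : 'I_3 -> R) i j :
  x i * f (\sum_a skew X j a * v a) - x j * f (\sum_a skew X i a * v a)
  = - f (skew X i j) * (\sum_a x a * f (v a)) + f (skew v i j) * \sum_l f (X l) * x l.
Proof. by move: i j; expand; ring. Qed.

Lemma pole_dual c :
  \sum_a x a * f (pole c a) = - \sum_a f (skew X c a) * \sum_b f (h a b) * x b.
Proof. by move: c; expand; ring. Qed.

(** This is the relation making x proportional to a column of N on D: the right side combines a
    minor of the relative Jacobian with the incidence equation. *)
Lemma line_mx_cross i j c :
  x i * f (line_mx j c) - x j * f (line_mx i c)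
  = f (skew X i j) * (\sum_a f (skew X c a) * \sum_b f (h a b) * x b)
    + f (skew (pole c) i j) * \sum_l f (X l) * x l.
Proof. by rewrite cross_cross pole_dual mulrNN. Qed.

(** The previous relations are multiplied by S h, and S h N = -disc S is applied. Since the left
    side and the last term vanish on D, so does disc times each entry of S times x_e. *)
Lemma line_disc_cross i e c :
  \sum_j (\sum_a f (skew X i a) * f (h a j)) * (x e * f (line_mx j c) - x j * f (line_mx e c))
  = - (f line_disc * f (skew X i c) * x e)
    - f (line_mx e c) * \sum_a f (skew X i a) * \sum_b f (h a b) * x b.
Proof.
have -> : f line_disc * f (skew X i c) = - f (- line_disc * skew X i c).
  by rewrite mulNr rmorphN opprK rmorphM.
rewrite -line_mxK !sum_ord3; ring.
Qed.

Variable u : 'I_3 -> S.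
Hypothesis hx : forall i, x i = \sum_j f (skew X i j) * u j.

Lemma incidence_span : \sum_l f (X l) * x l = 0.
Proof. by rewrite sum_ord3 !hx; expand; ring. Qed.

(** For a point x = S u of the line, S h x = N u; hence everything that defines D vanishes on the
    line when N does. *)
Lemma minor_span i :
  \sum_a f (skew X i a) * \sum_b f (h a b) * x b = \sum_j f (line_mx i j) * u j.
Proof. by rewrite !sum_ord3 !hx; move: i; expand; ring. Qed.

Lemma quad_span :
  \sum_a x a * \sum_b f (h a b) * x b = - \sum_i u i * \sum_j f (line_mx i j) * u j.
Proof. by rewrite !sum_ord3 !hx; expand; ring. Qed.

End Point.


End BorderedHessian.


(** * The ideal of D *)

Lemma det_mx22 (R : comNzRingType) (M : 'M[R]_2) :
  \det M = M ord0 ord0 * M ord_max ord_max - M ord0 ord_max * M ord_max ord0.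
Proof.
rewrite (expand_det_row _ ord0) !big_ord_recl big_ord0 addr0 /cofactor !det_mx11 !mxE.
have e1 : fintype.lift ord0 (ord0 : 'I_1) = ord_max :> 'I_2 by apply: val_inj.
have e2 : fintype.lift (ord_max : 'I_2) ord0 = ord0 by apply: val_inj.
by rewrite !e1 e2 expr0 mul1r expr1; ring.
Qed.

Lemma lift_x0 : (fintype.lift x0 (ord0 : 'I_2) = x1) * (fintype.lift x0 (ord_max : 'I_2) = x2).
Proof. by split; apply: val_inj; rewrite /= /bump !(x0E, x1E, x2E). Qed.
Lemma lift_x1 : (fintype.lift x1 (ord0 : 'I_2) = x0) * (fintype.lift x1 (ord_max : 'I_2) = x2).
Proof. by split; apply: val_inj; rewrite /= /bump !(x0E, x1E, x2E). Qed.
Lemma lift_x2 : (fintype.lift x2 (ord0 : 'I_2) = x0) * (fintype.lift x2 (ord_max : 'I_2) = x1).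
Proof. by split; apply: val_inj; rewrite /= /bump !(x0E, x1E, x2E). Qed.

(** * The Hessian of a quadratic form *)

Section Quadratic.
Variables (n : nat) (R : comNzRingType) (T : {mpoly R[n]}).
Hypothesis hT : T \is 2.-homog.

(** The multiplicity is 2 on the diagonal and 1 off it, so these are the second derivatives of T. *)
Definition hess (i j : 'I_n) : R := T@_(U_(i) + U_(j)) *+ (i == j).+1.

Lemma hess_sym i j : hess i j = hess j i.
Proof. by rewrite /hess addmC eq_sym. Qed.

Lemma mderiv_quadratic i : mderiv i T = \sum_j (hess i j)%:MP * 'X_j.
Proof.
apply/mpolyP => m; rewrite mcoeff_mderiv raddf_sum /=.
under eq_bigr => j _ do rewrite mul_mpolyC mcoeffZ mcoeffX.
have [m1|m1] := boolP (mdeg m == 1%N).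
  move: m1; rewrite mdeg_eq1 => /existsP[j /eqP ->].
  under [RHS]eq_bigr => l _ do rewrite eq_mnm1 mulr_natr mulrb.
  rewrite -big_mkcond big_pred1_eq /hess addmC mnm1E.
  by rewrite eq_sym.
rewrite big1 ?(dhomog_nemf_coeff hT) ?mul0rn // => [|j _].
  by rewrite /= mdegD mdeg1 addn1.
by case: eqP => [jm|]; rewrite ?mulr0 //; move: m1; rewrite -jm mdeg1 eqxx.
Qed.

Lemma euler_quadratic : T *+ 2 = \sum_i 'X_i * \sum_j (hess i j)%:MP * 'X_j.
Proof.
under eq_bigr => i _ do rewrite -mderiv_quadratic.
rewrite {1}(mpolyE T) big_seq -sumrMnl.
under [RHS]eq_bigr => i _ do
  rewrite {1}(mpolyE T) (raddf_sum (mderiv i)) mulr_sumr big_seq.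
rewrite exchange_big /=; apply: eq_bigr => m mT.
have <- : mdeg m = 2%N by apply: (dhomog_mf hT).
rewrite mdegE -sumrMnr; apply: eq_bigr => i _.
rewrite mderivZ mderivX -scalerAr -scalerAr scaler_nat scalerMnr.
have [->|mi0] := eqVneq (m i) 0%N; first by rewrite !mulr0n.
by rewrite -mpolyXD addmC submK // lep1mP.
Qed.

End Quadratic.

Section IdealD.
Variable k : fieldType.
Variables F G H : {mpoly k[3]}.
Hypotheses (hF : F \is 2.-homog) (hG : G \is 2.-homog) (hH : H \is 2.-homog).
Local Notation T := (tangency_eq F G H).
Local Notation E := (incidence_eq k).
Local Notation X := (fun i : 'I_3 => 'X_i : dualring k).
Local Notation h := (hess T).

Lemma bihomog_lift e (q : {mpoly k[3]}) : q \is e.-homog -> bihomog e 0 (lift q).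
Proof.
move=> hq; split=> [|m].
  apply/dhomogP => m; rewrite mcoeff_msupp mcoeff_map_mpoly mpolyC_eq0 => qm.
  by apply: (dhomog_mf hq); rewrite mcoeff_msupp.
by rewrite mcoeff_map_mpoly -[X in X \is _]mulr1 mul_mpolyC; apply/dhomogZ/dhomog1.
Qed.

Lemma dhomogXi (i : 'I_3) : ('X_i : dualring k) \is 1.-homog.
Proof. by rewrite dhomogX /= mdeg1. Qed.

Lemma bihomog_incidence : bihomog 1 1 E.
Proof.
apply: bihomog_sum => i; rewrite -[X in bihomog X]add0n -[X in bihomog _ X]addn0.
exact: (bihomogM (bihomogC (dhomogXi i)) (bihomogX k i)).
Qed.

Lemma vec3_homog i : vec3 F G H 0 i \is 2.-homog.
Proof. by move: i; apply: ord3_ind; rewrite mxE ?(x0E, x1E, x2E). Qed.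

Lemma bihomog_tangency : bihomog 2 1 T.
Proof.
apply: bihomog_sum => i; rewrite -[X in bihomog X]add0n -[X in bihomog _ X]addn0.
exact: (bihomogM (bihomogC (dhomogXi i)) (bihomog_lift (vec3_homog i))).
Qed.

Lemma hess_homog i j : h i j \is 1.-homog.
Proof. by apply: rpredMn; apply: (proj2 bihomog_tangency). Qed.

(** The cross product of X with the gradient of T, whose entries are up to sign the 2 by 2 minors of
    the relative Jacobian. *)
Definition minor (l : 'I_3) : biring k :=
  \sum_a (skew X l a)%:MP * \sum_b (h a b)%:MP * 'X_b.

Lemma mderiv_incidence i : mderiv i E = ('X_i)%:MP.
Proof.
rewrite /incidence_eq (raddf_sum (mderiv i)) /= (bigD1 i) //= big1 ?addr0 => [|j ji].
  by rewrite mderiv_mulC mderivX mnm1E eqxx scale1r -[X in (X - _)%MM]add0m addmK mpolyX0 mulr1.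
by rewrite mderiv_mulC mderivX mnm1E (negPf ji) scale0r mulr0.
Qed.

Lemma minorE l : minor l = \sum_a (skew X l a)%:MP * mderiv a T.
Proof.
by apply: eq_bigr => a _; rewrite (mderiv_quadratic (proj1 bihomog_tangency)).
Qed.

Lemma det_minor l : \det (col' l (rel_jacobian F G H)) = minor l \/
  \det (col' l (rel_jacobian F G H)) = - minor l.
Proof.
rewrite det_mx22 !mxE minorE sum_ord3 /= !mderiv_incidence.
move: l; apply: ord3_ind; rewrite /skew !(x0E, x1E, x2E) ?(lift_x0, lift_x1, lift_x2)
  mpolyC0 !mpolyCN; move: (mderiv x0 T) (mderiv x1 T) (mderiv x2 T) => t0 t1 t2.
- by left; rewrite mul0r add0r mulNr addrC.
- by right; rewrite mul0r addr0 mulNr opprB.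
- by left; rewrite mul0r addr0 mulNr addrC.
Qed.


Lemma ideal_D_ideal : is_ideal (ideal_D F G H).
Proof.
split=> [|_ _ [c ->] [d ->]|s _ [c ->]].
- by exists (fun _ => 0); rewrite big1 // => i _; rewrite mul0r.
- by exists (fun i => c i + d i); rewrite -big_split; apply: eq_bigr => i _; rewrite mulrDl.
- by exists (fun i => s * c i); rewrite mulr_sumr; apply: eq_bigr => i _; rewrite mulrA.
Qed.

Let gens := [:: E; T] ++ [seq \det (col' l (rel_jacobian F G H)) | l <- enum 'I_3].

Let gen_mem i : (i < size gens)%N -> ideal_D F G H gens`_i.
Proof.
move=> hi; exists (fun j => (j == i)%:R); rewrite (bigD1 (Ordinal hi)) //=.
rewrite eqxx mul1r big1 ?addr0 // => j /eqP ji.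
by case: eqP => [e|_]; [case: ji; apply: val_inj | rewrite mul0r].
Qed.

Lemma incidence_mem : ideal_D F G H E. Proof. exact: (@gen_mem 0). Qed.
Lemma tangency_mem : ideal_D F G H T. Proof. exact: (@gen_mem 1). Qed.
Lemma minor_mem l : ideal_D F G H (minor l).
Proof.
have hl : (2 + l < size gens)%N by rewrite /gens size_cat size_map -cardE card_ord ltn_add2l.
have := gen_mem hl; rewrite /gens /= (nth_map ord0); last by rewrite size_enum_ord ltn_ord.
rewrite nth_ord_enum; case: (det_minor l) => -> // /(is_idealN ideal_D_ideal).
by rewrite opprK.
Qed.

Lemma ideal_D_sub N : is_ideal N -> N E -> N T -> (forall l, N (minor l)) ->
  forall s, ideal_D F G H s -> N s.
Proof.
move=> iN NE NT NM s [c ->]; apply: is_ideal_sum => // i _.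
case: (iN) => _ _ NMl; apply: NMl; case: i => -[|[|i]] hi //=.
move: hi; rewrite /gens /= size_map size_enum_ord !ltnS => hi.
rewrite (nth_map ord0); last by rewrite size_enum_ord.
rewrite (nth_ord_enum ord0 (Ordinal (hi : (i < 3)%N))).
by case: (det_minor (Ordinal (hi : (i < 3)%N))) => ->; [|apply: is_idealN].
Qed.

End IdealD.


(** * The pushforward of the cycle of D *)

Lemma prime_multiplicity (k : fieldType) (p Q : dualring k) :
  prime_divisor p -> Q != 0 -> exists n r, Q = p ^+ n * r /\ ~ dvd p r.
Proof.
move=> pp; have p0 : p != 0 by case: pp.
have size_p := prime_divisor_msize pp.
have [m] := ubnP (msize Q); elim: m Q => // m IH Q le_m Q0.
case: (classic (dvd p Q)) => [[q Qq]|nQ]; last first.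
  by exists 0%N, Q; rewrite expr0 mul1r.
have q0 : q != 0 by apply: contraNneq Q0 => q0; rewrite Qq q0 mulr0.
have [||n [r [qr nr]]] := IH q => //.
  move: le_m; rewrite Qq msizeM //; move: size_p; move: (msize p) => a.
  by move: (msize q) => b; lia.
by exists n.+1, r; rewrite Qq qr exprS mulrA.
Qed.

Section Pushforward.
Variable k : closedFieldType.
Hypothesis char0 : [pchar k] =i pred0.
Variables F G H : {mpoly k[3]}.
Hypotheses (hF : F \is 2.-homog) (hG : G \is 2.-homog) (hH : H \is 2.-homog).
Local Notation T := (tangency_eq F G H).
Local Notation E := (incidence_eq k).
Local Notation X := (fun i : 'I_3 => 'X_i : dualring k).
Local Notation h := (hess T).
Local Notation N := (line_mx X h).
Local Notation I := (ideal_D F G H).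
Let bT := bihomog_tangency hF hG hH.
Let hsym := hess_sym T.
Let iI := ideal_D_ideal F G H.

Lemma natr_pchar0 n : n.+1%:R != 0 :> k.
Proof. by rewrite (pcharf0P k).1. Qed.

(** The morphism f carries the inverse of an integer from k, where it exists in characteristic 0, to
    whichever ring the ideal lives in. *)
Lemma ideal_cancel_natr (n : nat) (R : comNzRingType) (J : R -> Prop) (f : {rmorphism k -> R}) s :
  is_ideal J -> J (s *+ n.+1) -> J s.
Proof.
case=> _ _ JM Js.
have -> : s = f (n.+1%:R^-1) * (s *+ n.+1).
  by rewrite -[s *+ _]mulr_natl mulrA -(rmorph_nat f) -rmorphM mulVf ?natr_pchar0 // rmorph1 mul1r.
exact: JM.
Qed.

Lemma ideal_cancel_natr_biring (n : nat) (J : biring k -> Prop) s :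
  is_ideal J -> J (s *+ n.+1) -> J s.
Proof. exact: (ideal_cancel_natr (@mpolyC 3 (dualring k) \o @mpolyC 3 k)). Qed.

Lemma skew_homog i j : skew X i j \is 1.-homog.
Proof.
by move: i j; do 2!apply: ord3_ind; rewrite /skew !(x0E, x1E, x2E) ?rpredN ?dhomogXi ?dhomog0.
Qed.

Lemma ideal_D_bicore s : I s -> bicore I s.
Proof.
have i0 : I 0 by case: iI.
move: s; apply: (ideal_D_sub hF hG hH).
- exact: (bicore_is_ideal iI).
- exact: (proj2 (bicore_bihomog i0 (bihomog_incidence k)) (incidence_mem F G H)).
- exact: (proj2 (bicore_bihomog i0 bT) (tangency_mem F G H)).
move=> l; suff bM : bihomog 1 2 (minor F G H l).
  exact: (proj2 (bicore_bihomog i0 bM) (minor_mem hF hG hH l)).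
apply: bihomog_sum => a; rewrite mulr_sumr; apply: bihomog_sum => b.
exact: (bihomogM (bihomogC (skew_homog l a)) (bihomogM (bihomogC (hess_homog hF hG hH a b)) (bihomogX k b))).
Qed.

Lemma line_mx_homog i c : N i c \is 3.-homog.
Proof.
apply: rpred_sum => a _; rewrite /pole mulr_sumr; apply: rpred_sum => b _.
exact: (dhomogM (skew_homog i a) (dhomogM (hess_homog hF hG hH a b) (skew_homog b c))).
Qed.

Lemma line_mx_cross_mem c i j : I ('X_i * (N j c)%:MP - 'X_j * (N i c)%:MP).
Proof.
have -> := line_mx_cross X hsym (@mpolyC 3 (dualring k)) (fun i => 'X_i) i j c.
case: (iI) => _ ID IM; apply: ID; apply: IM.
  exact: (minor_mem hF hG hH).
exact: (incidence_mem F G H).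
Qed.

Section Disc.
Variable Q : dualring k.
Hypothesis hQ : line_disc X h = Q *+ 4.

Lemma disc_mem i j : I (Q%:MP * ('X_j)%:MP * 'X_i).
Proof.
have [_ ID IM] := iI.
(* All terms of S lie in I by the proportionality of x to column c of N, and the remaining term is a
   multiple of a minor. *)
have step l c : I (Q%:MP * (skew X l c)%:MP * 'X_i).
  apply: (@ideal_cancel_natr_biring 3) => //.
  have := line_disc_cross X hsym (@mpolyC 3 (dualring k)) (fun a => 'X_a) l i c.
  set S := \sum_j _ => key.
  have IS : I S.
    by apply: is_ideal_sum => // a _; apply: IM; apply: line_mx_cross_mem.
  have -> : (Q%:MP * (skew X l c)%:MP * 'X_i : biring k) *+ 4
      = - S + - (N i c)%:MP * minor F G H l.
    rewrite key hQ rmorphMn /minor /=; ring.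
  by apply: ID; [apply: is_idealN | apply: IM; apply: minor_mem].
move: j; apply: ord3_ind.
(* In each case the entry of [skew] is chosen to be the wanted variable with a plus sign. *)
- by have := step x2 x1; rewrite /skew !(x0E, x1E, x2E).
- by have := step x0 x2; rewrite /skew !(x0E, x1E, x2E).
- by have := step x1 x0; rewrite /skew !(x0E, x1E, x2E).
Qed.

(** At a column of N the incidence equation vanishes identically, while the tangency equation, up to
    a factor 2, and the minors become multiples of disc = 4 Q. *)
Lemma eval_line_mx c s : I s -> dvd Q s.@[fun i => N i c].
Proof.
have iQ := dvd_is_ideal Q; have [D0 DD DM] := iQ.
have iN : is_ideal (fun s : biring k => dvd Q s.@[fun i => N i c]).
  by split=> [|u v|u v]; rewrite ?meval0 ?mevalD ?mevalM //; [apply: DD | apply: DM].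
move: s; apply: (ideal_D_sub hF hG hH); first exact: iN.
- rewrite /incidence_eq (raddf_sum (meval _)) /=.
  under eq_bigr => i _ do rewrite mevalM mevalC mevalXU.
  by rewrite incidence_line_mx.
- apply: (ideal_cancel_natr (n := 1) (@mpolyC 3 k) iQ).
  have -> : T.@[fun i => N i c] *+ 2 = (T *+ 2).@[fun i => N i c] by rewrite mevalMn.
  rewrite (euler_quadratic (proj1 bT)) (raddf_sum (meval _)) /=.
  under eq_bigr => i _.
    rewrite mevalM mevalXU (raddf_sum (meval _)) /=.
    under eq_bigr => j _ do rewrite mevalM mevalC mevalXU.
    over.
  rewrite line_mx_quad // hQ; exists (- N c c *+ 4); ring.
- move=> l; rewrite /minor (raddf_sum (meval _)) /=.
  under eq_bigr => i _.
    rewrite mevalM mevalC (raddf_sum (meval _)) /=.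
    under eq_bigr => j _ do rewrite mevalM mevalC mevalXU.
    over.
  rewrite line_mxK // hQ; exists (- skew X l c *+ 4); ring.
Qed.

Lemma pushforward_main : Q != 0 -> Q \is 4.-homog ->
  (forall p, prime_divisor p -> exists i c, ~ dvd p (N i c)) ->
  pushforward_is I Q.
Proof.
move=> Q0 Qhom nN p pp; have [n [r [Qr nr]]] := prime_multiplicity pp Q0.
exists n; last by exists r.
have [i [c nNic]] := nN p pp.
have [n0|n_gt0] := posnP n.
  rewrite n0; apply: (pushforward_coef_unit pp _ disc_mem).
  by move: Qr; rewrite n0 expr0 mul1r => ->.
apply: (pushforward_coef_point (Q := Q) (r := r) (bQ := 4) (ax := 3)
  (xi := fun i => N i c) (i0 := i)) => //.
- exact: ideal_D_bicore.
- by move=> j; apply: line_mx_homog.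
- exact: eval_line_mx.
- exact: line_mx_cross_mem.
- exact: disc_mem.
Qed.

End Disc.

Lemma dim_le1_line_mx : dim_le1 I ->
  forall p, prime_divisor p -> exists i c, ~ dvd p (N i c).
Proof.
move=> dimI p pp; apply: NNPP => nN.
have pN i c : dvd p (N i c).
  by apply: NNPP => nic; apply: nN; exists i, c.
apply: (rank_zero pp ideal_D_bicore _ dimI) => a b s Is.
have prime_p : prime_ideal (dvd p) by case: pp.
have iC := prime_is_ideal (content_prime prime_p).
set C := (fun q : {poly _} => _) in iC.
pose e : {rmorphism biring k -> {poly (dualring k)}} := @line_eval k a b.
have iN : is_ideal (fun s => C (e s)).
  have [C0 CD CM] := iC.
  split=> [|u v|u v]; rewrite ?rmorph0 ?rmorphD ?rmorphM //; [exact: CD | exact: CM].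
(* With u = e_a + t e_b, the generic point of the line used by [line_eval] becomes x = S u. *)
pose x i := e 'X_i; pose u i : {poly (dualring k)} := (i == a)%:R + (i == b)%:R * 'X.
have hx i : x i = \sum_j (skew X i j)%:P * u j.
  have -> : x i = (skew X i a)%:P + (skew X i b)%:P * 'X.
    exact: (etrans (mmapX _ _ _) (mmap1U _ _)).
  rewrite /u.
  under eq_bigr => j _ do rewrite mulrDr mulrA.
  rewrite big_split /= -mulr_suml.
  have pick c : \sum_j (skew X i j)%:P * (j == c)%:R = (skew X i c)%:P.
    rewrite (bigD1 c) //= eqxx mulr1 big1 ?addr0 // => j /negPf->.
    by rewrite mulr0.
  by rewrite !pick.
have CN i : C (\sum_j (N i j)%:P * u j).
  apply: is_ideal_sum => // j _; apply: (is_idealMr _ iC) => l.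
  by rewrite coefC; case: eqP => _; [apply: pN | case: (dvd_is_ideal p)].
have eC q : e q%:MP = q%:P by apply: mmapC.
suff : C (e s) by [].
move: s Is; apply: (ideal_D_sub hF hG hH); first exact: iN.
- rewrite /incidence_eq (rmorph_sum e) /=.
  under eq_bigr => i _ do rewrite rmorphM /= eC -/(x i).
  rewrite (incidence_span (f := @polyC _) hx).
  by case: iC.
- apply: (ideal_cancel_natr (n := 1) (@polyC _ \o @mpolyC 3 k) iC).
  rewrite -(rmorphMn e) (euler_quadratic (proj1 bT)) (rmorph_sum e) /=.
  under eq_bigr => i _.
    rewrite rmorphM /= -/(x i) (rmorph_sum e) /=.
    under eq_bigr => j _ do rewrite rmorphM /= eC -/(x j).
    over.
  rewrite (quad_span hsym (f := @polyC _) hx); apply: (is_idealN iC).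
  apply: (is_ideal_sum iC) => i _; case: (iC) => _ _ CM; exact: (CM _ _ (CN i)).
- move=> l; rewrite /minor (rmorph_sum e) /=.
  under eq_bigr => i _.
    rewrite rmorphM /= eC (rmorph_sum e) /=.
    under eq_bigr => j _ do rewrite rmorphM /= eC -/(x j).
    over.
  rewrite (minor_span hsym (f := @polyC _) hx); exact: CN.
Qed.

End Pushforward.

(** * Forms whose quartic vanishes *)

(** Named scalars allow the elimination by [subst] and [ring], without index lookups in the family
    of fifteen coordinates. *)
Record coefs (R : Type) := Coefs {
  c_a200 : R; c_a110 : R; c_a101 : R; c_a020 : R; c_a011 : R; c_a002 : R;
  c_b200 : R; c_b110 : R; c_b101 : R; c_b020 : R; c_b011 : R; c_b002 : R;
  c_c20 : R; c_c11 : R; c_c02 : R }.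

Section Elimination.
Variable R : comNzRingType.
Implicit Types c : coefs R.

(* [qijl c] is four times the coefficient of x^i y^j z^l (dual variables) in the
   quartic; the factor 4 removes the denominators. *)
Definition q400 c : R :=
  c_c02 c * c_c20 c *+ 4 - c_c11 c ^+ 2.
Definition q310 c : R :=
  - c_b002 c * c_c20 c *+ 4 + c_b011 c * c_c11 c *+ 2 - c_b020 c * c_c02 c *+ 4.
Definition q301 c : R :=
  c_a002 c * c_c20 c *+ 4 - c_a011 c * c_c11 c *+ 2 + c_a020 c * c_c02 c *+ 4.
Definition q220 c : R :=
  c_b002 c * c_b020 c *+ 4 - c_b011 c ^+ 2 - c_b101 c * c_c11 c *+ 2 + c_b110 c * c_c02 c *+ 4.
Definition q211 c : R :=
  - c_a002 c * c_b020 c *+ 4 + c_a011 c * c_b011 c *+ 2 - c_a020 c * c_b002 c *+ 4 + c_a101 c * c_c11 c *+ 2 - c_a110 c * c_c02 c *+ 4 + c_b101 c * c_c20 c *+ 4 - c_b110 c * c_c11 c *+ 2.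
Definition q202 c : R :=
  c_a002 c * c_a020 c *+ 4 - c_a011 c ^+ 2 - c_a101 c * c_c20 c *+ 4 + c_a110 c * c_c11 c *+ 2.
Definition q130 c : R :=
  - c_b002 c * c_b110 c *+ 4 + c_b011 c * c_b101 c *+ 2 - c_b200 c * c_c02 c *+ 4.
Definition q121 c : R :=
  c_a002 c * c_b110 c *+ 4 - c_a011 c * c_b101 c *+ 2 - c_a101 c * c_b011 c *+ 2 + c_a110 c * c_b002 c *+ 4 + c_a200 c * c_c02 c *+ 4 + c_b011 c * c_b110 c *+ 2 - c_b020 c * c_b101 c *+ 4 + c_b200 c * c_c11 c *+ 4.
Definition q112 c : R :=
  - c_a002 c * c_a110 c *+ 4 + c_a011 c * c_a101 c *+ 2 - c_a011 c * c_b110 c *+ 2 + c_a020 c * c_b101 c *+ 4 + c_a101 c * c_b020 c *+ 4 - c_a110 c * c_b011 c *+ 2 - c_a200 c * c_c11 c *+ 4 - c_b200 c * c_c20 c *+ 4.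
Definition q103 c : R :=
  c_a011 c * c_a110 c *+ 2 - c_a020 c * c_a101 c *+ 4 + c_a200 c * c_c20 c *+ 4.
Definition q040 c : R :=
  c_b002 c * c_b200 c *+ 4 - c_b101 c ^+ 2.
Definition q031 c : R :=
  - c_a002 c * c_b200 c *+ 4 + c_a101 c * c_b101 c *+ 2 - c_a200 c * c_b002 c *+ 4 - c_b011 c * c_b200 c *+ 4 + c_b101 c * c_b110 c *+ 2.
Definition q022 c : R :=
  c_a002 c * c_a200 c *+ 4 + c_a011 c * c_b200 c *+ 4 - c_a101 c * c_b110 c *+ 2 - c_a101 c ^+ 2 - c_a110 c * c_b101 c *+ 2 + c_a200 c * c_b011 c *+ 4 + c_b020 c * c_b200 c *+ 4 - c_b110 c ^+ 2.
Definition q013 c : R :=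
  - c_a011 c * c_a200 c *+ 4 - c_a020 c * c_b200 c *+ 4 + c_a101 c * c_a110 c *+ 2 + c_a110 c * c_b110 c *+ 2 - c_a200 c * c_b020 c *+ 4.
Definition q004 c : R :=
  c_a020 c * c_a200 c *+ 4 - c_a110 c ^+ 2.

Definition disc_zero c : Prop :=
  [/\ [/\ q400 c = 0, q310 c = 0, q301 c = 0, q220 c = 0 & q211 c = 0],
   [/\ q202 c = 0, q130 c = 0, q121 c = 0, q112 c = 0 & q103 c = 0]
   & [/\ q040 c = 0, q031 c = 0, q022 c = 0, q013 c = 0 & q004 c = 0]].

(* The pullback of the form under x |-> x + m y + n z. *)
Definition shear (m n : R) c : coefs R := Coefs
  (c_a200 c)
  (c_a110 c + c_a200 c * m *+ 2)
  (c_a101 c + c_a200 c * n *+ 3 - c_b200 c * m)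
  (c_a020 c + c_a110 c * m + c_a200 c * m ^+ 2)
  (c_a011 c + c_a101 c * m + c_a110 c * n *+ 2 + c_a200 c * m * n *+ 4 - c_b110 c * m - c_b200 c * m ^+ 2 *+ 2)
  (c_a002 c + c_a101 c * n *+ 2 + c_a200 c * n ^+ 2 *+ 3 - c_b101 c * m - c_b200 c * m * n *+ 2)
  (c_b200 c)
  (- c_a200 c * n + c_b110 c + c_b200 c * m *+ 3)
  (c_b101 c + c_b200 c * n *+ 2)
  (- c_a110 c * n - c_a200 c * m * n *+ 2 + c_b020 c + c_b110 c * m *+ 2 + c_b200 c * m ^+ 2 *+ 3)
  (- c_a101 c * n - c_a200 c * n ^+ 2 *+ 2 + c_b011 c + c_b101 c * m *+ 2 + c_b110 c * n + c_b200 c * m * n *+ 4)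
  (c_b002 c + c_b101 c * n + c_b200 c * n ^+ 2)
  (- c_a020 c * n - c_a110 c * m * n - c_a200 c * m ^+ 2 * n + c_b020 c * m + c_b110 c * m ^+ 2 + c_b200 c * m ^+ 3 + c_c20 c)
  (- c_a011 c * n - c_a101 c * m * n - c_a110 c * n ^+ 2 - c_a200 c * m * n ^+ 2 *+ 2 + c_b011 c * m + c_b101 c * m ^+ 2 + c_b110 c * m * n + c_b200 c * m ^+ 2 * n *+ 2 + c_c11 c)
  (- c_a002 c * n - c_a101 c * n ^+ 2 - c_a200 c * n ^+ 3 + c_b002 c * m + c_b101 c * m * n + c_b200 c * m * n ^+ 2 + c_c02 c).

Lemma shearK m n c : shear (- m) (- n) (shear m n c) = c.
Proof. by case: c => *; rewrite /shear /=; congr Coefs; ring. Qed.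

(** This and the next fourteen identities are the coefficients of Q(X, Y - m X, Z - n X): the shear
    x + m y + n z acts on the dual variables by this substitution. *)
Lemma q400_shear m n c : q400 (shear m n c) =
  q400 c + q301 c * (- n) ^+ 1 + q202 c * (- n) ^+ 2 + q103 c * (- n) ^+ 3 + q004 c * (- n) ^+ 4 + q310 c * (- m) ^+ 1 + q211 c * (- m) ^+ 1 * (- n) ^+ 1 + q112 c * (- m) ^+ 1 * (- n) ^+ 2 + q013 c * (- m) ^+ 1 * (- n) ^+ 3 + q220 c * (- m) ^+ 2 + q121 c * (- m) ^+ 2 * (- n) ^+ 1 + q022 c * (- m) ^+ 2 * (- n) ^+ 2 + q130 c * (- m) ^+ 3 + q031 c * (- m) ^+ 3 * (- n) ^+ 1 + q040 c * (- m) ^+ 4.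
Proof. by rewrite /q004 /q013 /q022 /q031 /q040 /q103 /q112 /q121 /q130 /q202 /q211 /q220 /q301 /q310 /q400 /shear /=; ring. Qed.
Lemma q310_shear m n c : q310 (shear m n c) =
  q310 c + q211 c * (- n) ^+ 1 + q112 c * (- n) ^+ 2 + q013 c * (- n) ^+ 3 + q220 c * (- m) ^+ 1 *+ 2 + q121 c * (- m) ^+ 1 * (- n) ^+ 1 *+ 2 + q022 c * (- m) ^+ 1 * (- n) ^+ 2 *+ 2 + q130 c * (- m) ^+ 2 *+ 3 + q031 c * (- m) ^+ 2 * (- n) ^+ 1 *+ 3 + q040 c * (- m) ^+ 3 *+ 4.
Proof. by rewrite /q013 /q022 /q031 /q040 /q112 /q121 /q130 /q211 /q220 /q310 /shear /=; ring. Qed.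
Lemma q301_shear m n c : q301 (shear m n c) =
  q301 c + q202 c * (- n) ^+ 1 *+ 2 + q103 c * (- n) ^+ 2 *+ 3 + q004 c * (- n) ^+ 3 *+ 4 + q211 c * (- m) ^+ 1 + q112 c * (- m) ^+ 1 * (- n) ^+ 1 *+ 2 + q013 c * (- m) ^+ 1 * (- n) ^+ 2 *+ 3 + q121 c * (- m) ^+ 2 + q022 c * (- m) ^+ 2 * (- n) ^+ 1 *+ 2 + q031 c * (- m) ^+ 3.
Proof. by rewrite /q004 /q013 /q022 /q031 /q103 /q112 /q121 /q202 /q211 /q301 /shear /=; ring. Qed.
Lemma q220_shear m n c : q220 (shear m n c) =
  q220 c + q121 c * (- n) ^+ 1 + q022 c * (- n) ^+ 2 + q130 c * (- m) ^+ 1 *+ 3 + q031 c * (- m) ^+ 1 * (- n) ^+ 1 *+ 3 + q040 c * (- m) ^+ 2 *+ 6.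
Proof. by rewrite /q022 /q031 /q040 /q121 /q130 /q220 /shear /=; ring. Qed.
Lemma q211_shear m n c : q211 (shear m n c) =
  q211 c + q112 c * (- n) ^+ 1 *+ 2 + q013 c * (- n) ^+ 2 *+ 3 + q121 c * (- m) ^+ 1 *+ 2 + q022 c * (- m) ^+ 1 * (- n) ^+ 1 *+ 4 + q031 c * (- m) ^+ 2 *+ 3.
Proof. by rewrite /q013 /q022 /q031 /q112 /q121 /q211 /shear /=; ring. Qed.
Lemma q202_shear m n c : q202 (shear m n c) =
  q202 c + q103 c * (- n) ^+ 1 *+ 3 + q004 c * (- n) ^+ 2 *+ 6 + q112 c * (- m) ^+ 1 + q013 c * (- m) ^+ 1 * (- n) ^+ 1 *+ 3 + q022 c * (- m) ^+ 2.
Proof. by rewrite /q004 /q013 /q022 /q103 /q112 /q202 /shear /=; ring. Qed.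
Lemma q130_shear m n c : q130 (shear m n c) =
  q130 c + q031 c * (- n) ^+ 1 + q040 c * (- m) ^+ 1 *+ 4.
Proof. by rewrite /q031 /q040 /q130 /shear /=; ring. Qed.
Lemma q121_shear m n c : q121 (shear m n c) =
  q121 c + q022 c * (- n) ^+ 1 *+ 2 + q031 c * (- m) ^+ 1 *+ 3.
Proof. by rewrite /q022 /q031 /q121 /shear /=; ring. Qed.
Lemma q112_shear m n c : q112 (shear m n c) =
  q112 c + q013 c * (- n) ^+ 1 *+ 3 + q022 c * (- m) ^+ 1 *+ 2.
Proof. by rewrite /q013 /q022 /q112 /shear /=; ring. Qed.
Lemma q103_shear m n c : q103 (shear m n c) =
  q103 c + q004 c * (- n) ^+ 1 *+ 4 + q013 c * (- m) ^+ 1.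
Proof. by rewrite /q004 /q013 /q103 /shear /=; ring. Qed.
Lemma q040_shear m n c : q040 (shear m n c) =
  q040 c.
Proof. by rewrite /q040 /shear /=; ring. Qed.
Lemma q031_shear m n c : q031 (shear m n c) =
  q031 c.
Proof. by rewrite /q031 /shear /=; ring. Qed.
Lemma q022_shear m n c : q022 (shear m n c) =
  q022 c.
Proof. by rewrite /q022 /shear /=; ring. Qed.
Lemma q013_shear m n c : q013 (shear m n c) =
  q013 c.
Proof. by rewrite /q013 /shear /=; ring. Qed.
Lemma q004_shear m n c : q004 (shear m n c) =
  q004 c.
Proof. by rewrite /q004 /shear /=; ring. Qed.

Lemma disc_zero_shear m n c : disc_zero c -> disc_zero (shear m n c).
Proof.
move=> [[h1 h2 h3 h4 h5] [h6 h7 h8 h9 h10] [h11 h12 h13 h14 h15]].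
rewrite /disc_zero q400_shear q310_shear q301_shear q220_shear q211_shear q202_shear q130_shear q121_shear q112_shear q103_shear q040_shear q031_shear q022_shear q013_shear q004_shear.
by rewrite !(h1, h2, h3, h4, h5, h6, h7, h8, h9, h10, h11, h12, h13, h14, h15)
  !(mul0r, mul0rn, addr0).
Qed.

(* (s0 x + s1 y + s2 z)^2 (p (x dy - y dx) + q (x dz - z dx) + r (y dz - z dy)) *)
Definition double_form (s0 s1 s2 p q r : R) : coefs R := Coefs
  (p * s0 ^+ 2)
  (p * s0 * s1 *+ 2)
  (p * s0 * s2 *+ 2 - r * s0 ^+ 2)
  (p * s1 ^+ 2)
  (p * s1 * s2 *+ 2 - r * s0 * s1 *+ 2)
  (p * s2 ^+ 2 - r * s0 * s2 *+ 2)
  (q * s0 ^+ 2)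
  (q * s0 * s1 *+ 2 + r * s0 ^+ 2)
  (q * s0 * s2 *+ 2)
  (q * s1 ^+ 2 + r * s0 * s1 *+ 2)
  (q * s1 * s2 *+ 2 + r * s0 * s2 *+ 2)
  (q * s2 ^+ 2)
  (r * s1 ^+ 2)
  (r * s1 * s2 *+ 2)
  (r * s2 ^+ 2).

Lemma double_form_shear m n s0 s1 s2 p q r :
  shear m n (double_form s0 s1 s2 p q r)
  = double_form s0 (s1 + s0 * m) (s2 + s0 * n) p q (r + m * q - n * p).
Proof. by rewrite /shear /double_form /=; congr Coefs; ring. Qed.

Definition is_double c : Prop := exists s0 s1 s2 p q r,
  c = double_form s0 s1 s2 p q r /\ ~ [/\ s0 = 0, s1 = 0 & s2 = 0].

Lemma is_double_shear m n c : is_double (shear m n c) -> is_double c.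
Proof.
case=> s0 [s1 [s2 [p [q [r [e s]]]]]]; rewrite -(shearK m n c) e double_form_shear.
do 6!eexists; split; first by [].
case=> s00 s10 s20; apply: s; move: s10 s20.
by rewrite s00 !mul0r !addr0.
Qed.

End Elimination.

(** * Solving the fifteen equations over a field *)

Section EliminationField.
Variable k : fieldType.
Hypothesis k2 : 2%:R != 0 :> k.
Implicit Types c : coefs k.

Let k4 : 4%:R != 0 :> k.
Proof. by rewrite (natrM _ 2 2) mulf_neq0. Qed.

Let cancel4 (x q : k) : q != 0 -> x * q *+ 4 = 0 -> x = 0.
Proof.
move=> q0 /eqP; rewrite -mulr_natl mulf_eq0 (negPf k4) /= mulf_eq0 (negPf q0) orbF.
by move/eqP.
Qed.

Let sqr0 (x : k) : x ^+ 2 = 0 -> x = 0.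
Proof. by move/eqP; rewrite sqrf_eq0 => /eqP. Qed.

(* Up to a factor, the square of this cubic is the value of the quartic at
   (0 : a200 : b200), the tangent line at (1:0:0). *)
Lemma disc_zero_pencil c : disc_zero c ->
  c_b101 c * c_a200 c ^+ 2 - (c_b110 c + c_a101 c) * c_a200 c * c_b200 c
    + c_a110 c * c_b200 c ^+ 2 = 0.
Proof.
case: c => p a110 a101 a020 a011 a002 q b110 b101 b020 b011 b002 c20 c11 c02.
move=> [_ _ [h040 h031 h022 h013 h004]] /=; apply: sqr0.
transitivity (- (q040 (Coefs p a110 a101 a020 a011 a002 q b110 b101 b020 b011 b002 c20 c11 c02) * p ^+ 4
  + q031 (Coefs p a110 a101 a020 a011 a002 q b110 b101 b020 b011 b002 c20 c11 c02) * p ^+ 3 * q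
  + q022 (Coefs p a110 a101 a020 a011 a002 q b110 b101 b020 b011 b002 c20 c11 c02) * p ^+ 2 * q ^+ 2
  + q013 (Coefs p a110 a101 a020 a011 a002 q b110 b101 b020 b011 b002 c20 c11 c02) * p * q ^+ 3
  + q004 (Coefs p a110 a101 a020 a011 a002 q b110 b101 b020 b011 b002 c20 c11 c02) * q ^+ 4)).
  by rewrite /q040 /q031 /q022 /q013 /q004 /=; ring.
by rewrite h040 h031 h022 h013 h004 !mul0r !addr0 oppr0.
Qed.

Let double1 (p q r : k) : is_double (Coefs p 0 (- r) 0 0 0 q r 0 0 0 0 0 0 0).
Proof.
exists 1, 0, 0, p, q, r; split; last by case=> /eqP; rewrite oner_eq0.
by congr Coefs; ring.
Qed.

(** In this normal form the equations are triangular: each in turn is, up to sign, four times b200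
    times one new unknown or a sum of two, or else a square. What survives is x^2 times a form with
    constant coefficients p, q, r. *)
Lemma is_double_b200_neq0 c : c_b200 c != 0 -> c_b101 c = 0 ->
  c_a101 c = - c_b110 c -> disc_zero c -> is_double c.
Proof.
move=> + + + dz; have := disc_zero_pencil dz; move: dz.
case: c => p a110 a101 a020 a011 a002 q r b101 b020 b011 b002 c20 c11 c02 /=.
move=> [] [_ _ _ h220 _] [h202 h130 h121 h112 h103] [h040 h031 h022 h013 h004].
move=> u q0 b0 a0; subst b101 a101.
rewrite /q220 /= in h220; rewrite /q202 /= in h202; rewrite /q130 /= in h130.
rewrite /q121 /= in h121; rewrite /q112 /= in h112; rewrite /q103 /= in h103.
rewrite /q040 /= in h040; rewrite /q031 /= in h031; rewrite /q022 /= in h022.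
rewrite /q013 /= in h013; rewrite /q004 /= in h004.
(* With b101 = 0 and b110 + a101 = 0, the cubic of [disc_zero_pencil] reduces to a110 b200^2. *)
have e : a110 = 0.
  have q20 : q ^+ 2 != 0 by rewrite expf_neq0.
  by apply: (mulIf q20); rewrite mul0r -[RHS]u; ring.
subst a110.
have e : b002 = 0 by apply: (cancel4 q0); rewrite -[RHS]h040; ring.
subst b002.
have e : a002 + b011 = 0.
  by apply: (cancel4 q0); rewrite -oppr0 -[in RHS]h031; ring.
have {}e : a002 = - b011 by apply/eqP; rewrite -addr_eq0 e.
subst a002.
have e : a011 + b020 = 0 by apply: (cancel4 q0); rewrite -[RHS]h022; ring.
have {}e : b020 = - a011 by apply/eqP; rewrite -addr_eq0 addrC e.
subst b020.
have e : a020 = 0.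
  by apply: (cancel4 q0); rewrite -oppr0 -[in RHS]h013; ring.
subst a020.
have e : c02 = 0.
  by apply: (cancel4 q0); rewrite -oppr0 -[in RHS]h130; ring.
subst c02.
have e : c11 = 0 by apply: (cancel4 q0); rewrite -[RHS]h121; ring.
subst c11.
have e : b011 = 0 by apply: sqr0; rewrite -oppr0 -[in RHS]h220; ring.
subst b011.
have e : c20 = 0.
  by apply: (cancel4 q0); rewrite -oppr0 -[in RHS]h112; ring.
subst c20.
have e : a011 = 0 by apply: sqr0; rewrite -oppr0 -[in RHS]h202; ring.
subst a011.
by rewrite !oppr0; apply: double1.
Qed.

Lemma is_double_a200_neq0 c : c_a200 c != 0 -> c_b200 c = 0 -> c_a110 c = 0 ->
  c_a101 c = - c_b110 c -> disc_zero c -> is_double c.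
Proof.
move=> + + + + dz; have := disc_zero_pencil dz; move: dz.
case: c => p a110 a101 a020 a011 a002 q r b101 b020 b011 b002 c20 c11 c02 /=.
move=> [] [_ _ _ h220 _] [h202 h130 h121 h112 h103] [h040 h031 h022 h013 h004].
move=> u p0 q0 b0 a0; subst q a110 a101.
rewrite /q220 /= in h220; rewrite /q202 /= in h202; rewrite /q130 /= in h130.
rewrite /q121 /= in h121; rewrite /q112 /= in h112; rewrite /q103 /= in h103.
rewrite /q040 /= in h040; rewrite /q031 /= in h031; rewrite /q022 /= in h022.
rewrite /q013 /= in h013; rewrite /q004 /= in h004.
(* Here the cubic of [disc_zero_pencil] reduces to b101 a200^2, and the elimination goes on with
   a200 as pivot. *)
have e : b101 = 0.
  have p20 : p ^+ 2 != 0 by rewrite expf_neq0.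
  by apply: (mulIf p20); rewrite mul0r -[RHS]u; ring.
subst b101.
have e : a020 = 0 by apply: (cancel4 p0); rewrite -[RHS]h004; ring.
subst a020.
have e : b002 = 0.
  by apply: (cancel4 p0); rewrite -oppr0 -[in RHS]h031; ring.
subst b002.
have e : a002 + b011 = 0 by apply: (cancel4 p0); rewrite -[RHS]h022; ring.
have {}e : a002 = - b011 by apply/eqP; rewrite -addr_eq0 e.
subst a002.
have e : a011 + b020 = 0.
  by apply: (cancel4 p0); rewrite -oppr0 -[in RHS]h013; ring.
have {}e : b020 = - a011 by apply/eqP; rewrite -addr_eq0 addrC e.
subst b020.
have e : c20 = 0 by apply: (cancel4 p0); rewrite -[RHS]h103; ring.
subst c20.
have e : c11 = 0.
  by apply: (cancel4 p0); rewrite -oppr0 -[in RHS]h112; ring.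
subst c11.
have e : a011 = 0 by apply: sqr0; rewrite -oppr0 -[in RHS]h202; ring.
subst a011.
have e : c02 = 0 by apply: (cancel4 p0); rewrite -[RHS]h121; ring.
subst c02.
have e : b011 = 0 by apply: sqr0; rewrite -oppr0 -[in RHS]h220; ring.
subst b011.
by rewrite !oppr0; apply: double1.
Qed.

(** The pivot is now b110; after the normalisation each remaining equation isolates one unknown
    times 4 b110. *)
Lemma is_double_b110_neq0 c : c_a200 c = 0 -> c_b200 c = 0 -> c_a110 c = 0 ->
  c_b101 c = 0 -> c_a101 c = - c_b110 c -> c_b110 c != 0 ->
  c_b020 c = 0 -> c_b011 c = 0 -> disc_zero c -> is_double c.
Proof.
case: c => p a110 a101 a020 a011 a002 q r b101 b020 b011 b002 c20 c11 c02 /=.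
move=> -> -> -> -> -> r0 -> ->.
move=> [] [_ _ _ h220 h211] [h202 h130 h121 h112 h103] _.
rewrite /q220 /= in h220; rewrite /q202 /= in h202; rewrite /q130 /= in h130.
rewrite /q121 /= in h121; rewrite /q112 /= in h112; rewrite /q103 /= in h103.
rewrite /q211 /= in h211.
have e : b002 = 0.
  by apply: (cancel4 r0); rewrite -oppr0 -[in RHS]h130; ring.
subst b002.
have e : a020 = 0 by apply: (cancel4 r0); rewrite -[RHS]h103; ring.
subst a020.
have e : a002 = 0 by apply: (cancel4 r0); rewrite -[RHS]h121; ring.
subst a002.
have e : a011 = 0.
  by apply: (cancel4 r0); rewrite -oppr0 -[in RHS]h112; ring.
subst a011.
have e : c02 = 0 by apply: (cancel4 r0); rewrite -[RHS]h220; ring.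
subst c02.
have e : c20 = 0 by apply: (cancel4 r0); rewrite -[RHS]h202; ring.
subst c20.
have e : c11 = 0.
  by apply: (cancel4 r0); rewrite -oppr0 -[in RHS]h211; ring.
subst c11.
exact: double1.
Qed.

(* A totally isotropic subspace of the space of binary quadratic forms, for
   the discriminant, consists of the multiples of one square. *)
Lemma isotropic_square (v0 v1 v2 : k) : ~ [/\ v0 = 0, v1 = 0 & v2 = 0] ->
  v0 * v2 *+ 4 = v1 ^+ 2 ->
  exists s1 s2, ~ (s1 = 0 /\ s2 = 0) /\ forall b0 b1 b2, b0 * b2 *+ 4 = b1 ^+ 2 ->
    (v0 * b2 + v2 * b0) *+ 2 = v1 * b1 ->
    exists t, [/\ b0 = t * s1 ^+ 2, b1 = t * s1 * s2 *+ 2 & b2 = t * s2 ^+ 2].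
Proof.
move=> v0n v_iso; have [v00|v00] := eqVneq v0 0.
  have v10 : v1 = 0 by apply: sqr0; rewrite -v_iso v00 mul0r mul0rn.
  have v20 : v2 != 0 by apply/eqP => v20; apply: v0n.
  (* Here v is a multiple of the square of the second variable. *)
  exists 0, 1; split=> [[_ /eqP]|b0 b1 b2 b_iso bv]; first by rewrite oner_eq0.
  have b00 : b0 = 0.
    apply: (cancel4 v20); transitivity ((v0 * b2 + v2 * b0) *+ 2 *+ 2).
      by rewrite v00; ring.
    by rewrite bv v10 mul0r mul0rn.
  have b10 : b1 = 0 by apply: sqr0; rewrite -b_iso b00 mul0r mul0rn.
  by exists b2; split; rewrite ?b00 ?b10; ring.
(* Completing the square: 4 v0 (v0 y^2 + v1 y z + v2 z^2) = (2 v0 y + v1 z)^2. *)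
exists (v0 *+ 2), v1; split=> [[/eqP]|b0 b1 b2 b_iso bv].
  by rewrite -mulr_natl mulf_eq0 (negPf k2) (negPf v00).
(* The square of the difference is a combination of the two isotropy conditions and the
   orthogonality condition. *)
have e1 : b1 * v0 = b0 * v1.
  apply/eqP; rewrite -subr_eq0; apply/eqP/sqr0.
  transitivity (b1 ^+ 2 * v0 ^+ 2 - v1 * b1 * b0 * v0 *+ 2 + b0 ^+ 2 * v1 ^+ 2).
    by ring.
  by rewrite -bv -v_iso -b_iso; ring.
have e2 : b2 * v0 ^+ 2 *+ 4 = b0 * v1 ^+ 2.
  transitivity ((v0 * b2 + v2 * b0) *+ 2 * v0 *+ 2 - v0 * v2 *+ 4 * b0); first by ring.
  rewrite bv v_iso; transitivity (b1 * v0 * v1 *+ 2 - v1 ^+ 2 * b0); first by ring.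
  by rewrite e1; ring.
have n4 : v0 ^+ 2 *+ 4 != 0 by rewrite -mulr_natl mulf_neq0 // expf_neq0.
exists (b0 / (v0 ^+ 2 *+ 4)); split.
- by field; rewrite v00 ?k2 ?k4.
- apply: (mulIf v00); rewrite e1; field; by rewrite v00 ?k2 ?k4.
- apply: (mulIf n4); rewrite -mulrnAr in e2; rewrite e2; field; by rewrite v00 ?k2 ?k4.
Qed.

Lemma is_double_binary c : c_a200 c = 0 -> c_b200 c = 0 -> c_a110 c = 0 ->
  c_b101 c = 0 -> c_a101 c = 0 -> c_b110 c = 0 -> disc_zero c -> is_double c.
Proof.
case: c => p a110 a101 a020 a011 a002 q r b101 b020 b011 b002 c20 c11 c02 /=.
move=> -> -> -> -> -> ->.
move=> [] [h400 h310 h301 h220 h211] [h202 _ _ _ _] _.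
rewrite /q400 /= in h400; rewrite /q310 /= in h310; rewrite /q301 /= in h301.
rewrite /q220 /= in h220; rewrite /q211 /= in h211; rewrite /q202 /= in h202.
have iso (u0 u1 u2 : k) e : e = 0 -> e = u2 * u0 *+ 4 - u1 ^+ 2 -> u0 * u2 *+ 4 = u1 ^+ 2.
  by move=> -> /esym/eqP; rewrite subr_eq0 mulrC => /eqP.
(* The sign s is the one with which the polarised discriminant occurs in the given coefficient of
   the quartic. *)
have orth (u0 u1 u2 v0 v1 v2 e s : k) : s ^+ 2 = 1 -> e = 0 ->
    e = s * (u0 * v2 *+ 4 + u2 * v0 *+ 4 - u1 * v1 *+ 2) -> (u0 * v2 + u2 * v0) *+ 2 = u1 * v1.
  move=> s1 -> h; have s0 : s != 0 by apply: contraTneq isT => s0; move/eqP: s1; rewrite s0 expr0n eq_sym oner_eq0.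
  apply/eqP; rewrite -subr_eq0; apply/eqP; apply: (mulfI k2); apply: (mulfI s0).
  by rewrite !mulr0 h; ring.
have ia : a020 * a002 *+ 4 = a011 ^+ 2 by apply: (iso _ _ _ _ h202); ring.
have ib : b020 * b002 *+ 4 = b011 ^+ 2 by apply: (iso _ _ _ _ h220); ring.
have ic : c20 * c02 *+ 4 = c11 ^+ 2 by apply: (iso _ _ _ _ h400); ring.
have oab : (a020 * b002 + a002 * b020) *+ 2 = a011 * b011.
  by apply: (orth _ _ _ _ _ _ _ (-1) _ h211); ring.
have oac : (a020 * c02 + a002 * c20) *+ 2 = a011 * c11.
  by apply: (orth _ _ _ _ _ _ _ 1 _ h301); ring.
have obc : (b020 * c02 + b002 * c20) *+ 2 = b011 * c11.
  by apply: (orth _ _ _ _ _ _ _ (-1) _ h310); ring.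
have self (u0 u1 u2 : k) : u0 * u2 *+ 4 = u1 ^+ 2 -> (u0 * u2 + u2 * u0) *+ 2 = u1 * u1.
  by move=> h; rewrite -expr2 -h; ring.
have sym (u0 u1 u2 v0 v1 v2 : k) : (u0 * v2 + u2 * v0) *+ 2 = u1 * v1 ->
    (v0 * u2 + v2 * u0) *+ 2 = v1 * u1.
  by move=> h; rewrite [RHS]mulrC -h; ring.
suff [s1 [s2 [s [ta [tb [tc [[-> -> ->] [-> -> ->] [-> -> ->]]]]]]]] :
    exists s1 s2, ~ (s1 = 0 /\ s2 = 0) /\ exists ta tb tc,
    [/\ [/\ a020 = ta * s1 ^+ 2, a011 = ta * s1 * s2 *+ 2 & a002 = ta * s2 ^+ 2],
     [/\ b020 = tb * s1 ^+ 2, b011 = tb * s1 * s2 *+ 2 & b002 = tb * s2 ^+ 2]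
     & [/\ c20 = tc * s1 ^+ 2, c11 = tc * s1 * s2 *+ 2 & c02 = tc * s2 ^+ 2]].
  exists 0, s1, s2, ta, tb, tc; split; last by case=> _ ? ?; apply: s.
  by rewrite /double_form; congr Coefs; ring.
case: (classic [/\ a020 = 0, a011 = 0 & a002 = 0]) => [[a0 a1 a2]|na]; last first.
  have [s1 [s2 [s hs]]] := isotropic_square na ia.
  have [ta ha] := hs _ _ _ ia (self _ _ _ ia).
  have [tb hb] := hs _ _ _ ib oab; have [tc hc] := hs _ _ _ ic oac.
  by exists s1, s2; split=> //; exists ta, tb, tc.
case: (classic [/\ b020 = 0, b011 = 0 & b002 = 0]) => [[b0 b1 b2]|nb]; last first.
  have [s1 [s2 [s hs]]] := isotropic_square nb ib.
  have [ta ha] := hs _ _ _ ia (sym _ _ _ _ _ _ oab).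
  have [tb hb] := hs _ _ _ ib (self _ _ _ ib); have [tc hc] := hs _ _ _ ic obc.
  by exists s1, s2; split=> //; exists ta, tb, tc.
case: (classic [/\ c20 = 0, c11 = 0 & c02 = 0]) => [[c0 c1 c2]|nc]; last first.
  have [s1 [s2 [s hs]]] := isotropic_square nc ic.
  have [ta ha] := hs _ _ _ ia (sym _ _ _ _ _ _ oac).
  have [tb hb] := hs _ _ _ ib (sym _ _ _ _ _ _ obc).
  have [tc hc] := hs _ _ _ ic (self _ _ _ ic).
  by exists s1, s2; split=> //; exists ta, tb, tc.
(* For the zero form any square will do, with all three multipliers 0. *)
exists 1, 0; split; first by case=> /eqP; rewrite oner_eq0.
by exists 0, 0, 0; rewrite a0 a1 a2 b0 b1 b2 c0 c1 c2; split; split; ring.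
Qed.

Lemma disc_zero_is_double c : disc_zero c -> is_double c.
Proof.
move=> dz; have [q0|q0] := eqVneq (c_b200 c) 0; last first.
  (* Under the shear b101 becomes b101 + 2 b200 n, and a101 + b110 becomes a101 + b110 + 2 a200 n +
     2 b200 m; m and n are chosen to annihilate both. *)
  pose n := - c_b101 c / (c_b200 c *+ 2).
  pose m := (- (c_a101 c + c_b110 c) / 2%:R - c_a200 c * n) / c_b200 c.
  apply: (@is_double_shear _ m n); apply: is_double_b200_neq0; last exact: disc_zero_shear.
  - by [].
  - by rewrite /shear /= /n; field; rewrite q0 k2.
  - by rewrite /shear /= /m; field; rewrite q0 k2.
have [p0|p0] := eqVneq (c_a200 c) 0; last first.
  (* Now a110 changes by 2 a200 m, and a101 + b110 by 2 a200 n. *)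
  pose m := - c_a110 c / (c_a200 c *+ 2).
  pose n := - (c_a101 c + c_b110 c) / (c_a200 c *+ 2).
  apply: (@is_double_shear _ m n); apply: is_double_a200_neq0; last exact: disc_zero_shear.
  - by [].
  - by [].
  - by rewrite /shear /= /m; field; rewrite p0 k2.
  - by rewrite /shear /= /m /n q0; field; rewrite p0 k2.
(* With a200 = b200 = 0 these coefficients are minus the squares of b101, of a101 + b110 (once b101
   and a110 vanish), and of a110. *)
have [_ _ [h040 _ h022 _ h004]] := dz.
have b101 : c_b101 c = 0.
  by apply: sqr0; rewrite -oppr0 -[in RHS]h040 /q040 q0; ring.
have a110 : c_a110 c = 0.
  by apply: sqr0; rewrite -oppr0 -[in RHS]h004 /q004 p0; ring.
have ab : c_b110 c + c_a101 c = 0.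
  by apply: sqr0; rewrite -oppr0 -[in RHS]h022 /q022 p0 q0 b101 a110; ring.
have a101 : c_a101 c = - c_b110 c by apply/eqP; rewrite -addr_eq0 addrC ab.
have [r0|r0] := eqVneq (c_b110 c) 0.
  by apply: is_double_binary => //; rewrite a101 r0 oppr0.
(* Because a101 = -b110, the shear changes b020 by 2 b110 m and b011 by 2 b110 n. *)
pose m := - c_b020 c / (c_b110 c *+ 2); pose n := - c_b011 c / (c_b110 c *+ 2).
apply: (@is_double_shear _ m n); apply: is_double_b110_neq0; last exact: disc_zero_shear.
all: rewrite /shear /= ?(p0, q0, a110, b101, a101).
- by [].
- by [].
- by ring.
- by ring.
- by ring.
- by rewrite !(mul0r, mul0rn, oppr0, addr0, add0r).
- by rewrite /m; field; rewrite r0 k2.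
- by rewrite /n; field; rewrite r0 k2.
Qed.

End EliminationField.


(** * Coefficients of forms and vector fields *)

Definition mn (a b c : nat) : 'X_{1..3} := [multinom vec_fun a b c i | i < 3].

Lemma mn0 a b c : mn a b c x0 = a. Proof. by rewrite mnmE /vec_fun x0E. Qed.
Lemma mn1 a b c : mn a b c x1 = b. Proof. by rewrite mnmE /vec_fun x1E. Qed.
Lemma mn2 a b c : mn a b c x2 = c. Proof. by rewrite mnmE /vec_fun x2E. Qed.

Lemma mnP (m m' : 'X_{1..3}) :
  m x0 = m' x0 -> m x1 = m' x1 -> m x2 = m' x2 -> m = m'.
Proof. by move=> e0 e1 e2; apply/mnmP; apply: ord3_ind. Qed.

Lemma mn_eq a b c a' b' c' : (mn a b c == mn a' b' c') = [&& a == a', b == b' & c == c'].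
Proof.
apply/eqP/and3P => [e|[/eqP-> /eqP-> /eqP->] //].
have e' i : mn a b c i = mn a' b' c' i by rewrite e.
by move: (e' x0) (e' x1) (e' x2); rewrite !(mn0, mn1, mn2) => -> -> ->.
Qed.

Section Monomials.
Variable R : comNzRingType.
Implicit Types q : {mpoly R[3]}.

Lemma mnE a b c : 'X_[mn a b c] = 'X_x0 ^+ a * 'X_x1 ^+ b * 'X_x2 ^+ c :> {mpoly R[3]}.
Proof. by rewrite mpolyXE_id prod_ord3 mn0 mn1 mn2. Qed.

Lemma mcoeffXMS i q m : ('X_i * q)@_(U_(i) + m) = q@_m.
Proof. by rewrite mulrC mcoeffMX. Qed.

Lemma mcoeffXM0 i q (m : 'X_{1..3}) : m i = 0%N -> ('X_i * q)@_m = 0.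
Proof.
move=> mi; rewrite (mpolyE q) mulr_sumr raddf_sum big1 // => m' _ /=.
rewrite -scalerAr mcoeffZ -mpolyXD mcoeffX; case: eqP => [e|]; last by rewrite mulr0.
by move: mi; rewrite -e mnmDE mnm1E eqxx.
Qed.

Lemma mcoeffX0S q a b c : ('X_x0 * q)@_(mn a.+1 b c) = q@_(mn a b c).
Proof.
rewrite -[RHS](mcoeffXMS x0); congr (mcoeff _ _); apply: mnP;
  by rewrite mnmDE mnm1E ?(mn0, mn1, mn2) ?eqxx ?neqx.
Qed.
Lemma mcoeffX1S q a b c : ('X_x1 * q)@_(mn a b.+1 c) = q@_(mn a b c).
Proof.
rewrite -[RHS](mcoeffXMS x1); congr (mcoeff _ _); apply: mnP;
  by rewrite mnmDE mnm1E ?(mn0, mn1, mn2) ?eqxx ?neqx.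
Qed.
Lemma mcoeffX2S q a b c : ('X_x2 * q)@_(mn a b c.+1) = q@_(mn a b c).
Proof.
rewrite -[RHS](mcoeffXMS x2); congr (mcoeff _ _); apply: mnP;
  by rewrite mnmDE mnm1E ?(mn0, mn1, mn2) ?eqxx ?neqx.
Qed.
Lemma mcoeffX00 q b c : ('X_x0 * q)@_(mn 0 b c) = 0.
Proof. by rewrite mcoeffXM0 // mn0. Qed.
Lemma mcoeffX10 q a c : ('X_x1 * q)@_(mn a 0 c) = 0.
Proof. by rewrite mcoeffXM0 // mn1. Qed.
Lemma mcoeffX20 q a b : ('X_x2 * q)@_(mn a b 0) = 0.
Proof. by rewrite mcoeffXM0 // mn2. Qed.
Definition mcoeffXM := (mcoeffX0S, mcoeffX1S, mcoeffX2S, mcoeffX00, mcoeffX10, mcoeffX20).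

Lemma mnU : ((U_(x0) + U_(x0) = mn 2 0 0)%MM * (U_(x0) + U_(x1) = mn 1 1 0)%MM *
  (U_(x0) + U_(x2) = mn 1 0 1)%MM * (U_(x1) + U_(x1) = mn 0 2 0)%MM *
  (U_(x1) + U_(x2) = mn 0 1 1)%MM * (U_(x2) + U_(x2) = mn 0 0 2)%MM).
Proof.
by do !split; apply: mnP; rewrite mnmDE !mnm1E ?(mn0, mn1, mn2) ?eqxx ?neqx.
Qed.

Definition quad3 (u v w p q r : R) : {mpoly R[3]} :=
  u *: 'X_[mn 2 0 0] + v *: 'X_[mn 1 1 0] + w *: 'X_[mn 1 0 1]
  + p *: 'X_[mn 0 2 0] + q *: 'X_[mn 0 1 1] + r *: 'X_[mn 0 0 2].

Lemma mcoeff_quad3 (u v w p q r : R) (F := quad3 u v w p q r) :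
  [/\ F@_(mn 2 0 0) = u, F@_(mn 1 1 0) = v & F@_(mn 1 0 1) = w] /\
  [/\ F@_(mn 0 2 0) = p, F@_(mn 0 1 1) = q & F@_(mn 0 0 2) = r].
Proof.
rewrite /F /quad3 !mcoeffD !mcoeffZ !mcoeffX !mn_eq /=.
by rewrite !mulr0 !mulr1 !addr0 !add0r.
Qed.

Lemma mcoeff_lincomb (a : 'I_3 -> R) (u : 'I_3 -> {mpoly R[3]}) m :
  (\sum_i (a i)%:MP * u i)@_m = \sum_i a i * (u i)@_m.
Proof. by rewrite raddf_sum; apply: eq_bigr => i _; rewrite mul_mpolyC /= mcoeffZ. Qed.

Definition coefs_of (w : 'I_15 -> R) : coefs R := Coefs
  (acoef w 2 0 0) (acoef w 1 1 0) (acoef w 1 0 1)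
  (acoef w 0 2 0) (acoef w 0 1 1) (acoef w 0 0 2)
  (bcoef w 2 0 0) (bcoef w 1 1 0) (bcoef w 1 0 1)
  (bcoef w 0 2 0) (bcoef w 0 1 1) (bcoef w 0 0 2)
  (ccoef w 2 0) (ccoef w 1 1) (ccoef w 0 2).

(** This division-free multiple of the quartic makes sense over every commutative ring and commutes
    with ring morphisms. *)
Definition disc_poly (c : coefs R) : {mpoly R[3]} :=
  q400 c *: 'X_[mn 4 0 0]
  + q310 c *: 'X_[mn 3 1 0]
  + q220 c *: 'X_[mn 2 2 0]
  + q130 c *: 'X_[mn 1 3 0]
  + q040 c *: 'X_[mn 0 4 0]
  + q301 c *: 'X_[mn 3 0 1]
  + q211 c *: 'X_[mn 2 1 1]
  + q121 c *: 'X_[mn 1 2 1]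
  + q031 c *: 'X_[mn 0 3 1]
  + q202 c *: 'X_[mn 2 0 2]
  + q112 c *: 'X_[mn 1 1 2]
  + q022 c *: 'X_[mn 0 2 2]
  + q103 c *: 'X_[mn 1 0 3]
  + q013 c *: 'X_[mn 0 1 3]
  + q004 c *: 'X_[mn 0 0 4].

Lemma disc_poly_eq0 c : disc_poly c = 0 -> disc_zero c.
Proof.
move=> /mpolyP e; have {}e i j l := e (mn i j l).
rewrite /disc_zero; split; split.
- by move: (e 4%N 0%N 0%N); rewrite /disc_poly !mcoeffD !mcoeffZ !mcoeffX !mn_eq /= !mulr0 !mulr1 !addr0 ?add0r mcoeff0.
- by move: (e 3%N 1%N 0%N); rewrite /disc_poly !mcoeffD !mcoeffZ !mcoeffX !mn_eq /= !mulr0 !mulr1 !addr0 ?add0r mcoeff0.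
- by move: (e 3%N 0%N 1%N); rewrite /disc_poly !mcoeffD !mcoeffZ !mcoeffX !mn_eq /= !mulr0 !mulr1 !addr0 ?add0r mcoeff0.
- by move: (e 2%N 2%N 0%N); rewrite /disc_poly !mcoeffD !mcoeffZ !mcoeffX !mn_eq /= !mulr0 !mulr1 !addr0 ?add0r mcoeff0.
- by move: (e 2%N 1%N 1%N); rewrite /disc_poly !mcoeffD !mcoeffZ !mcoeffX !mn_eq /= !mulr0 !mulr1 !addr0 ?add0r mcoeff0.
- by move: (e 2%N 0%N 2%N); rewrite /disc_poly !mcoeffD !mcoeffZ !mcoeffX !mn_eq /= !mulr0 !mulr1 !addr0 ?add0r mcoeff0.
- by move: (e 1%N 3%N 0%N); rewrite /disc_poly !mcoeffD !mcoeffZ !mcoeffX !mn_eq /= !mulr0 !mulr1 !addr0 ?add0r mcoeff0.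
- by move: (e 1%N 2%N 1%N); rewrite /disc_poly !mcoeffD !mcoeffZ !mcoeffX !mn_eq /= !mulr0 !mulr1 !addr0 ?add0r mcoeff0.
- by move: (e 1%N 1%N 2%N); rewrite /disc_poly !mcoeffD !mcoeffZ !mcoeffX !mn_eq /= !mulr0 !mulr1 !addr0 ?add0r mcoeff0.
- by move: (e 1%N 0%N 3%N); rewrite /disc_poly !mcoeffD !mcoeffZ !mcoeffX !mn_eq /= !mulr0 !mulr1 !addr0 ?add0r mcoeff0.
- by move: (e 0%N 4%N 0%N); rewrite /disc_poly !mcoeffD !mcoeffZ !mcoeffX !mn_eq /= !mulr0 !mulr1 !addr0 ?add0r mcoeff0.
- by move: (e 0%N 3%N 1%N); rewrite /disc_poly !mcoeffD !mcoeffZ !mcoeffX !mn_eq /= !mulr0 !mulr1 !addr0 ?add0r mcoeff0.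
- by move: (e 0%N 2%N 2%N); rewrite /disc_poly !mcoeffD !mcoeffZ !mcoeffX !mn_eq /= !mulr0 !mulr1 !addr0 ?add0r mcoeff0.
- by move: (e 0%N 1%N 3%N); rewrite /disc_poly !mcoeffD !mcoeffZ !mcoeffX !mn_eq /= !mulr0 !mulr1 !addr0 ?add0r mcoeff0.
- by move: (e 0%N 0%N 4%N); rewrite /disc_poly !mcoeffD !mcoeffZ !mcoeffX !mn_eq /= !mulr0 !mulr1 !addr0 ?add0r mcoeff0.
Qed.

End Monomials.

Lemma quartic4 (R : comUnitRingType) (w : 'I_15 -> R) :
  2%:R \is a @GRing.unit R -> 4%:R \is a @GRing.unit R ->
  quartic w *+ 4 = disc_poly (coefs_of w).
Proof.
move=> u2 u4; have d4 (t : R) : t / 4%:R *+ 4 = t by rewrite -mulr_natr divrK.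
have d2 (t : R) : t / 2%:R *+ 4 = t *+ 2 by rewrite -[in RHS](divrK u2 t) mulr_natr -mulrnA.
rewrite /quartic /disc_poly !mnE !expr0 !expr1 !mulr1 !mul1r !mulrnDl.
do ?congr (_ + _); rewrite scalerMnl; congr (_ *: _).
all: rewrite /q400 /q310 /q220 /q130 /q040 /q301 /q211 /q121 /q031 /q202 /q112 /q022 /q103 /q013 /q004 /=.
all: rewrite ?(mulrnBl, mulrnDl) ?d4 ?d2; ring.
Qed.

(** * Base change and the discriminant in coordinates *)

Section MapCoefs.
Variables (R S : comNzRingType) (f : {rmorphism R -> S}).

Definition map_coefs (c : coefs R) : coefs S := Coefs
  (f (c_a200 c)) (f (c_a110 c)) (f (c_a101 c))
  (f (c_a020 c)) (f (c_a011 c)) (f (c_a002 c))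
  (f (c_b200 c)) (f (c_b110 c)) (f (c_b101 c))
  (f (c_b020 c)) (f (c_b011 c)) (f (c_b002 c))
  (f (c_c20 c)) (f (c_c11 c)) (f (c_c02 c)).

Lemma q_map c :
  [/\ q400 (map_coefs c) = f (q400 c), q310 (map_coefs c) = f (q310 c), q220 (map_coefs c) = f (q220 c), q130 (map_coefs c) = f (q130 c) & q040 (map_coefs c) = f (q040 c)] /\
  [/\ q301 (map_coefs c) = f (q301 c), q211 (map_coefs c) = f (q211 c), q121 (map_coefs c) = f (q121 c), q031 (map_coefs c) = f (q031 c) & q202 (map_coefs c) = f (q202 c)] /\
  [/\ q112 (map_coefs c) = f (q112 c), q022 (map_coefs c) = f (q022 c), q103 (map_coefs c) = f (q103 c), q013 (map_coefs c) = f (q013 c) & q004 (map_coefs c) = f (q004 c)].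
Proof.
by do !split; rewrite /q400 /q310 /q220 /q130 /q040 /q301 /q211 /q121 /q031 /q202 /q112 /q022 /q103 /q013 /q004 /map_coefs /=; ring.
Qed.

End MapCoefs.

Definition disc_val (R : comNzRingType) (c : coefs R) (X Y Z : R) : R :=
  q400 c * (X ^+ 4 * Y ^+ 0 * Z ^+ 0)
  + q310 c * (X ^+ 3 * Y ^+ 1 * Z ^+ 0)
  + q220 c * (X ^+ 2 * Y ^+ 2 * Z ^+ 0)
  + q130 c * (X ^+ 1 * Y ^+ 3 * Z ^+ 0)
  + q040 c * (X ^+ 0 * Y ^+ 4 * Z ^+ 0)
  + q301 c * (X ^+ 3 * Y ^+ 0 * Z ^+ 1)
  + q211 c * (X ^+ 2 * Y ^+ 1 * Z ^+ 1)
  + q121 c * (X ^+ 1 * Y ^+ 2 * Z ^+ 1)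
  + q031 c * (X ^+ 0 * Y ^+ 3 * Z ^+ 1)
  + q202 c * (X ^+ 2 * Y ^+ 0 * Z ^+ 2)
  + q112 c * (X ^+ 1 * Y ^+ 1 * Z ^+ 2)
  + q022 c * (X ^+ 0 * Y ^+ 2 * Z ^+ 2)
  + q103 c * (X ^+ 1 * Y ^+ 0 * Z ^+ 3)
  + q013 c * (X ^+ 0 * Y ^+ 1 * Z ^+ 3)
  + q004 c * (X ^+ 0 * Y ^+ 0 * Z ^+ 4).

(** The fifteen arguments of [Coefs] are the coordinates of the form attached to the field (F, G,
    H), and the hypothesis on h says that it is the Hessian of X F + Y G + Z H. *)
Lemma line_disc_val (R : comNzRingType) (X : 'I_3 -> R) h
    (f200 f110 f101 f020 f011 f002 g200 g110 g101 g020 g011 g002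
     h200 h110 h101 h020 h011 h002 : R) (t := fun f g h : R => X x0 * f + X x1 * g + X x2 * h) :
  [/\ h x0 x0 = t f200 g200 h200 *+ 2, h x0 x1 = t f110 g110 h110 & h x0 x2 = t f101 g101 h101] /\
  [/\ h x1 x1 = t f020 g020 h020 *+ 2, h x1 x2 = t f011 g011 h011 & h x2 x2 = t f002 g002 h002 *+ 2] ->
  line_disc X h = disc_val (Coefs (- h200) (- h110) (f200 - h101) (- h020) (f110 - h011) (f101 - h002)
    g200 (g110 - f200) g101 (g020 - f110) (g011 - f101) g002 (- f020) (- f011) (- f002))
    (X x0) (X x1) (X x2).
Proof.
rewrite /line_disc /disc_val /t => -[[-> -> ->] [-> -> ->]].
rewrite /q400 /q310 /q220 /q130 /q040 /q301 /q211 /q121 /q031 /q202 /q112 /q022 /q103 /q013 /q004 /=; ring.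
Qed.

Lemma disc_poly_val (R : comNzRingType) (c : coefs R) :
  disc_poly c = disc_val (map_coefs (@mpolyC 3 R) c) 'X_x0 'X_x1 'X_x2.
Proof.
have [[e1 e2 e3 e4 e5] [[e6 e7 e8 e9 e10] [e11 e12 e13 e14 e15]]] := q_map (@mpolyC 3 R) c.
rewrite /disc_val e1 e2 e3 e4 e5 e6 e7 e8 e9 e10 e11 e12 e13 e14 e15 /disc_poly !mnE.
by rewrite -!mul_mpolyC.
Qed.

(** * From the vector field and the form to the quartic *)

Section Link.
Variable k : closedFieldType.
Hypothesis char0 : [pchar k] =i pred0.
Implicit Types w : 'I_15 -> k.

Definition quad_a (R : comNzRingType) (c : coefs R) : {mpoly R[3]} :=
  quad3 (c_a200 c) (c_a110 c) (c_a101 c) (c_a020 c) (c_a011 c) (c_a002 c).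
Lemma mcoeff_quad_a (R : comNzRingType) (c : coefs R) :
  ((quad_a c)@_(mn 2 0 0) = c_a200 c) * ((quad_a c)@_(mn 1 1 0) = c_a110 c) * ((quad_a c)@_(mn 1 0 1) = c_a101 c) *
  ((quad_a c)@_(mn 0 2 0) = c_a020 c) * ((quad_a c)@_(mn 0 1 1) = c_a011 c) * ((quad_a c)@_(mn 0 0 2) = c_a002 c).
Proof.
rewrite /quad_a; case: (mcoeff_quad3 (c_a200 c) (c_a110 c) (c_a101 c) (c_a020 c) (c_a011 c) (c_a002 c)) => [[e1 e2 e3] [e4 e5 e6]].
by rewrite e1 e2 e3 e4 e5 e6.
Qed.
Definition quad_b (R : comNzRingType) (c : coefs R) : {mpoly R[3]} :=
  quad3 (c_b200 c) (c_b110 c) (c_b101 c) (c_b020 c) (c_b011 c) (c_b002 c).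
Lemma mcoeff_quad_b (R : comNzRingType) (c : coefs R) :
  ((quad_b c)@_(mn 2 0 0) = c_b200 c) * ((quad_b c)@_(mn 1 1 0) = c_b110 c) * ((quad_b c)@_(mn 1 0 1) = c_b101 c) *
  ((quad_b c)@_(mn 0 2 0) = c_b020 c) * ((quad_b c)@_(mn 0 1 1) = c_b011 c) * ((quad_b c)@_(mn 0 0 2) = c_b002 c).
Proof.
rewrite /quad_b; case: (mcoeff_quad3 (c_b200 c) (c_b110 c) (c_b101 c) (c_b020 c) (c_b011 c) (c_b002 c)) => [[e1 e2 e3] [e4 e5 e6]].
by rewrite e1 e2 e3 e4 e5 e6.
Qed.
Definition quad_c (R : comNzRingType) (c : coefs R) : {mpoly R[3]} :=
  quad3 0 0 0 (c_c20 c) (c_c11 c) (c_c02 c).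

Lemma mcoeff_quad_c (R : comNzRingType) (c : coefs R) :
  ((quad_c c)@_(mn 2 0 0) = 0) * ((quad_c c)@_(mn 1 1 0) = 0) * ((quad_c c)@_(mn 1 0 1) = 0) *
  ((quad_c c)@_(mn 0 2 0) = c_c20 c) * ((quad_c c)@_(mn 0 1 1) = c_c11 c) * ((quad_c c)@_(mn 0 0 2) = c_c02 c).
Proof.
rewrite /quad_c; case: (mcoeff_quad3 0 0 0 (c_c20 c) (c_c11 c) (c_c02 c)) => [[e1 e2 e3] [e4 e5 e6]].
by rewrite e1 e2 e3 e4 e5 e6.
Qed.

Let x : {mpoly k[3]} := 'X_x0.
Let y : {mpoly k[3]} := 'X_x1.
Let z : {mpoly k[3]} := 'X_x2.

Lemma formE w (c := coefs_of w) :
  form w = quad_a c *: vec3 (- y) x 0 + quad_b c *: vec3 (- z) 0 x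
           + quad_c c *: vec3 0 (- z) y.
Proof.
have scal (J : Type) (r : seq J) (u : J -> k) (m : J -> {mpoly k[3]}) (v : 'rV[{mpoly k[3]}]_3) :
    \sum_(t <- r) (u t)%:MP *: (m t *: v) = (\sum_(t <- r) u t *: m t) *: v.
  by rewrite scaler_suml; apply: eq_bigr => t _; rewrite scalerA mul_mpolyC.
have sum3 (u : nat -> nat -> nat -> k) :
    \sum_(t <- exps3) u t.1.1 t.1.2 t.2 *: (x ^+ t.1.1 * y ^+ t.1.2 * z ^+ t.2)
    = quad3 (u 2 0 0) (u 1 1 0) (u 1 0 1) (u 0 2 0) (u 0 1 1) (u 0 0 2).
  by rewrite /exps3 !big_cons big_nil addr0 /quad3 !mnE !addrA.
have sum2 (u : nat -> nat -> k) :
    \sum_(t <- exps2) u t.1 t.2 *: (y ^+ t.1 * z ^+ t.2)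
    = quad3 0 0 0 (u 2 0) (u 1 1) (u 0 2).
  rewrite /exps2 !big_cons big_nil addr0 /quad3 !mnE !addrA !scale0r !add0r.
  by rewrite expr0 !mul1r.
rewrite /form; congr (_ + _ + _).
- exact: (etrans (scal _ _ _ _ _) (congr1 (fun q => q *: _) (sum3 (acoef w)))).
- exact: (etrans (scal _ _ _ _ _) (congr1 (fun q => q *: _) (sum3 (bcoef w)))).
- exact: (etrans (scal _ _ _ _ _) (congr1 (fun q => q *: _) (sum2 (ccoef w)))).
Qed.

Lemma vec3E (R : nzRingType) (p q r : R) :
  [/\ vec3 p q r 0 x0 = p, vec3 p q r 0 x1 = q & vec3 p q r 0 x2 = r].
Proof. by rewrite !mxE !(x0E, x1E, x2E). Qed.

Lemma form_components w (c := coefs_of w) :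
  [/\ form w 0 x0 = - (y * quad_a c + z * quad_b c),
      form w 0 x1 = x * quad_a c - z * quad_c c
    & form w 0 x2 = x * quad_b c + y * quad_c c].
Proof.
rewrite formE -/c; move: (quad_a c) (quad_b c) (quad_c c) => A B C.
have entry (u v t : 'rV[{mpoly k[3]}]_3) i :
    (A *: u + B *: v + C *: t) 0 i = A * u 0 i + B * v 0 i + C * t 0 i.
  by rewrite !mxE.
have [a0 a1 a2] := vec3E (- y) x 0; have [b0 b1 b2] := vec3E (- z) 0 x.
have [c0 c1 c2] := vec3E 0 (- z) y.
rewrite !entry a0 a1 a2 b0 b1 b2 c0 c1 c2.
move: x y z => X Y Z; split; ring.
Qed.

Lemma is_double_double_curve w : is_double (coefs_of w) -> double_curve w.
Proof.
case=> s0 [s1 [s2 [p [q [r [e s]]]]]].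
pose l : {mpoly k[3]} := s0%:MP * x + s1%:MP * y + s2%:MP * z.
have hX i a : a%:MP * 'X_i \is [in k[3], 1.-homog].
  by rewrite mul_mpolyC; apply: dhomogZ; rewrite dhomogX /= mdeg1.
exists 1%N, l; split=> //.
- by rewrite !rpredD ?hX.
- apply/eqP => l0; apply: s.
  have ev v : l.@[v] = s0 * v x0 + s1 * v x1 + s2 * v x2.
    by rewrite /l !mevalD !mevalM !mevalC !mevalXU.
  rewrite l0 in ev; split.
  + by have := ev (vec_fun 1 0 0); rewrite meval0 /vec_fun !(x0E, x1E, x2E) mulr1 !mulr0 !addr0.
  + by have := ev (vec_fun 0 1 0); rewrite meval0 /vec_fun !(x0E, x1E, x2E) mulr1 !mulr0 !addr0 add0r.
  + by have := ev (vec_fun 0 0 1); rewrite meval0 /vec_fun !(x0E, x1E, x2E) mulr1 !mulr0 !add0r.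
have [f0 f1 f2] := form_components w; rewrite e in f0 f1 f2.
rewrite /quad_a /quad_b /quad_c /double_form /quad3 /= !mnE -!mul_mpolyC in f0 f1 f2.
apply: ord3_ind.
(* The cofactors of l^2 are the entries of p (x dy - y dx) + q (x dz - z dx) + r (y dz - z dy). *)
- exists (- (p%:MP * y + q%:MP * z)); rewrite f0 /l /x /y /z; ring.
- exists (p%:MP * x - r%:MP * z); rewrite f1 /l /x /y /z; ring.
- exists (q%:MP * x + r%:MP * y); rewrite f2 /l /x /y /z; ring.
Qed.

Let k2 : 2%:R != 0 :> k. Proof. exact: natr_pchar0. Qed.

Lemma quartic_eq0_disc w : quartic w = 0 -> disc_zero (coefs_of w).
Proof.
move=> Q0; apply: disc_poly_eq0; rewrite -quartic4 ?Q0 ?mul0rn // unitfE //.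
exact: natr_pchar0.
Qed.

Lemma quartic_eq0_double w : quartic w = 0 -> double_curve w.
Proof.
by move/quartic_eq0_disc/(disc_zero_is_double k2); apply: is_double_double_curve.
Qed.


Variables (w : 'I_15 -> k) (F G H : {mpoly k[3]}).
Hypothesis hw : vector_field_of w F G H.
Local Notation T := (tangency_eq F G H).
Local Notation X := (fun i : 'I_3 => 'X_i : dualring k).

(** Since [quad_c] does not involve x, the monomials divisible by x in the dy entry isolate the a,
    those in the dz entry the b, and the monomials of the dz entry free of x the c. *)
Lemma coefs_of_field : coefs_of w = Coefs
  (- H@_(mn 2 0 0)) (- H@_(mn 1 1 0)) (F@_(mn 2 0 0) - H@_(mn 1 0 1))
  (- H@_(mn 0 2 0)) (F@_(mn 1 1 0) - H@_(mn 0 1 1)) (F@_(mn 1 0 1) - H@_(mn 0 0 2))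
  G@_(mn 2 0 0) (G@_(mn 1 1 0) - F@_(mn 2 0 0)) G@_(mn 1 0 1)
  (G@_(mn 0 2 0) - F@_(mn 1 1 0)) (G@_(mn 0 1 1) - F@_(mn 1 0 1)) G@_(mn 0 0 2)
  (- F@_(mn 0 2 0)) (- F@_(mn 0 1 1)) (- F@_(mn 0 0 2)).
Proof.
have [_ _ _ fE] := hw; have [_ f1 f2] := form_components w.
rewrite fE in f1 f2; have [_ g1 g2] := vec3E (y * H - z * G) (z * F - x * H) (x * G - y * F).
rewrite g1 in f1; rewrite g2 in f2.
have m1 a b c : (z * F)@_(mn a b c) - (x * H)@_(mn a b c)
    = (x * quad_a (coefs_of w))@_(mn a b c) - (z * quad_c (coefs_of w))@_(mn a b c).
  by rewrite -!mcoeffB f1.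
have m2 a b c : (x * G)@_(mn a b c) - (y * F)@_(mn a b c)
    = (x * quad_b (coefs_of w))@_(mn a b c) + (y * quad_c (coefs_of w))@_(mn a b c).
  by rewrite -mcoeffB -mcoeffD f2.
rewrite /x /y /z in m1 m2.
have simp := (mcoeffXM, mcoeff_quad_a, mcoeff_quad_b, mcoeff_quad_c,
  sub0r, subr0, addr0, add0r).
rewrite /coefs_of; congr Coefs.
- by have h := m1 3%N 0%N 0%N; rewrite !simp in h; exact: (esym h).
- by have h := m1 2%N 1%N 0%N; rewrite !simp in h; exact: (esym h).
- by have h := m1 2%N 0%N 1%N; rewrite !simp in h; exact: (esym h).
- by have h := m1 1%N 2%N 0%N; rewrite !simp in h; exact: (esym h).
- by have h := m1 1%N 1%N 1%N; rewrite !simp in h; exact: (esym h).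
- by have h := m1 1%N 0%N 2%N; rewrite !simp in h; exact: (esym h).
- by have h := m2 3%N 0%N 0%N; rewrite !simp in h; exact: (esym h).
- by have h := m2 2%N 1%N 0%N; rewrite !simp in h; exact: (esym h).
- by have h := m2 2%N 0%N 1%N; rewrite !simp in h; exact: (esym h).
- by have h := m2 1%N 2%N 0%N; rewrite !simp in h; exact: (esym h).
- by have h := m2 1%N 1%N 1%N; rewrite !simp in h; exact: (esym h).
- by have h := m2 1%N 0%N 2%N; rewrite !simp in h; exact: (esym h).
- by have h := m2 0%N 3%N 0%N; rewrite !simp in h; exact: (esym h).
- by have h := m2 0%N 2%N 1%N; rewrite !simp in h; exact: (esym h).
- by have h := m2 0%N 1%N 2%N; rewrite !simp in h; exact: (esym h).
Qed.

Lemma mcoeff_tangency m :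
  T@_m = 'X_x0 * (F@_m)%:MP + 'X_x1 * (G@_m)%:MP + 'X_x2 * (H@_m)%:MP.
Proof.
rewrite (mcoeff_lincomb (fun i => 'X_i) (fun i => lift (vec3 F G H 0 i))) sum_ord3.
have liftE (q : {mpoly k[3]}) : (lift q)@_m = (q@_m)%:MP by apply: mcoeff_map_mpoly.
have [e0 e1 e2] := vec3E F G H.
congr (_ * _ + _ * _ + _ * _).
- exact: (etrans (liftE _) (congr1 (fun q => (q@_m)%:MP) e0)).
- exact: (etrans (liftE _) (congr1 (fun q => (q@_m)%:MP) e1)).
- exact: (etrans (liftE _) (congr1 (fun q => (q@_m)%:MP) e2)).
Qed.

Lemma hess_tangency (t := fun m => T@_m) :
  [/\ hess T x0 x0 = t (mn 2 0 0) *+ 2, hess T x0 x1 = t (mn 1 1 0) & hess T x0 x2 = t (mn 1 0 1)] /\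
  [/\ hess T x1 x1 = t (mn 0 2 0) *+ 2, hess T x1 x2 = t (mn 0 1 1) & hess T x2 x2 = t (mn 0 0 2) *+ 2].
Proof. by rewrite /hess /t !eqxx !neqx !mnU. Qed.

Lemma line_disc_quartic : line_disc X (hess T) = quartic w *+ 4.
Proof.
rewrite quartic4 ?unitfE ?natr_pchar0 // coefs_of_field disc_poly_val /map_coefs /= !mpolyCB !mpolyCN.
by apply: line_disc_val; have := hess_tangency; rewrite /= !mcoeff_tangency.
Qed.

End Link.

(** * The generic foliation *)

Lemma line_mx_morph (R S : comNzRingType) (f : {rmorphism R -> S}) X h i c :
  f (line_mx X h i c) = line_mx (fun a => f (X a)) (fun a b => f (h a b)) i c.
Proof.
have sk a b : f (skew X a b) = skew (fun a => f (X a)) a b.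
  by move: a b; do 2!apply: ord3_ind; rewrite /skew !(x0E, x1E, x2E) ?rmorphN ?rmorph0.
rewrite /line_mx /pole rmorph_sum; apply: eq_bigr => a _.
rewrite rmorphM sk rmorph_sum; congr (_ * _); apply: eq_bigr => b _.
by rewrite rmorphM sk.
Qed.

(** On a line through (1:0:0) these entries see only the first row of h, that is, the coefficient of
    x^2 and the mixed coefficient of x with the second parameter of the line. *)
Lemma line_mx_x0 (R : comNzRingType) (X : 'I_3 -> R) (h : 'I_3 -> 'I_3 -> R) :
  (forall i j, h i j = h j i) -> X x0 = 0 ->
  [/\ line_mx X h x1 x1 = - (X x2 ^+ 2 * h x0 x0),
      line_mx X h x2 x2 = - (X x1 ^+ 2 * h x0 x0),
      line_mx X h x0 x1 = - (X x2 * (X x1 * h x0 x2 - X x2 * h x0 x1))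
    & line_mx X h x0 x2 = X x1 * (X x1 * h x0 x2 - X x2 * h x0 x1)].
Proof.
move=> hsym X0; rewrite /line_mx /pole !sum_ord3 /skew !(x0E, x1E, x2E) X0.
by rewrite ?(hsym x1 x0) ?(hsym x2 x0); split; ring.
Qed.

Lemma disc_poly_homog (R : comNzRingType) (c : coefs R) : disc_poly c \is 4.-homog.
Proof.
rewrite /disc_poly; do ?apply: rpredD; apply: dhomogZ;
  by rewrite dhomogX /= mdegE sum_ord3 mn0 mn1 mn2.
Qed.

Lemma map_disc_poly (R S : comNzRingType) (f : {rmorphism R -> S}) (c : coefs R) :
  map_mpoly f (disc_poly c) = disc_poly (map_coefs f c).
Proof.
have [[e1 e2 e3 e4 e5] [[e6 e7 e8 e9 e10] [e11 e12 e13 e14 e15]]] := q_map f c.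
rewrite /disc_poly e1 e2 e3 e4 e5 e6 e7 e8 e9 e10 e11 e12 e13 e14 e15.
rewrite 14!(rmorphD (map_mpoly f)) /=.
by rewrite 15!map_mpolyZ 15!map_mpolyX.
Qed.

Lemma quarticE (R : comUnitRingType) (w : 'I_15 -> R) :
  2%:R \is a @GRing.unit R -> 4%:R \is a @GRing.unit R ->
  quartic w = 4%:R^-1 *: disc_poly (coefs_of w).
Proof.
by move=> u2 u4; rewrite -quartic4 // -scaler_nat scalerA mulVr // scale1r.
Qed.

Section Generic.
Variable k : closedFieldType.
Hypothesis char0 : [pchar k] =i pred0.
Implicit Types w : 'I_15 -> k.
Let k2 : 2%:R != 0 :> k. Proof. exact: natr_pchar0. Qed.

Let g (i : 'I_15) : {mpoly k[15]} := 'X_i.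

(* Nonvanishing of this cubic means that no line through (1:0:0) is invariant. *)
Definition pencil_form (R : comNzRingType) (c : coefs R) : R :=
  c_b101 c * c_a200 c ^+ 2 - (c_b110 c + c_a101 c) * c_a200 c * c_b200 c
    + c_a110 c * c_b200 c ^+ 2.

Lemma map_coefs_generic w : map_coefs (meval w) (coefs_of g) = coefs_of w.
Proof.
by rewrite /map_coefs /coefs_of /= /acoef /bcoef /ccoef /g; congr Coefs; rewrite mevalXU.
Qed.

Lemma pencil_form_eval w : (pencil_form (coefs_of g)).@[w] = pencil_form (coefs_of w).
Proof.
by rewrite -map_coefs_generic /pencil_form /map_coefs /=; ring.
Qed.

Lemma unit_nat n : n.+1%:R \is a @GRing.unit {mpoly k[15]}.
Proof.
rewrite -(rmorph_nat (@mpolyC 15 k)); apply: rmorph_unit.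
by rewrite unitfE natr_pchar0.
Qed.

Lemma specialize_quartic w : specialize w (quartic g) = quartic w.
Proof.
rewrite /specialize quarticE ?unit_nat // map_mpolyZ map_disc_poly.
rewrite rmorphV ?unit_nat // rmorph_nat quarticE ?unitfE ?natr_pchar0 //.
by rewrite map_coefs_generic.
Qed.

Lemma quartic_dhomog w : quartic w \is 4.-homog.
Proof.
by rewrite quarticE ?unitfE ?natr_pchar0 //; apply: dhomogZ; apply: disc_poly_homog.
Qed.

Lemma quartic_generic_homog : quartic g \is 4.-homog.
Proof. by rewrite quarticE ?unit_nat //; apply: dhomogZ; apply: disc_poly_homog. Qed.

Lemma quartic_generic_coef m : (quartic g)@_m \is 2.-homog.
Proof.
have inv4 : 4%:R^-1 = (4%:R^-1)%:MP :> {mpoly k[15]}.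
  by rewrite rmorphV ?unitfE ?natr_pchar0 // rmorph_nat.
rewrite quarticE ?unit_nat // mcoeffZ inv4 mul_mpolyC; apply: dhomogZ.
have hM i j : g i * g j \is 2.-homog by apply: (dhomogM (d := 1) (e := 1)); rewrite dhomogX /= mdeg1.
have hX i : g i ^+ 2 \is 2.-homog by rewrite expr2.
rewrite /disc_poly !mcoeffD; do ?apply: rpredD; rewrite mcoeffZ mcoeffX mulr_natr; apply: rpredMn.
all: rewrite /q400 /q310 /q220 /q130 /q040 /q301 /q211 /q121 /q031 /q202 /q112 /q022 /q103 /q013 /q004 /= /acoef /bcoef /ccoef.
all: repeat lazymatch goal with
  | |- is_true (in_mem (_ + _) _) => apply: rpredD
  | |- is_true (in_mem (- _) _) => rewrite rpredN
  | |- is_true (in_mem (- _ * _) _) => rewrite mulNr rpredN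
  | |- is_true (in_mem (_ *+ _) _) => apply: rpredMn
  | |- is_true (in_mem (_ ^+ _) _) => exact: hX
  | |- is_true (in_mem (_ * _) _) => exact: hM
  end.
Qed.

Definition cubic : {mpoly k[15]} := pencil_form (coefs_of g).

Lemma cubic_homog : cubic \is 3.-homog.
Proof.
have h1 i : g i \is 1.-homog by rewrite dhomogX /= mdeg1.
have h2 i j : g i * g j \is 2.-homog by apply: (dhomogM (d := 1) (e := 1)).
rewrite /cubic /pencil_form /= /acoef /bcoef; apply: rpredD; first apply: rpredB.
- by apply: (dhomogM (d := 1) (e := 2)); rewrite ?expr2.
- apply: (dhomogM (d := 2) (e := 1)) => //.
  by apply: (dhomogM (d := 1) (e := 1)) => //; apply: rpredD.
- by apply: (dhomogM (d := 1) (e := 2)); rewrite ?expr2.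
Qed.

Lemma cubic_neq0 : cubic != 0.
Proof.
(* Positions 0 and 8 are a200 and b101, whose monomial b101 a200^2 in the cubic then equals 1. *)
pose w (i : 'I_15) : k := ((i == inord 0) || (i == inord 8))%:R.
have val i j : (i < 15)%N -> (j < 15)%N -> (inord i == inord j :> 'I_15) = (i == j).
  by move=> hi hj; rewrite -val_eqE /= !inordK.
have w1 : pencil_form (coefs_of w) = 1.
  by rewrite /pencil_form /= /acoef /bcoef /= /w !val //=; ring.
apply: contraTneq isT => /(congr1 (meval w)); rewrite pencil_form_eval meval0 w1.
by move/eqP; rewrite oner_eq0.
Qed.

Section Field.
Variables (w : 'I_15 -> k) (F G H : {mpoly k[3]}).
Hypothesis hw : vector_field_of w F G H.
Local Notation X := (fun i : 'I_3 => 'X_i : dualring k).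
Local Notation N := (line_mx X (hess (tangency_eq F G H))).

(** The curve p = 0 contains a line eta through (1:0:0). Were N zero at eta, then E = 0 would make
    eta the tangent line at (1:0:0), or leave g2 = h2 = 0, and Z = 0 would then make the cubic
    vanish. *)
Lemma pencil_line_mx : pencil_form (coefs_of w) != 0 ->
  forall p, prime_divisor p -> exists i c, ~ dvd p (N i c).
Proof.
move=> nz p pp; apply: NNPP => nN.
have [e hp e_gt0] := prime_divisor_pos_deg pp.
have [eta [eta_p eta0 [l eta_l]]] := curve_meets_line hp e_gt0.
have {}nN i c : (N i c).@[eta] = 0.
  case: (classic (dvd p (N i c))) => [[q ->]|nd]; first by rewrite mevalM eta_p mul0r.
  by case: nN; exists i, c.
pose h i j := (hess (tangency_eq F G H) i j).@[eta].
have hsym i j : h i j = h j i by rewrite /h hess_sym.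
pose u i : k := (X i).@[eta]; have uE i : u i = eta i by rewrite /u mevalXU.
have N0 i c : line_mx u h i c = 0 by rewrite -(nN i c) (line_mx_morph (meval eta)).
have [[h00 h01 h02] _] := hess_tangency F G H.
rewrite !mcoeff_tangency in h00 h01 h02.
have {}h00 : h x0 x0 = (eta x1 * G@_(mn 2 0 0) + eta x2 * H@_(mn 2 0 0)) *+ 2.
  by rewrite /h h00 mevalMn !mevalD !mevalM !mevalC !mevalXU eta0 mul0r add0r.
have {}h01 : h x0 x1 = eta x1 * G@_(mn 1 1 0) + eta x2 * H@_(mn 1 1 0).
  by rewrite /h h01 !mevalD !mevalM !mevalC !mevalXU eta0 mul0r add0r.
have {}h02 : h x0 x2 = eta x1 * G@_(mn 1 0 1) + eta x2 * H@_(mn 1 0 1).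
  by rewrite /h h02 !mevalD !mevalM !mevalC !mevalXU eta0 mul0r add0r.
have N11 := N0 x1 x1; have N22 := N0 x2 x2; have N01 := N0 x0 x1; have N02 := N0 x0 x2.
have u0 : u x0 = 0 by rewrite uE.
have [e1 e2 e3 e4] := line_mx_x0 hsym u0.
rewrite e1 !uE in N11; rewrite e2 !uE in N22; rewrite e3 !uE in N01; rewrite e4 !uE in N02.
move: nz; rewrite (coefs_of_field hw) /pencil_form /=.
set g2 := G@_(mn 2 0 0) in h00 *; set h2 := H@_(mn 2 0 0) in h00 *.
set D := _ + _ => D0.
have cancel (r s : k) : r != 0 -> r * s = 0 -> s = 0.
  by move=> r0 /eqP; rewrite mulf_eq0 (negPf r0) => /eqP.
have lN (s : k) : - s = 0 -> s = 0 by move/eqP; rewrite oppr_eq0 => /eqP.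
pose Z := eta x1 * h x0 x2 - eta x2 * h x0 x1.
pose E := eta x1 * g2 + eta x2 * h2.
have E0 : h x0 x0 = 0 -> E = 0.
  move=> z00; apply: (cancel _ _ k2); rewrite -z00 h00 /E; ring.
have [y0 | z0] : eta x1 != 0 \/ eta x2 != 0.
- by move: l eta_l; apply: ord3_ind => el; [rewrite eta0 eqxx in el | left | right].
- have y20 : eta x1 ^+ 2 != 0 by rewrite expf_neq0.
  have {}E0 := E0 (cancel _ _ y20 (lN _ N22)); have Z0 : Z = 0 := cancel _ _ y0 N02.
  move/eqP: D0; apply; apply: (cancel _ _ y20).
  (* E = 0 reads eta1 g2 = -eta2 h2; eliminating eta2 from h2^2 Z in this way leaves the cubic times
     eta1^2. *)
  transitivity (h2 ^+ 2 * Z + E * ((G@_(mn 1 1 0) - H@_(mn 1 0 1)) * h2 * eta x1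
      - H@_(mn 1 1 0) * (eta x1 * g2 - eta x2 * h2))).
    by rewrite /D /Z /E h01 h02; ring.
  by rewrite E0 Z0 mulr0 mul0r addr0.
- have z20 : eta x2 ^+ 2 != 0 by rewrite expf_neq0.
  have {}E0 := E0 (cancel _ _ z20 (lN _ N11)).
  have Z0 : Z = 0 := cancel _ _ z0 (lN _ N01).
  move/eqP: D0; apply; apply: (cancel _ _ z20).
  transitivity (g2 ^+ 2 * Z + E * (G@_(mn 1 0 1) * (h2 * eta x2 - eta x1 * g2)
      + (G@_(mn 1 1 0) - H@_(mn 1 0 1)) * g2 * eta x2)).
    by rewrite /D /Z /E h01 h02; ring.
  by rewrite E0 Z0 mulr0 mul0r addr0.
Qed.

Lemma quartic_pushforward : quartic w != 0 ->
  (forall p, prime_divisor p -> exists i c, ~ dvd p (N i c)) ->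
  pushforward_is (ideal_D F G H) (quartic w).
Proof.
have [hF hG hH _] := hw; move=> Q0 nN.
apply: (pushforward_main char0 hF hG hH _ Q0 (quartic_dhomog w) nN).
exact: line_disc_quartic.
Qed.

Lemma dim_le1_pushforward : quartic w != 0 -> dim_le1 (ideal_D F G H) ->
  pushforward_is (ideal_D F G H) (quartic w).
Proof.
have [hF hG hH _] := hw; move=> Q0 dimD; apply: quartic_pushforward => //.
exact: (dim_le1_line_mx char0 hF hG hH dimD).
Qed.

End Field.

(** The square of the cubic is, up to a factor, a value of the quartic. *)
Lemma pencil_quartic_neq0 w : pencil_form (coefs_of w) != 0 -> quartic w != 0.
Proof.
apply: contraNneq => /(quartic_eq0_disc char0) /disc_zero_pencil e.
by rewrite /pencil_form e.
Qed.

Lemma quartic_represents_Phi : represents_Phi (quartic g).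
Proof.
split; first exact: quartic_generic_homog.
  by exists 2%N; apply: quartic_generic_coef.
exists 3%N, cubic; split; [exact: cubic_homog | exact: cubic_neq0 |].
move=> w _; rewrite pencil_form_eval specialize_quartic => nz.
have Q0 := pencil_quartic_neq0 nz; split; first exact: Q0.
by move=> F G H hw; exact: (quartic_pushforward hw Q0 (pencil_line_mx hw nz)).
Qed.

End Generic.

Theorem mainTheorem3 (k : closedFieldType) (char0 : [pchar k] =i pred0) :
  (forall w : 'I_15 -> k, foliation w -> ~ double_curve w ->
     Phi_at w (quartic w) /\
     (forall F G H : {mpoly k[3]}, vector_field_of w F G H ->
        dim_le1 (ideal_D F G H) -> pushforward_is (ideal_D F G H) (quartic w)))
  /\ represents_Phi (quartic (fun i : 'I_15 => 'X_i : {mpoly k[15]})).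
Proof.
have rep := quartic_represents_Phi char0.
split; last exact: rep.
move=> w _ ndc; have Q0 : quartic w != 0.
  by apply/eqP => Q0; apply: ndc; apply: quartic_eq0_double.
split; last by move=> F G H hw; apply: (dim_le1_pushforward char0 hw Q0).
exists (quartic (fun i : 'I_15 => 'X_i : {mpoly k[15]})), 1.
rewrite (specialize_quartic char0) scale1r; split=> //.
exact: oner_neq0.
Qed.
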